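(* For fixed $\rho,\sigma\in\{0,1\}$ and for the parameters $a_{12}=\lambda$, $b_{12}=\frac{c(\lambda+\mu+\gamma)}{1-c}$, $r_{12}=\frac{\lambda+c\mu+c^2\gamma}{c-1}$, let $d_k$ and $\tilde d_k$ for $k=0,1,2,\ldots$ be the vectors defined by the recurrence relations \begin{align*} u_k & := \big(A+\tfrac{\rho}{2}-k\big)^{-1}\left(\big(B-\tfrac{\sigma}{2}+\tfrac{1}{2}\big)d_{k-1} + \tfrac{1}{c}Su_{k-1} + \tfrac{1}{c}Rs_{k-1}\right),\\ d_k & := d_{k-1}+u_k,\quad s_k := \tfrac{1}{c}s_{k-1}+u_k\quad (k\geq 1),\qquad u_0=s_0=d_0:=a_0, \end{align*} and \begin{align*} \tilde u_k & := \big(B+\tfrac{\sigma}{2}-k\big)^{-1}\left(\big(A+\tfrac{\rho}{2}+1\big)\tilde d_{k-1} - \tfrac{1}{c}S\tilde u_{k-1} + \tfrac{1}{1-c}R\tilde s_{k-1}\right),\\ \tilde d_k & := \tilde d_{k-1}+\tilde u_k,\quad\tilde s_k := \tfrac{1}{1-c}\tilde s_{k-1}+\tilde u_k\quad (k\geq 1),\qquad \tilde u_0=\tilde s_0=\tilde d_0:=b_2, \end{align*} respectively. Moreover, for an arbitrary $n\geq 0$, let \begin{equation*} p_k := b_2 + \sum_{\ell=1}^n \left(\prod_{m=0}^{\ell-1}\frac{m+\frac{1}{2}-\sigma}{m+\frac{1}{2}-\sigma-k}\right)\tilde d_\ell,\quad \vartheta_k := \frac{1}{b_1^{\operatorname{T}}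 Jp_k}Jp_k,\quad J := \begin{pmatrix} 0 & 1 \\[1ex] -1 & 0 \end{pmatrix} \end{equation*} where $b_1^{\operatorname{T}} Jp_k\neq 0$ for sufficiently large $k$, say for $k\geq k_1$. If we define $\Theta_k := d_k^{\operatorname{T}}\vartheta_k$ for all $k\geq k_1$, then $\lim_{k\to\infty}\Theta_k = \Theta$, and the convergence being $\mathcal{O}(k^{\sigma-n-3/2})$.
   Context: Let $c>1$ and $\gamma,\lambda,\mu\in\mathbb{C}$. Consider the $2\times 2$ system associated with the ellipsoidal wave equation $z(z-1)(z-c)w''+\tfrac12(3z^2-2(1+c)z+c)w'+(\lambda+\mu z+\gamma z^2)w=0$ (via $y=(-cw',w)^{\operatorname{T}}$): $y'(z)=\left(\frac1z A+\frac{1}{z-1}B+\frac{1}{z-c}R-\frac1c S\right)y(z)$, with $A=\begin{pmatrix}-\frac12 & a_{12}\\ 0&0\end{pmatrix}$, $B=\begin{pmatrix}-\frac12 & b_{12}\\ 0&0\end{pmatrix}$, $R=\begin{pmatrix}-\frac12 & r_{12}\\ 0&0\end{pmatrix}$, $S=\begin{pmatrix}0&0\\1&0\end{pmatrix}$, where $a_{12}=\lambda$, $b_{12}=\frac{c(\lambda+\mu+\gamma)}{1-c}$, $r_{12}=\frac{\lambda+c\mu+c^2\gamma}{c-1}$. For $\rho,\sigma\in\{0,1\}$, let $\alpha_0=-\rho/2$ (eigenvalue of $A$), $\beta_1=(\sigma-1)/2$, $\beta_2=-\sigma/2$ (eigenvalues of $B$), with eigenvectors $a_0=\begin{pmatrix}2a_{12}(1-\rho)+\frac\rho2\\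 1-\rho\end{pmatrix}$, $b_1=\begin{pmatrix}2b_{12}\sigma+\frac{1-\sigma}{2}\\ \sigma\end{pmatrix}$, $b_2=\begin{pmatrix}2b_{12}(1-\sigma)+\frac\sigma2\\ 1-\sigma\end{pmatrix}$; $\delta=\beta_2-\beta_1=\tfrac12-\sigma$. The system has a Floquet solution $y_0(z)=z^{\alpha_0}h_0(z)$ near $0$ with $h_0$ holomorphic, $h_0(0)=a_0$, and near $z=1$ a fundamental matrix $Y(z)=H(z)\operatorname{diag}\big((1-z)^{\beta_1},(1-z)^{\beta_2}\big)\begin{pmatrix}1&0\\ q\log(1-z)&1\end{pmatrix}$ with $H$ holomorphic, $H(1)e_1=b_1$, $H(1)e_2=b_2$ ($q=0$ if $\delta\notin\mathbb{Z}$). The connection coefficients $\Theta,\Omega$ are defined by $y_0(z)=Y(z)\begin{pmatrix}\Theta\\ \Omega\end{pmatrix}$ on the common domain (i.e. $y_0=\Theta y_1+\Omega y_2$ with $y_j=Ye_j$). *)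

(* Defs.v *)
From mathcomp Require Export all_boot all_order all_algebra.
Import Order.TTheory GRing.Theory Num.Theory.
From mathcomp.real_closed Require Export complex.
From mathcomp Require Export all_classical all_reals all_analysis.
Export Order.TTheory GRing.Theory Num.Theory.
Export numFieldNormedType.Exports.

Set Implicit Arguments.
Unset Strict Implicit.
Unset Printing Implicit Defensive.

Local Open Scope ring_scope.
Local Open Scope complex_scope.
Local Open Scope classical_set_scope.

Definition C (R : realType) : numFieldType := (R[i] : numFieldType).

Section Ellipsoidal.
Variable R : realType.
Local Notation CC := (C R).

Definition RtoC (x : R) : CC := x%:C.

Definition has_derivC (f : R -> CC) (x : R) (l : CC) : Prop :=
  (fun h : R => (f (x + h) - f x) / RtoC h) @ (0 : R)^' --> l.


Definition has_derivV (y : R -> 'cV[CC]_2) (x : R) (v : 'cV[CC]_2) : Prop :=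
  forall i : 'I_2, has_derivC (fun t => y t i 0) x (v i 0).

Definition series_to (a : nat -> CC) (w : R) (l : CC) : Prop :=
  (fun N : nat => \sum_(k < N) a k * RtoC w ^+ k) @ \oo --> l.

(* f : R -> 'M_(m,n) is (the restriction to the real axis of) a function
   holomorphic near z0, i.e. given by a convergent power series in (z - z0) *)
Definition analytic_at {m n : nat} (f : R -> 'M[CC]_(m, n)) (z0 : R) : Prop :=
  exists r : R, 0 < r /\ exists a : nat -> 'M[CC]_(m, n),
    forall x : R, `|x - z0| < r ->
      forall (i : 'I_m) (j : 'I_n), series_to (fun k => a k i j) (x - z0) (f x i j).

Variables (c : R) (lam mu gam : CC) (rho sig : nat).

Definition a12 : CC := lam.
Definition b12 : CC := RtoC c * (lam + mu + gam) / RtoC (1 - c).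
Definition r12 : CC := (lam + RtoC c * mu + RtoC (c ^+ 2) * gam) / RtoC (c - 1).

Definition mx2 (x11 x12 x21 x22 : CC) : 'M[CC]_2 :=
  \matrix_(i < 2, j < 2)
    if i == 0 then (if j == 0 then x11 else x12) else (if j == 0 then x21 else x22).
Definition vec2 (x1 x2 : CC) : 'cV[CC]_2 :=
  \col_(i < 2) if i == 0 then x1 else x2.

Definition Amx : 'M[CC]_2 := mx2 (- (1/2)) a12 0 0.
Definition Bmx : 'M[CC]_2 := mx2 (- (1/2)) b12 0 0.
Definition Rmx : 'M[CC]_2 := mx2 (- (1/2)) r12 0 0.
Definition Smx : 'M[CC]_2 := mx2 0 0 1 0.
Definition Jmx : 'M[CC]_2 := mx2 0 1 (-1) 0.

Definition rhoR : R := rho%:R.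
Definition sigR : R := sig%:R.

Definition alpha0 : R := - rhoR / 2.
Definition beta1 : R := (sigR - 1) / 2.
Definition beta2 : R := - sigR / 2.
Definition delta : R := beta2 - beta1.

Definition a0 : 'cV[CC]_2 :=
  vec2 (2 * a12 * RtoC (1 - rhoR) + RtoC (rhoR / 2)) (RtoC (1 - rhoR)).
Definition b1 : 'cV[CC]_2 :=
  vec2 (2 * b12 * RtoC sigR + RtoC ((1 - sigR) / 2)) (RtoC sigR).
Definition b2 : 'cV[CC]_2 :=
  vec2 (2 * b12 * RtoC (1 - sigR) + RtoC (sigR / 2)) (RtoC (1 - sigR)).

Definition coefM (z : R) : 'M[CC]_2 :=
  (RtoC z)^-1 *: Amx + (RtoC (z - 1))^-1 *: Bmx + (RtoC (z - c))^-1 *: Rmx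
  - (RtoC c)^-1 *: Smx.

Definition solves_on01 (y : R -> 'cV[CC]_2) : Prop :=
  forall z : R, 0 < z < 1 -> has_derivV y z (coefM z *m y z).

Fixpoint uds (k : nat) : 'cV[CC]_2 * 'cV[CC]_2 * 'cV[CC]_2 :=
  match k with
  | 0%N => (a0, a0, a0)
  | k'.+1 =>
      let: (u, d, s) := uds k' in
      let u' := invmx (Amx + (RtoC (rhoR / 2 - k'.+1%:R))%:M) *m
                  ((Bmx + (RtoC (- sigR / 2 + 1 / 2))%:M) *m d
                   + (RtoC c)^-1 *: (Smx *m u) + (RtoC c)^-1 *: (Rmx *m s)) in
      (u', d + u', (RtoC c)^-1 *: s + u')
  end.
Definition d_ (k : nat) : 'cV[CC]_2 := (uds k).1.2.

Fixpoint udst (k : nat) : 'cV[CC]_2 * 'cV[CC]_2 * 'cV[CC]_2 :=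
  match k with
  | 0%N => (b2, b2, b2)
  | k'.+1 =>
      let: (u, d, s) := udst k' in
      let u' := invmx (Bmx + (RtoC (sigR / 2 - k'.+1%:R))%:M) *m
                  ((Amx + (RtoC (rhoR / 2 + 1))%:M) *m d
                   - (RtoC c)^-1 *: (Smx *m u) + (RtoC (1 - c))^-1 *: (Rmx *m s)) in
      (u', d + u', (RtoC (1 - c))^-1 *: s + u')
  end.
Definition dt_ (k : nat) : 'cV[CC]_2 := (udst k).1.2.

Variable n : nat.

Definition p_ (k : nat) : 'cV[CC]_2 :=
  b2 + \sum_(1 <= l < n.+1)
         RtoC (\prod_(0 <= m < l)
                 ((m%:R + 1 / 2 - sigR) / (m%:R + 1 / 2 - sigR - k%:R))) *: dt_ l.

Definition den_ (k : nat) : CC := (b1^T *m Jmx *m p_ k) 0 0.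

Definition vartheta_ (k : nat) : 'cV[CC]_2 := (den_ k)^-1 *: (Jmx *m p_ k).

Definition Theta_ (k : nat) : CC := ((d_ k)^T *m vartheta_ k) 0 0.

End Ellipsoidal.

Notation "''M2[' R ]" := ('M[C R]_2) (at level 0, format "''M2[' R ]").
Notation "''V2[' R ]" := ('cV[C R]_2) (at level 0, format "''V2[' R ]").

(* Main.v *)
Require Import Defs.
From mathcomp Require Import ring lra zify.
Set Implicit Arguments.
Unset Strict Implicit.
Unset Printing Implicit Defensive.
Local Open Scope ring_scope.
Local Open Scope complex_scope.
Local Open Scope classical_set_scope.

(* The vectors u_k are the Taylor coefficients at 0 of
   U(z) = z^(-alpha0) (1-z)^(-beta1) y0(z), and sum d_k z^k = U(z) / (1-z).
   Truncating the expansion at 1 of the second local solution gives an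
   approximate solution e_k p_k of the recurrence, where e_k is the coefficient
   of z^k in (1-z)^(delta-1), with residual O(e_k k^(-n-1)).  A Lyapunov argument
   then yields d_k = xi b_1 + l e_k p_k + O(e_k k^(-n-1)) for some constants
   xi, l; pairing with J p_k kills the middle term, as p^T J p = 0.
   Comparing (1-z) sum d_k z^k with the connection formula as z tends to 1
   (Abel summation) identifies xi with Theta.  That y0 is the gauged series is
   the uniqueness of the Floquet solution, obtained from an energy estimate for
   the difference of two candidates.  Since delta is 1/2 or -1/2, the logarithmic
   coefficient q always vanishes. *)

(** The gauge factor at 1 puts $b_1$ in the kernel of the residue there, so a constant survives
    along $b_1$, while the $b_2$ direction carries $e_k \sim k^{sig-1/2}$. For [sig = 1] this grows,
    so $d_k$ need not converge. Convergence is therefore first read through a linear form that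
    annihilates $b_2$; its error is $O(e_k/k)$, which tends to 0 in both cases. The recurrence is
    analysed twice. Without residual it gives the amplitude $l$ of the $b_2$ part. After subtraction
    of $l$ times the approximate solution the relative amplitude tends to 0, and then every round of
    estimates gains one factor $1/k$ until the order of the residual is reached. The pole at $c$ is
    carried by the auxiliary sequence $s_k$, the coefficients of $U(z)/(1-z/c)$. It keeps the
    recurrence of first order and brings in the contraction factor $1/c < 1$. The first pass also
    yields linear growth of the coefficients, hence convergence of the series for $|z|<1$. The
    comparison with $y_0$ thus takes place on the whole real interval $(0,1)$, without analytic
    continuation. *)

(** * Real-valued modulus of complex numbers *)

Section Modulus.
Variable R : realType.
Implicit Types (x y z : C R) (a b : R).

(** The norm of [C R] takes its values in [C R]; a modulus with values in [R] makes real order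
    lemmas and [lra] applicable. *)
Definition cn z : R := complex.Re `|z|.

Lemma cnE z : `|z| = RtoC (cn z).
Proof. by rewrite /cn /RtoC normc_def. Qed.

Lemma RtoC_inj : injective (@RtoC R). Proof. exact: complexI. Qed.
Lemma RtoCD a b : RtoC (a + b) = RtoC a + RtoC b. Proof. exact: rmorphD. Qed.
Lemma RtoCB a b : RtoC (a - b) = RtoC a - RtoC b. Proof. exact: rmorphB. Qed.
Lemma RtoCN a : RtoC (- a) = - RtoC a. Proof. exact: rmorphN. Qed.
Lemma RtoCM a b : RtoC (a * b) = RtoC a * RtoC b. Proof. exact: rmorphM. Qed.
Lemma RtoCV a : RtoC (a^-1) = (RtoC a)^-1. Proof. exact: fmorphV. Qed.
Lemma RtoC0 : RtoC (0 : R) = 0. Proof. by []. Qed.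
Lemma RtoC1 : RtoC (1 : R) = 1. Proof. by []. Qed.
Lemma RtoC_nat n : RtoC (n%:R : R) = n%:R. Proof. exact: rmorph_nat. Qed.
Lemma RtoC_half : RtoC (1 / 2 : R) = 1 / 2. Proof. by rewrite RtoCM RtoCV RtoC_nat. Qed.
Lemma RtoCX a n : RtoC (a ^+ n) = RtoC a ^+ n. Proof. exact: rmorphXn. Qed.
Lemma RtoC_eq0 a : (RtoC a == 0) = (a == 0). Proof. exact: fmorph_eq0. Qed.
Lemma ler_RtoC a b : (RtoC a <= RtoC b) = (a <= b).
Proof. by rewrite /RtoC lecR. Qed.

Lemma cn_ge0 z : 0 <= cn z.
Proof. by rewrite /cn normc_def sqrtr_ge0. Qed.
Lemma cn0 : cn 0 = 0. Proof. by apply: RtoC_inj; rewrite -cnE normr0. Qed.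
Lemma cn1 : cn 1 = 1. Proof. by apply: RtoC_inj; rewrite -cnE normr1. Qed.
Lemma cnM y z : cn (y * z) = cn y * cn z.
Proof. by apply: RtoC_inj; rewrite RtoCM -!cnE normrM. Qed.
Lemma cnN z : cn (- z) = cn z.
Proof. by apply: RtoC_inj; rewrite -!cnE normrN. Qed.
Lemma cnV z : cn (z^-1) = (cn z)^-1.
Proof. by apply: RtoC_inj; rewrite RtoCV -!cnE normfV. Qed.
Lemma cnD y z : cn (y + z) <= cn y + cn z.
Proof. by rewrite -ler_RtoC RtoCD -!cnE ler_normD. Qed.
Lemma cnB y z : cn (y - z) <= cn y + cn z.
Proof. by rewrite -(cnN z) cnD. Qed.
Lemma cnC y z : cn (y - z) = cn (z - y).
Proof. by rewrite -cnN opprB. Qed.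
Lemma cn_RtoC a : cn (RtoC a) = `|a|.
Proof. by rewrite /cn /RtoC normc_def/= expr0n/= addr0 sqrtr_sqr. Qed.
Lemma cn_eq0 z : (cn z == 0) = (z == 0).
Proof. by rewrite -(inj_eq RtoC_inj) -cnE normr_eq0. Qed.
Lemma cn_Re z : `|complex.Re z| <= cn z.
Proof. by rewrite -ler_RtoC -cnE normc_ge_Re. Qed.
Lemma cn_Im z : `|complex.Im z| <= cn z.
Proof.
rewrite /cn normc_def/= -sqrtr_sqr ler_wsqrtr// lerDr sqr_ge0//.
Qed.
Lemma cn_le z : cn z <= `|complex.Re z| + `|complex.Im z|.
Proof.
have h0 : 0 <= `|complex.Re z| + `|complex.Im z| by rewrite addr_ge0.
rewrite /cn normc_def/= -[leRHS]ger0_norm// -sqrtr_sqr ler_wsqrtr//.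
by rewrite sqrrD !real_normK ?num_real// lerD2r lerDl mulrn_wge0// mulr_ge0.
Qed.
End Modulus.

(** * Real sequences: limits with rates and discrete Gronwall bounds *)

Section RealSequences.
Variable R : realType.
Implicit Types (a w Q X : nat -> R) (K L th : R).

(** [a - K * w] is nondecreasing, [a + K * w] is nonincreasing, and every term of the first lies
    below every term of the second; [l] is the supremum of the first. *)
Lemma bracketed_limit a w K k0 :
  (forall k, (k0 <= k)%N -> 0 <= K * w k) ->
  (forall k, (k0 <= k)%N -> `|a k.+1 - a k| <= K * (w k - w k.+1)) ->
  exists l, forall k, (k0 <= k)%N -> `|a k - l| <= K * w k.
Proof.
move=> w0 aw.
have lo i j : (k0 <= i)%N -> a i - K * w i <= a (i + j)%N - K * w (i + j)%N.
  move=> ki; elim: j => [|j IH]; first by rewrite addn0.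
  rewrite addnS (le_trans IH)//.
  have := aw (i + j)%N (leq_trans ki (leq_addr _ _)); rewrite ler_norml; lra.
have up i j : (k0 <= i)%N -> a (i + j)%N + K * w (i + j)%N <= a i + K * w i.
  move=> ki; elim: j => [|j IH]; first by rewrite addn0.
  rewrite addnS (le_trans _ IH)//.
  have := aw (i + j)%N (leq_trans ki (leq_addr _ _)); rewrite ler_norml; lra.
have cross i j : (k0 <= i)%N -> (k0 <= j)%N -> a i - K * w i <= a j + K * w j.
  move=> ki kj; apply: le_trans (lo i j ki) _.
  apply: le_trans _ (up j i kj); rewrite (addnC j i).
  have := w0 (i + j)%N (leq_trans ki (leq_addr _ _)); lra.
pose A := [set x | exists2 i, (k0 <= i)%N & x = a i - K * w i].
have A0 : A !=set0 by exists (a k0 - K * w k0); exists k0.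
have Aub j : (k0 <= j)%N -> ubound A (a j + K * w j).
  by move=> kj _ [i ki ->]; exact: cross.
have supA : has_sup A by split=> //; exists (a k0 + K * w k0); exact: Aub.
exists (sup A) => k kk; rewrite ler_norml.
have h1 : a k - K * w k <= sup A by apply: ub_le_sup; [case: supA|exists k].
have h2 : sup A <= a k + K * w k by apply: ge_sup => //; exact: Aub.
by apply/andP; split; lra.
Qed.

Lemma bernoulli_sub (x : R) j : 0 <= x <= 1 -> 1 - j%:R * x <= (1 - x) ^+ j.
Proof.
move=> /andP[x0 x1]; elim: j => [|j IH]; first by rewrite mul0r subr0 expr0.
rewrite exprS -natr1; have j0 : 0 <= j%:R :> R by [].
apply: le_trans (ler_wpM2l _ IH); last by lra.
have := mulr_ge0 j0 (mulr_ge0 x0 x0); nra.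
Qed.

Lemma invS_gt0 k : 0 < (k.+1%:R)^-1 :> R. Proof. by rewrite invr_gt0. Qed.
Lemma invS_le1 k : (k.+1%:R)^-1 <= 1 :> R.
Proof. by rewrite invf_le1// ler1n. Qed.
Lemma invS_le k : (k.+2%:R)^-1 <= (k.+1%:R)^-1 :> R.
Proof. by rewrite lef_pV2 ?posrE// ler_nat. Qed.

(* Going from [k] to [k + 1] the weight [(k+1)^-j] loses a factor that tends to 1, hence eventually exceeds [th]. *)
Lemma contraction_power_decay Q th K j k0 :
  0 <= th < 1 -> 0 <= K -> (forall k, 0 <= Q k) ->
  (forall k, (k0 <= k)%N -> Q k.+1 <= th * Q k + K * (k.+1%:R)^-1 ^+ j) ->
  exists M k1, 0 <= M /\ forall k, (k1 <= k)%N -> Q k <= M * (k.+1%:R)^-1 ^+ j.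
Proof.
move=> /andP[th0 th1] K0 Q0 HQ.
(* [q] lies midway between [th] and 1: the ratio of consecutive weights eventually exceeds [q], and
   the gap [q - th] pays for the forcing term. *)
pose q := (1 + th) / 2.
have [N HN] : exists N, forall k, (N <= k)%N -> q <= (1 - (k.+2%:R)^-1) ^+ j.
  pose N := Num.truncn (2 * j%:R / (1 - th) : R).
  exists N => k Nk; apply: le_trans (bernoulli_sub _ _); last first.
    by rewrite (ltW (invS_gt0 _)) invS_le1.
  have : 2 * j%:R / (1 - th) < k.+2%:R :> R.
    apply: lt_le_trans (truncnS_gt _) _; rewrite ler_nat ltnS (leq_trans Nk)//.
  rewrite ltr_pdivrMr ?subr_gt0// => h.
  have : j%:R * (k.+2%:R)^-1 <= (1 - th) / 2 :> R.
    by rewrite ler_pdivrMr//; lra.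
  set z : R := j%:R * _ => hz; rewrite /q; lra.
pose k1 := maxn k0 N.
(* The first entry gives [K <= M * (q - th)] for the induction step; the second starts the induction
   at [k1]. *)
pose M := Num.max (2 * K / (1 - th)) (Q k1 / ((k1.+1%:R)^-1 ^+ j)).
have M1 : 2 * K / (1 - th) <= M by rewrite le_max lexx.
have M0 : 0 <= M by apply: le_trans M1; rewrite divr_ge0//; lra.
exists M, k1; split=> // k /subnK <-; elim: (k - k1)%N => [|i].
  rewrite add0n -ler_pdivrMr ?exprn_gt0 ?invS_gt0//.
  by rewrite le_max lexx orbT.
rewrite addSn; set r := (i + k1)%N => IH.
have kr : (k0 <= r)%N by rewrite /r /k1; lia.
have Nr : (N <= r)%N by rewrite /r /k1; lia.
apply: le_trans (HQ _ kr) _.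
have -> : (r.+2%:R)^-1 ^+ j = (r.+1%:R)^-1 ^+ j * (1 - (r.+2%:R)^-1) ^+ j :> R.
  rewrite -exprMn; congr (_ ^+ _).
  have : (r.+1%:R : R) != 0 by [].
  have : (r.+2%:R : R) != 0 by [].
  rewrite -!natr1; set t : R := r%:R => h2 h1.
  by field; rewrite h2 h1.
have h1 := HN r Nr.
set g := (r.+1%:R)^-1 ^+ j in IH *.
have g0 : 0 < g by rewrite exprn_gt0 ?invS_gt0.
set v := (1 - (r.+2%:R)^-1) ^+ j in h1 *.
have hM : K <= M * (q - th).
  have -> : q - th = (1 - th) / 2 by rewrite /q; lra.
  by move: M1; rewrite ler_pdivrMr ?subr_gt0//; lra.
have hv : M * q <= M * v by rewrite ler_wpM2l.
have hQ : th * Q r <= th * (M * g) by rewrite ler_wpM2l.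
have : (th * M + K) * g <= (M * v) * g by rewrite ler_wpM2r ?(ltW g0)//; lra.
lra.
Qed.

(** Discrete Gronwall: $X_k\exp(2L/(k+1))$ is nonincreasing because $2L/(k+1) - 2L/(k+2) \ge
    L/(k+1)^2$. *)
Lemma summable_growth_bounded X L k0 :
  0 <= L -> (forall k, 0 <= X k) ->
  (forall k, (k0 <= k)%N -> X k.+1 <= (1 + L * (k.+1%:R)^-1 ^+ 2) * X k) ->
  exists M, 0 <= M /\ forall k, (k0 <= k)%N -> X k <= M.
Proof.
move=> L0 X0 HX.
have mono i : X (i + k0)%N * expR (2 * L * ((i + k0).+1%:R)^-1) <=
     X k0 * expR (2 * L * (k0.+1%:R)^-1).
  elim: i => [|i]; first by rewrite add0n.
  rewrite addSn; set r := (i + k0)%N => IH; apply: le_trans IH.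
  have kr : (k0 <= r)%N by rewrite leq_addl.
  have ee : L * (r.+1%:R)^-1 ^+ 2 + 2 * L * (r.+2%:R)^-1 <= 2 * L * (r.+1%:R)^-1.
    rewrite -subr_ge0.
    have -> : 2 * L * (r.+1%:R)^-1 - (L * (r.+1%:R)^-1 ^+ 2 + 2 * L * (r.+2%:R)^-1)
      = L * (r%:R * (r.+1%:R)^-1 ^+ 2 * (r.+2%:R)^-1).
      have : (r.+1%:R : R) != 0 by [].
      have : (r.+2%:R : R) != 0 by [].
      rewrite -!natr1; set t : R := r%:R => h2 h1.
      by field; rewrite h2 h1.
    by rewrite mulr_ge0// !mulr_ge0.
  apply: le_trans (ler_wpM2r (expR_ge0 _) (HX _ kr)) _.
  rewrite (mulrC (1 + _)) -(mulrA (X r)) ler_wpM2l//.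
  apply: le_trans (ler_wpM2r (expR_ge0 _) (expR_ge1Dx _)) _.
  by rewrite -expRD ler_expR.
exists (X k0 * expR (2 * L * (k0.+1%:R)^-1)); split.
  by rewrite mulr_ge0// expR_ge0.
move=> k /subnK <-; apply: le_trans _ (mono (k - k0)%N).
rewrite ler_peMr// -expR0 ler_expR mulr_ge0// mulr_ge0//.
Qed.
End RealSequences.

(** * A slowly varying complex amplitude coupled to a contracted remainder *)

Section ComplexSequences.
Variable R : realType.

Lemma cn_bracketed_limit (a : nat -> C R) (w : nat -> R) (K : R) k0 :
  (forall k, (k0 <= k)%N -> 0 <= K * w k) ->
  (forall k, (k0 <= k)%N -> cn (a k.+1 - a k) <= K * (w k - w k.+1)) ->
  exists l, forall k, (k0 <= k)%N -> cn (a k - l) <= 2 * K * w k.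
Proof.
move=> w0 aw.
have [l1 h1] : exists l, forall k, (k0 <= k)%N -> `|complex.Re (a k) - l| <= K * w k.
  apply: bracketed_limit => // k kk; apply: le_trans (aw k kk).
  by rewrite -raddfB; exact: cn_Re.
have [l2 h2] : exists l, forall k, (k0 <= k)%N -> `|complex.Im (a k) - l| <= K * w k.
  apply: bracketed_limit => // k kk; apply: le_trans (aw k kk).
  by rewrite -raddfB; exact: cn_Im.
exists (Complex l1 l2) => k kk; apply: le_trans (cn_le _) _.
rewrite !raddfB/=; have := h1 k kk; have := h2 k kk; lra.
Qed.

Section ErrorSystem.
Variables (tau : nat -> C R) (Q : nat -> R) (th K : R) (m k0 : nat).
Hypotheses (th01 : 0 <= th < 1) (K0 : 0 <= K) (Q0 : forall k, 0 <= Q k).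
Local Notation h k := ((k.+1%:R : R)^-1).
Hypothesis HQ : forall k, (k0 <= k)%N ->
  Q k.+1 <= th * Q k + K * (h k * cn (tau k) + h k ^+ m.+1).
Hypothesis Htau : forall k, (k0 <= k)%N ->
  cn (tau k.+1 - tau k) <= K * h k * (Q k + h k * cn (tau k) + h k ^+ m.+1).

Let hm k : h k ^+ m.+1 <= h k.
Proof. by rewrite exprS ler_piMr ?(ltW (invS_gt0 _ _))// exprn_ile1// invS_le1. Qed.

(* Lyapunov function [|tau_k| + K / (1 - th) / (k+1) * Q_k]. *)
Lemma error_system_bounded :
  exists M, 0 <= M /\ forall k, (k0 <= k)%N -> cn (tau k) <= M.
Proof.
have /andP[th0 th1] := th01.
(* This [a] solves [K + a * th = a], so the terms in [h k * Q k] coming from the increment of [tau]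
   and from the contraction of [Q] add up to exactly the old [a * h k * Q k]. *)
pose a := K / (1 - th).
have a0 : 0 <= a by apply: divr_ge0 => //; lra.
have aE : K + a * th = a by rewrite /a; field; lra.
(* The summand 1 absorbs the inhomogeneous terms, which are at most [L * h k ^+ 2]. *)
pose X k := cn (tau k) + a * h k * Q k + 1.
pose L := K + a * K.
have L0 : 0 <= L by rewrite addr_ge0// mulr_ge0.
have X0 k : 0 <= X k.
  by rewrite /X !addr_ge0 ?cn_ge0// mulr_ge0// mulr_ge0.
have [k kk|M [M0 HM]] := @summable_growth_bounded _ X L k0 L0 X0; last first.
  exists M; split=> // k kk; apply: le_trans (HM k kk).
  rewrite /X -addrA lerDl addr_ge0// mulr_ge0// mulr_ge0//.
have hk0 := invS_gt0 R k; have hk1 := invS_le1 R k; have hS := invS_le R k.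
have := HQ kk; have := Htau kk.
have := hm k; rewrite /X; set H := h k; set Hm := H ^+ m.+1 => hHm H2 H1.
have T : cn (tau k.+1) <= cn (tau k) + cn (tau k.+1 - tau k).
  by rewrite -{1}(subrK (tau k) (tau k.+1)) addrC cnD.
rewrite -/H in hk0 hk1 hS.
have T0 := cn_ge0 (tau k).
have step1 : a * h k.+1 * Q k.+1 <= a * H * (th * Q k + K * (H * cn (tau k) + H)).
  apply: ler_pM => //; first by rewrite mulr_ge0.
    by rewrite ler_wpM2l.
  by apply: le_trans H1 _; rewrite lerD2l ler_wpM2l// lerD2l.
have step2 : cn (tau k.+1 - tau k) <= K * H * (Q k + H * cn (tau k) + H).
  by apply: le_trans H2 _; rewrite ler_wpM2l ?mulr_ge0 ?(ltW hk0)// lerD2l.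
have e : (1 + L * H ^+ 2) * (cn (tau k) + a * H * Q k + 1) =
  cn (tau k) + (a * H * (th * Q k + K * (H * cn (tau k) + H)) +
   K * H * (Q k + H * cn (tau k) + H)) + 1 + L * H ^+ 2 * (a * H * Q k)
   + (a - (K + a * th)) * (H * Q k) by rewrite /L; ring.
rewrite e aE subrr mul0r addr0.
have H0 := ltW hk0.
have : 0 <= L * H ^+ 2 * (a * H * Q k) by apply: mulr_ge0; apply: mulr_ge0 => //; [exact: exprn_ge0|exact: mulr_ge0].
clear -step1 step2 T; move: step1 step2 T.
move: (a * h k.+1 * Q k.+1) (a * H * _) (K * H * _) (L * _ * _) (cn (tau k.+1)) (cn (_ - _)) => *; lra.
Qed.

(** Brings increments of order $k^{-j-2}$ into the telescoping form that [cn_bracketed_limit]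
    requires. *)
Let gap k j : h k ^+ j.+2 <= 2 * (h k ^+ j.+1 - h k.+1 ^+ j.+1).
Proof.
have hk0 := invS_gt0 R k; have hk1 := invS_le1 R k; have hS := invS_le R k.
have hS0 := invS_gt0 R k.+1.
have : h k.+1 ^+ j.+1 <= h k ^+ j * h k.+1.
  rewrite exprSr; apply: ler_wpM2r; first exact: ltW.
  by apply: lerXn2r => //; rewrite nnegrE ltW.
have -> : h k ^+ j.+2 = h k ^+ j * h k ^+ 2 by rewrite -exprD addn2.
have e : h k ^+ 2 <= 2 * (h k - h k.+1).
  rewrite -subr_ge0.
  have -> : 2 * (h k - h k.+1) - h k ^+ 2 = k%:R * h k ^+ 2 * h k.+1.
    have : (k.+1%:R : R) != 0 by [].
    have : (k.+2%:R : R) != 0 by [].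
    rewrite -!natr1; set t : R := k%:R => h2 h1.
    by field; rewrite h2 h1.
  by rewrite !mulr_ge0// ltW.
have p0 : 0 <= h k ^+ j by rewrite exprn_ge0 ?ltW.
have := ler_wpM2l p0 e; rewrite [h k ^+ j.+1]exprSr.
rewrite (mulrCA _ 2) (mulrBr (h k ^+ j)).
move: (h k ^+ j * h k ^+ 2) (h k ^+ j * h k) (h k ^+ j * h k.+1) => x y z.
by move: (h k.+1 ^+ j.+1) => *; lra.
Qed.

(** If [tau] is $O(k^{-j})$, the contraction makes [Q] of order $k^{-j-1}$, hence the increments of
    [tau] are $O(k^{-j-2})$ and sum to a tail $O(k^{-j-1})$. The condition [j <= m] keeps the
    forcing below that order. *)
Lemma error_system_gain j (M : R) k1 : (j <= m)%N -> 0 <= M ->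
  (forall k, (k1 <= k)%N -> cn (tau k) <= M * h k ^+ j) ->
  exists l M' k2, 0 <= M' /\ forall k, (k2 <= k)%N ->
     cn (tau k - l) <= M' * h k ^+ j.+1 /\ Q k <= M' * h k ^+ j.+1.
Proof.
move=> jm M0 HM.
have hjm k : h k ^+ m.+1 <= h k ^+ j.+1.
  by rewrite ler_wiXn2l// ?invS_le1// ltW// invS_gt0.
have KM0 : 0 <= K * (M + 1) by rewrite mulr_ge0// addr_ge0.
have [k kk|MQ [k2 [MQ0 HMQ]]] := @contraction_power_decay R Q th (K * (M + 1)) j.+1
   (maxn k0 k1) th01 KM0 Q0.
  apply: le_trans (HQ _) _; first by lia.
  rewrite lerD2l -mulrA ler_wpM2l// mulrDl mul1r lerD// exprS mulrCA ler_wpM2l//.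
  by apply: HM; lia.
pose K3 := 2 * (K * (MQ + M + 1)).
have K30 : 0 <= K3 by rewrite /K3 !(mulr_ge0, addr_ge0).
pose k3 := maxn (maxn k0 k1) k2.
have [||l Hl] := @cn_bracketed_limit tau (fun k => h k ^+ j.+1) K3 k3.
- by move=> k _; rewrite mulr_ge0// exprn_ge0.
- move=> k kk; apply: le_trans (Htau _) _; first by rewrite /k3 in kk; lia.
  have := gap k j; rewrite exprS => hg.
  apply: (@le_trans _ _ (K * (MQ + M + 1) * (h k * h k ^+ j.+1))); last first.
    apply: le_trans (ler_wpM2l _ hg) _; first by rewrite !(mulr_ge0, addr_ge0).
    by rewrite /K3 mulrCA mulrA.
  rewrite -!mulrA ler_wpM2l// mulrCA ler_wpM2l//.
  rewrite 2!mulrDl mul1r; apply: lerD => //; apply: lerD.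
    by apply: HMQ; rewrite /k3 in kk; lia.
  rewrite [h k ^+ j.+1]exprS mulrCA ler_wpM2l//; apply: HM.
  by rewrite /k3 in kk; lia.
exists l, (Num.max MQ (2 * K3)), k3; split; first by rewrite le_max MQ0.
move=> k kk; split.
  by apply: le_trans (Hl k kk) _; rewrite ler_wpM2r ?exprn_ge0// le_max lexx orbT.
apply: le_trans (HMQ _ _) _; first by rewrite /k3 in kk; lia.
by rewrite ler_wpM2r ?exprn_ge0// le_max lexx.
Qed.

Lemma error_system_cvg : exists l M k1, 0 <= M /\ forall k, (k1 <= k)%N ->
     cn (tau k - l) <= M * h k /\ Q k <= M * h k.
Proof.
have [M [M0 HM]] := error_system_bounded.
have := @error_system_gain 0 M k0 (leq0n _) M0.
by apply=> k kk; rewrite expr0 mulr1 HM.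
Qed.

(** Since [tau] tends to 0, the limit produced by [error_system_gain] is 0 in every round. The gain
    therefore applies to [tau] itself and can be iterated up to the order of the forcing. *)
Lemma error_system_decay :
  (forall e : R, 0 < e -> exists N, forall k, (N <= k)%N -> cn (tau k) <= e) ->
  exists M k1, 0 <= M /\ forall k, (k1 <= k)%N ->
     cn (tau k) <= M * h k ^+ m.+1 /\ Q k <= M * h k ^+ m.+1.
Proof.
move=> tau0.
have gain j (M : R) k1 : (j <= m)%N -> 0 <= M ->
  (forall k, (k1 <= k)%N -> cn (tau k) <= M * h k ^+ j) ->
  exists M' k2, 0 <= M' /\ forall k, (k2 <= k)%N ->
     cn (tau k) <= M' * h k ^+ j.+1 /\ Q k <= M' * h k ^+ j.+1.
  move=> jm M0 HM; have [l [M' [k2 [M'0 H]]]] := error_system_gain jm M0 HM.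
  suff l0 : l = 0 by exists M', k2; split=> // k kk; have := H k kk; rewrite l0 subr0.
  apply/eqP; rewrite -cn_eq0 eq_le cn_ge0 andbT; apply/ler_addgt0Pr => e e0.
  rewrite add0r.
  have e20 : 0 < e / 2 by rewrite divr_gt0.
  have [N HN] := tau0 _ e20.
  pose k := maxn (maxn N k2) (Num.truncn (2 * M' / e)).
  have kN : (N <= k)%N by rewrite /k; lia.
  have kk2 : (k2 <= k)%N by rewrite /k; lia.
  have [h1 _] := H k kk2; have h2 := HN k kN.
  have h3 : M' * h k ^+ j.+1 <= e / 2.
    apply: (@le_trans _ _ (M' * h k)).
      by rewrite ler_wpM2l// exprS ler_piMr// exprn_ile1// invS_le1.
    have hk : 2 * M' / e < k.+1%:R.
      by apply: lt_le_trans (truncnS_gt _) _; rewrite ler_nat ltnS /k leq_maxr.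
    move: hk; rewrite ltr_pdivrMr// ler_pdivrMr//.
    by move: (k.+1%:R : R) => x *; lra.
  have := cnD (tau k) (- (tau k - l)); rewrite cnN opprB addrC subrK => h4.
  by apply: le_trans h4 _; lra.
have [M [M0 HM]] := error_system_bounded.
have base j : (j <= m)%N ->
  exists M' k2, 0 <= M' /\ forall k, (k2 <= k)%N -> cn (tau k) <= M' * h k ^+ j.
  elim: j => [|j IH] jm.
    by exists M, k0; split=> // k kk; rewrite expr0 mulr1 HM.
  have [M' [k2 [M'0 H]]] := IH (ltnW jm).
  have [M2 [k3 [M20 H2]]] := gain j M' k2 (ltnW jm) M'0 H.
  by exists M2, k3; split=> // k /H2[].
have [M' [k2 [M'0 H]]] := base m (leqnn _).
exact: (gain m M' k2).
Qed.

End ErrorSystem.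

End ComplexSequences.

(** * The entrywise $\ell^1$ norm of complex matrices *)

Section MatrixNorm.
Variable R : realType.

Definition nm m n (M : 'M[C R]_(m, n)) : R := \sum_i \sum_j cn (M i j).

Lemma nm_ge0 m n (M : 'M[C R]_(m, n)) : 0 <= nm M.
Proof. by apply: sumr_ge0 => i _; apply: sumr_ge0 => j _; exact: cn_ge0. Qed.

Lemma nm_entry m n (M : 'M[C R]_(m, n)) i j : cn (M i j) <= nm M.
Proof.
rewrite /nm (bigD1 i)//= (bigD1 j)//= -addrA lerDl addr_ge0//.
  by apply: sumr_ge0 => j' _; exact: cn_ge0.
by apply: sumr_ge0 => i' _; apply: sumr_ge0 => j' _; exact: cn_ge0.
Qed.

Lemma nmD m n (M N : 'M[C R]_(m, n)) : nm (M + N) <= nm M + nm N.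
Proof.
rewrite /nm -big_split ler_sum// => i _; rewrite -big_split ler_sum// => j _.
by rewrite mxE cnD.
Qed.

Lemma nmN m n (M : 'M[C R]_(m, n)) : nm (- M) = nm M.
Proof. by apply: eq_bigr => i _; apply: eq_bigr => j _; rewrite mxE cnN. Qed.

Lemma nmB m n (M N : 'M[C R]_(m, n)) : nm (M - N) <= nm M + nm N.
Proof. by rewrite -(nmN N) nmD. Qed.

Lemma nmZ m n a (M : 'M[C R]_(m, n)) : nm (a *: M) = cn a * nm M.
Proof.
rewrite /nm mulr_sumr; apply: eq_bigr => i _; rewrite mulr_sumr.
by apply: eq_bigr => j _; rewrite mxE cnM.
Qed.

Lemma cn_sum I (r : seq I) (F : I -> C R) : cn (\sum_(i <- r) F i) <= \sum_(i <- r) cn (F i).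
Proof.
elim: r => [|i r IH]; first by rewrite !big_nil cn0.
by rewrite !big_cons (le_trans (cnD _ _))// lerD2l.
Qed.

Lemma nmM m n p (M : 'M[C R]_(m, n)) (N : 'M[C R]_(n, p)) : nm (M *m N) <= nm M * nm N.
Proof.
have row k : \sum_j cn (N k j) <= nm N.
  rewrite /nm (bigD1 k)//= lerDl; apply: sumr_ge0 => i _.
  by apply: sumr_ge0 => j _; exact: cn_ge0.
rewrite {1 2}/nm mulr_suml; apply: ler_sum => i _.
apply: (@le_trans _ _ (\sum_j \sum_k cn (M i k) * cn (N k j))).
  apply: ler_sum => j _; rewrite mxE (le_trans (cn_sum _ _))//.
  by apply: ler_sum => k _; rewrite cnM.
rewrite exchange_big mulr_suml; apply: ler_sum => k _.
by rewrite -mulr_sumr ler_wpM2l ?cn_ge0.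
Qed.

Lemma nm_row_mul (r : 'rV[C R]_2) (v : 'cV[C R]_2) : cn ((r *m v) 0 0) <= nm r * nm v.
Proof. exact: le_trans (nm_entry _ _ _) (nmM _ _). Qed.

End MatrixNorm.

(** * Coefficients of the binomial series $(1-z)^{\delta-1+l}$ and their size *)

Section BinomialWeights.
Variables (R : realType) (sig : nat).
Hypothesis hsig : (sig <= 1)%N.
Local Notation h k := ((k.+1%:R : R)^-1).
Local Notation dl := (1 / 2 - sig%:R : R).

(** These are the $e_k = (1-\delta)_k/k!$, of size $k^{sig-1/2}$: decreasing for [sig = 0], growing
    for [sig = 1]. *)
Definition ewt (k : nat) : R := \prod_(i < k) (1 - dl * h i).
(** Written with [sigR] so that it agrees literally with the factor in [p_]. *)
Definition eprod (l k : nat) : R := \prod_(0 <= m < l)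
                 ((m%:R + 1 / 2 - sigR R sig) / (m%:R + 1 / 2 - sigR R sig - k%:R)).
(* The coefficient of [z^k] in [(1 - z)^(dl - 1 + l)]. *)
Definition Ewt (l k : nat) : R := ewt k * eprod l k.

Lemma dl_cases : dl = 1 / 2 \/ dl = - (1 / 2).
Proof.
have [->|->] : sig = 0%N \/ sig = 1%N by lia.
  by left; rewrite subr0.
by right; lra.
Qed.

Lemma ewtS k : ewt k.+1 = (1 - dl * h k) * ewt k.
Proof. by rewrite /ewt big_ord_recr/= mulrC. Qed.

Lemma factor_gt0 k : 0 < 1 - dl * h k.
Proof.
have := invS_gt0 R k; have := invS_le1 R k.
move: (h k) => x *; by case: dl_cases => ->; lra.
Qed.

Lemma ewt_gt0 k : 0 < ewt k.
Proof. by apply: prodr_gt0 => i _; exact: factor_gt0. Qed.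

(** This factor tends to 1, so it fits beside the contraction factor $1/c$ in [Qstep], where the
    factor 2 of [ewt_ratio2] would destroy the contraction. *)
Lemma ewt_ratio k : ewt k <= (1 + h k) * ewt k.+1.
Proof.
rewrite ewtS mulrA ler_peMl ?(ltW (ewt_gt0 _))//.
have := invS_gt0 R k; have := invS_le1 R k.
move: (h k) => x *; by case: dl_cases => ->; nra.
Qed.

Lemma ewt_ratio2 k : ewt k <= 2 * ewt k.+1.
Proof.
apply: le_trans (ewt_ratio k) _; rewrite ler_wpM2r ?(ltW (ewt_gt0 _))//.
by have := invS_le1 R k; move: (h k) => *; lra.
Qed.

Lemma invS_next k : h k.+1 = h k / (1 + h k).
Proof.
have : (k.+1%:R : R) != 0 by [].
have : (k.+2%:R : R) != 0 by [].
rewrite -!natr1; set t : R := k%:R => h2 h1.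
by field; rewrite h2 h1.
Qed.

(** The weighted counterpart of [gap]: $e_k/(k+1)$ behaves like $k^{-\delta-1}$ with $\delta+1 \ge
    1/2$, so it decreases fast enough to telescope. The constant 6 is attained at $\delta=-1/2$,
    $k=j=0$. *)
Lemma ewt_gap k j :
  ewt k.+1 * h k ^+ j.+2 <= 6 * (ewt k * h k ^+ j.+1 - ewt k.+1 * h k.+1 ^+ j.+1).
Proof.
have hk0 := invS_gt0 R k; have hk1 := invS_le1 R k; have hS := invS_le R k.
have hS0 := invS_gt0 R k.+1; have e0 := ewt_gt0 k; have e1 := ewt_gt0 k.+1.
have H1 : ewt k.+1 * h k.+1 ^+ j.+1 <= h k ^+ j * (ewt k.+1 * h k.+1).
  rewrite exprSr mulrCA; apply: ler_wpM2r; first by rewrite mulr_ge0// ltW.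
  by apply: lerXn2r => //; rewrite nnegrE ltW.
have H2 : ewt k.+1 * h k ^+ 2 <= 6 * (ewt k * h k - ewt k.+1 * h k.+1).
  rewrite ewtS invS_next; move: (h k) (ewt k) hk0 hk1 e0 => x e x0 x1 e0.
  have x10 : 0 < 1 + x by lra.
  rewrite -(ler_pM2r x10).
  have -> : 6 * (e * x - (1 - dl * x) * e * (x / (1 + x))) * (1 + x) =
    (6 * (1 + dl)) * (e * x ^+ 2) by field; lra.
  have -> : (1 - dl * x) * e * x ^+ 2 * (1 + x) = ((1 - dl * x) * (1 + x)) * (e * x ^+ 2).
    by ring.
  rewrite ler_wpM2r; [by []|by rewrite mulr_ge0 ?sqr_ge0 ?ltW|].
  by case: dl_cases => ->; nra.
have p0 : 0 <= h k ^+ j by rewrite exprn_ge0 ?ltW.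
have := ler_wpM2l p0 H2; rewrite (mulrCA _ 6) (mulrBr (h k ^+ j)) => H3.
have -> : ewt k.+1 * h k ^+ j.+2 = h k ^+ j * (ewt k.+1 * h k ^+ 2).
  by rewrite [RHS]mulrCA -exprD addn2.
have -> : ewt k * h k ^+ j.+1 = h k ^+ j * (ewt k * h k) by rewrite [RHS]mulrCA -exprSr.
apply: le_trans H3 _; by rewrite ler_wpM2l// lerD2l lerN2 H1 //.
Qed.

(** Squaring removes the half-integer power of $k$, and the induction becomes an inequality between
    rational functions. The factor $(2k+1)^{2\,sig}$ reflects that the weight for [sig = 1] is
    $2k+1$ times the weight for [sig = 0]. *)
Lemma ewt_sqr_le k : ewt k ^+ 2 <= (2 * k%:R + 1) ^+ (2 * sig) * h k.
Proof.
elim: k => [|k IH].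
  by rewrite /ewt big_ord0 mulr0 add0r !expr1n invr1 mulr1.
rewrite ewtS exprMn; apply: le_trans (ler_wpM2l (sqr_ge0 _) IH) _.
have k0 : 0 <= k%:R :> R by [].
rewrite -(natr1 k.+1) -(natr1 k); move: (k%:R : R) k0 => x x0.
have x1 : x + 1 != 0 by lra. have x2 : x + 1 + 1 != 0 by lra.
have p2 : 0 < (x + 1) ^+ 3 * (x + 1 + 1) by rewrite mulr_gt0 ?exprn_gt0//; lra.
have [->|->] : sig = 0%N \/ sig = 1%N by lia.
  rewrite muln0 !expr0 mulr0n.
  rewrite -(ler_pM2r p2).
  have -> : (1 - (1 / 2 - 0) * (x + 1)^-1) ^+ 2 * (1 * (x + 1)^-1) * ((x + 1) ^+ 3 * (x + 1 + 1))
   = (x + 1 / 2) ^+ 2 * (x + 1 + 1) by field; rewrite x1.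
  have -> : 1 * (x + 1 + 1)^-1 * ((x + 1) ^+ 3 * (x + 1 + 1)) = (x + 1) ^+ 3.
    by field; rewrite x2.
  nra.
rewrite muln1 mulr1n -(ler_pM2r p2).
have -> : (1 - (1 / 2 - 1) * (x + 1)^-1) ^+ 2 * ((2 * x + 1) ^+ 2 * (x + 1)^-1) *
   ((x + 1) ^+ 3 * (x + 1 + 1))
   = (2 * x + 3) ^+ 2 * ((x + 1 / 2) ^+ 2 * (x + 1 + 1)) by field; rewrite x1.
have -> : (2 * (x + 1) + 1) ^+ 2 * (x + 1 + 1)^-1 * ((x + 1) ^+ 3 * (x + 1 + 1)) =
  (2 * x + 3) ^+ 2 * (x + 1) ^+ 3 by field; rewrite x2.
rewrite ler_wpM2l ?sqr_ge0//; nra.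
Qed.

Lemma ewt_le_pow k : (0 < k)%N -> ewt k <= 3 * k%:R `^ (sig%:R - 1 / 2).
Proof.
move=> k0; have kR : 1 <= k%:R :> R by rewrite ler1n.
have r0 : 0 <= 3 * k%:R `^ (sig%:R - 1 / 2) :> R by rewrite mulr_ge0// powR_ge0.
rewrite -ler_sqr ?nnegrE ?(ltW (ewt_gt0 _))//.
apply: le_trans (ewt_sqr_le k) _.
have -> : (3 * k%:R `^ (sig%:R - 1 / 2)) ^+ 2 = 9 * k%:R `^ (2 * sig%:R - 1) :> R.
  rewrite exprMn -[X in _ * X = _]powR_mulrn ?powR_ge0// -powRrM.
  have -> : (sig%:R - 1 / 2) * 2 = 2 * sig%:R - 1 :> R by lra.
  by congr (_ * _); lra.
have [->|->] : sig = 0%N \/ sig = 1%N by lia.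
  rewrite muln0 expr0 mul1r mulr0n mulr0 sub0r powR_inv1//.
  rewrite -(natr1 k); move: (k%:R : R) kR => x x1.
  rewrite -[leLHS]mul1r ler_pM// ?invr_ge0; try lra.
  by rewrite lef_pV2 ?posrE; lra.
rewrite muln1 mulr1n (_ : 2 * 1 - 1 = 1 :> R); last by lra.
rewrite powRr1// -(natr1 k); move: (k%:R : R) kR => x x1.
rewrite ler_pdivrMr; last by lra.
nra.
Qed.

Lemma ewt_pow_rate n k : (0 < k)%N ->
  ewt k * h k ^+ n.+1 <= 3 * k%:R `^ (sig%:R - n%:R - 3 / 2).
Proof.
move=> k0; have kR : 0 < k%:R :> R by rewrite ltr0n.
have -> : (sig%:R - n%:R - 3 / 2 : R) = (sig%:R - 1 / 2) + - n.+1%:R.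
  by rewrite -(natr1 n); lra.
rewrite powRD; last by rewrite (gt_eqF kR) implybT.
rewrite mulrA; apply: ler_pM => //.
- exact: ltW (ewt_gt0 _).
- exact: ewt_le_pow.
- rewrite powRN powR_mulrn ?(ltW kR)// -exprVn.
  by apply: lerXn2r; rewrite ?nnegrE ?invr_ge0// lef_pV2 ?posrE// ler_nat.
Qed.

Lemma ewt_inv_vanish (e : R) : 0 < e -> exists N, forall k, (N <= k)%N -> ewt k * h k <= e.
Proof.
(* The threshold comes from $(e_k/(k+1))^2 \le 4/(k+1)$, valid for both values of [sig]. *)
move=> e0; exists (Num.truncn (4 / e ^+ 2)) => k Nk.
have e20 : 0 < e ^+ 2 by rewrite exprn_gt0.
have hk : 4 / e ^+ 2 < k.+1%:R.
  by apply: lt_le_trans (truncnS_gt _) _; rewrite ler_nat ltnS.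
have h0 := invS_gt0 R k; have w0 := ewt_gt0 k.
rewrite -ler_sqr ?nnegrE ?(ltW e0)//; last by rewrite mulr_ge0// ltW.
rewrite exprMn; apply: le_trans (ler_wpM2r (sqr_ge0 _) (ewt_sqr_le k)) _.
have b : (2 * k%:R + 1) ^+ (2 * sig) <= 4 * k.+1%:R ^+ 2 :> R.
  have k0 : 0 <= k%:R :> R by [].
  rewrite -(natr1 k); move: (k%:R : R) k0 => x x0.
  have [->|->] : sig = 0%N \/ sig = 1%N by lia.
    by rewrite muln0 expr0; nra.
  by rewrite muln1; nra.
apply: (@le_trans _ _ (4 * k.+1%:R ^+ 2 * h k * h k ^+ 2)).
  apply: ler_wpM2r; first exact: sqr_ge0.
  by apply: ler_wpM2r => //; exact: ltW.
have k1 : (k.+1%:R : R) != 0 by [].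
have kp : 0 < (k.+1%:R : R) by [].
move: hk; rewrite ltr_pdivrMr//; move: (k.+1%:R : R) k1 kp => x x1 xp hk.
have -> : 4 * x ^+ 2 / x * x^-1 ^+ 2 = 4 / x by field.
rewrite ler_pdivrMr//; lra.
Qed.

(** Parity: twice the left side is an odd integer. Hence no denominator in [eprod] vanishes,
    whatever [k] is. *)
Lemma half_integer_neq0 l k : l%:R + 1 / 2 - sigR R sig - k%:R != 0.
Proof.
apply/eqP => H; have : (2 * l + 1)%:R = (2 * (sig + k))%:R :> R.
  by rewrite natrD !natrM natrD; move: H; rewrite /sigR; lra.
by move/eqP; rewrite eqr_nat; lia.
Qed.

Lemma EwtS l k : Ewt l.+1 k * (l%:R + dl - k%:R) = Ewt l k * (l%:R + dl).
Proof.
have := half_integer_neq0 l k.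
rewrite /Ewt /eprod big_nat_recr//= /sigR; move: (\prod_(0 <= i < l) _) => P.
move: (l%:R : R) (k%:R : R) (sig%:R : R) => x y z h0.
by move/eqP in h0; field; apply/eqP => H; apply: h0; lra.
Qed.

(** The ratio of consecutive coefficients of $(1-z)^{\delta-1+l}$; [EwtS] carries it from one [l] to
    the next. *)
Lemma Ewt_step l k : k.+1%:R * Ewt l k.+1 = (k.+1%:R - l%:R - dl) * Ewt l k.
Proof.
elim: l => [|l IH].
  rewrite /Ewt /eprod !big_geq// !mulr1 ewtS subr0.
  have : (k.+1%:R : R) != 0 by [].
  by move: (k.+1%:R : R) => x x0; field.
have n1 := half_integer_neq0 l k; have n2 := half_integer_neq0 l k.+1.
have e1 := EwtS l k; have e2 := EwtS l k.+1.
rewrite /sigR in n1 n2.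
have := mulfI n1; apply; apply: (mulfI n2).
move: e1 e2 IH; rewrite -(natr1 k) -(natr1 l).
move: (l%:R : R) (k%:R : R) (sig%:R : R) => x y z e1 e2 IH.
transitivity ((y + 1) * ((x + 1 / 2 - z - y) * (Ewt l.+1 k.+1 * (x + (1 / 2 - z) - (y + 1))))); first by ring.
rewrite e2.
transitivity ((x + 1 / 2 - z - y) * (x + (1 / 2 - z)) * ((y + 1) * Ewt l k.+1)); first by ring.
rewrite IH.
transitivity ((x + 1 / 2 - z - (y + 1)) * (y + 1 - (x + 1) - (1 / 2 - z)) * (Ewt l.+1 k * (x + (1 / 2 - z) - y))); last by ring.
rewrite e1; ring.
Qed.

(** Multiplication of the binomial series by $1-z$ raises its exponent by one. *)
Lemma Ewt_diff l k : Ewt l.+1 k.+1 = Ewt l k.+1 - Ewt l k.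
Proof.
have e1 := Ewt_step l k; have e2 := EwtS l k.+1.
have n2 := half_integer_neq0 l k.+1; rewrite /sigR in n2.
apply: (mulIf n2); have : (k.+1%:R : R) != 0 by [].
move: e1 e2 n2; move: (l%:R : R) (k.+1%:R : R) (sig%:R : R) => x y z e1 e2 n2 y0.
have -> : x + 1 / 2 - z - y = x + (1 / 2 - z) - y by ring.
rewrite e2 mulrBl.
have -> : Ewt l k * (x + (1 / 2 - z) - y) = - ((y - x - (1 / 2 - z)) * Ewt l k) by ring.
rewrite -e1; ring.
Qed.

(** Coefficient form of $z\frac{d}{dz}(1-z)^a = -a\,((1-z)^{a-1}-(1-z)^a)$ with $a=\delta+l$. *)
Lemma Ewt_mul l k : k%:R * Ewt l.+1 k = - (dl + l%:R) * (Ewt l k - Ewt l.+1 k).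
Proof. by have := EwtS l k; move: (l%:R : R) (k%:R : R) (sig%:R : R) => *; lra. Qed.

Lemma Ewt_le l : exists M k1, 0 <= M /\ forall k, (k1 <= k)%N ->
  `|Ewt l k| <= M * ewt k * h k ^+ l.
Proof.
elim: l => [|l [M [k1 [M0 H]]]].
  exists 1, 0%N; split=> // k _.
  by rewrite /Ewt /eprod big_geq// !mulr1 mul1r ger0_norm// ltW ?ewt_gt0.
(* For $k \ge 2l+2$ the denominator $k-l-\delta$ is at least $(k+1)/4$, whence the factor 4. *)
exists (M * (4 * (l%:R + 1))), (maxn k1 (2 * l + 2)); split.
  by rewrite mulr_ge0// mulr_ge0// addr_ge0.
move=> k kk; have := H k ltac:(lia); have e := EwtS l k.
have n1 := half_integer_neq0 l k; rewrite /sigR in n1.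
have -> : Ewt l.+1 k = Ewt l k * ((l%:R + dl) / (l%:R + dl - k%:R)).
  by rewrite mulrA -e mulfK// addrA.
move=> Hk.
have kl : 2 * l%:R + 2 <= k%:R :> R by rewrite -natrM -natrD ler_nat; lia.
have bd : `|(l%:R + dl) / (l%:R + dl - k%:R)| <= 4 * (l%:R + 1) * h k.
  rewrite normrM normfV -(natr1 k).
  have l0 : 0 <= l%:R :> R by [].
  move: (l%:R : R) (k%:R : R) kl l0 => x y xy x0.
  have d1 : -(1/2) <= dl <= 1/2 by case: dl_cases => ->; apply/andP; split; lra.
  move: dl d1 => d /andP[d1 d2].
  rewrite [`|x + d - y|]ltr0_norm; last by lra.
  rewrite ler_pdivrMr; last by lra.
  apply: (@le_trans _ _ (x + 1)); first by rewrite ler_norml; apply/andP; split; lra.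
  rewrite [leRHS](_ : _ = (x + 1) * (4 * - (x + d - y) / (y + 1))); last by ring.
  apply: ler_peMr; first by lra.
  by rewrite ler_pdivlMr; lra.
rewrite [h k ^+ l.+1]exprSr.
have -> : M * (4 * (l%:R + 1)) * ewt k * (h k ^+ l * h k) =
  (M * ewt k * h k ^+ l) * (4 * (l%:R + 1) * h k) by ring.
by rewrite normrM; apply: ler_pM.
Qed.

End BinomialWeights.

(** * Asymptotics of the recurrence for the triple [u], [d], [s] with residuals *)

Section PerturbedRecurrence.
Variables (R : realType) (sig : nat) (c : R).
Hypotheses (hsig : (sig <= 1)%N) (hc : 1 < c).
Local Notation h k := ((k.+1%:R : R)^-1).
Local Notation dl := (1 / 2 - sig%:R : R).
Local Notation CC := (C R).
Local Notation e := (ewt R sig).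
Variables (A' S' R' : 'M[CC]_2) (tr xr : 'rV[CC]_2) (b2 : 'cV[CC]_2).
Hypotheses (tb2 : (tr *m b2) 0 0 = 1) (xb2 : (xr *m b2) 0 0 = 0).
Local Notation ap r v := ((r *m v) 0 0).

Variables (u d s r rho : nat -> 'cV[CC]_2) (Kr : R) (m k0 : nat).
Hypothesis Kr0 : 0 <= Kr.
Hypothesis Hd : forall k, (k0 <= k)%N -> d k.+1 = d k + u k.+1.
Hypothesis Hs : forall k, (k0 <= k)%N -> s k.+1 = RtoC c^-1 *: s k + u k.+1 + rho k.
Hypothesis Hu : forall k, (k0 <= k)%N ->
  RtoC k.+1%:R *: u k.+1 = A' *m u k.+1
    - (RtoC dl * ap tr (d k)) *: b2 - S' *m u k - R' *m s k - r k.
Hypothesis Hr : forall k, (k0 <= k)%N -> nm (r k) <= Kr * (e k * h k ^+ m.+1).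
Hypothesis Hrho : forall k, (k0 <= k)%N -> nm (rho k) <= Kr * (e k * h k ^+ m.+1).

(** [tau] is the amplitude of [d] along [b2] relative to the weight $e_k$; [Q] gathers what the
    recurrence damps, [u] by $1/(k+1)$ and [s] by $1/c$. *)
Let tau k : CC := ap tr (d k) / RtoC (e k).
Let Q k : R := (nm (u k) + nm (s k)) / e k.

Let P : R := 1 + nm A' + nm S' + nm R' + nm tr + nm xr + nm b2 + Kr.

Let P_ge1 : 1 <= P.
Proof. by rewrite /P -!addrA lerDl !addr_ge0// nm_ge0. Qed.

Let e0 k : 0 < e k. Proof. exact: ewt_gt0. Qed.

Let Q_ge0 k : 0 <= Q k.
Proof. by rewrite /Q divr_ge0 ?addr_ge0 ?nm_ge0// ltW. Qed.

Let tauE k : ap tr (d k) = tau k * RtoC (e k).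
Proof. by rewrite /tau divfK// RtoC_eq0 gt_eqF. Qed.

Let QE k : nm (u k) + nm (s k) = Q k * e k.
Proof. by rewrite /Q divfK// gt_eqF. Qed.

Let P_ge : [/\ nm A' <= P, nm S' <= P, nm R' <= P, nm tr <= P & nm xr <= P] /\
  nm b2 <= P /\ Kr <= P.
Proof.
have := nm_ge0 b2; have := nm_ge0 xr; have := nm_ge0 tr; have := nm_ge0 R'.
have := nm_ge0 S'; have := nm_ge0 A'; have := Kr0; rewrite /P.
move: (nm A') (nm S') (nm R') (nm tr) (nm xr) (nm b2) => a1 a2 a3 a4 a5 a6.
by move=> *; split; [split|split]; lra.
Qed.
Let PA : nm A' <= P. Proof. by have [[]] := P_ge. Qed.
Let PS : nm S' <= P. Proof. by have [[]] := P_ge. Qed.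
Let PR : nm R' <= P. Proof. by have [[]] := P_ge. Qed.
Let Pt : nm tr <= P. Proof. by have [[]] := P_ge. Qed.
Let Px : nm xr <= P. Proof. by have [[]] := P_ge. Qed.
Let Pb : nm b2 <= P. Proof. by have [_ []] := P_ge. Qed.
Let PK : Kr <= P. Proof. by have [_ []] := P_ge. Qed.
Let P0 : 0 <= P. Proof. exact: le_trans P_ge1. Qed.

Let dl1 : `|dl| <= 1.
Proof. by rewrite ler_norml; case: (dl_cases R hsig) => ->; apply/andP; split; lra. Qed.

Let G k : R := Q k + h k * cn (tau k) + h k ^+ m.+1.

Let G_ge0 k : 0 <= G k.
Proof.
by rewrite /G !addr_ge0// ?exprn_ge0// mulr_ge0// ?cn_ge0.
Qed.

Let rest k := S' *m u k + R' *m s k + r k.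

Let HuE k : (k0 <= k)%N -> RtoC k.+1%:R *: u k.+1 =
  A' *m u k.+1 - (RtoC dl * ap tr (d k)) *: b2 - rest k.
Proof. by move=> kk; rewrite Hu// /rest !opprD !addrA. Qed.

Let rest_le k : (k0 <= k)%N -> nm (rest k) <= P * (e k * (Q k + h k ^+ m.+1)).
Proof.
move=> kk; rewrite mulrDr mulrDr (mulrC (e k) (Q k)) -QE.
apply: le_trans (nmD _ _) _; apply: lerD; last first.
  by apply: le_trans (Hr kk) _; rewrite ler_wpM2r// mulr_ge0 ?exprn_ge0// ltW.
rewrite mulrDr; apply: le_trans (nmD _ _) _.
by apply: lerD; apply: le_trans (nmM _ _) _; rewrite ler_wpM2r ?nm_ge0.
Qed.

(** The recurrence is implicit in [u k.+1]; once [2 * P <= k.+1%:R], the term [A' *m u k.+1] is at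
    most half of the left side. The 4 is this factor 2 times the factor 2 of [ewt_ratio2]. *)
Let u_le k : (k0 <= k)%N -> 2 * P <= k.+1%:R ->
  nm (u k.+1) <= 4 * P * h k * e k.+1 * (cn (tau k) + Q k + h k ^+ m.+1).
Proof.
move=> kk kP.
set T := cn (tau k); set g := h k ^+ m.+1.
have g0 : 0 <= g by rewrite exprn_ge0.
have T0 : 0 <= T by exact: cn_ge0.
have h1 : k.+1%:R * nm (u k.+1) <= P * nm (u k.+1) + P * (e k * (T + Q k + g)).
  have -> : k.+1%:R * nm (u k.+1) = nm (RtoC k.+1%:R *: u k.+1).
    by rewrite nmZ cn_RtoC ger0_norm.
  rewrite (HuE kk) -addrA -opprD.
  apply: le_trans (nmB _ _) _; apply: lerD.
    by apply: le_trans (nmM _ _) _; rewrite ler_wpM2r ?nm_ge0.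
  apply: le_trans (nmD _ _) _; rewrite -addrA (mulrDr (e k)) mulrDr; apply: lerD.
    rewrite nmZ cnM cn_RtoC tauE cnM cn_RtoC (ger0_norm (ltW (e0 k))) -/T.
    rewrite [leRHS](_ : _ = 1 * (T * e k) * P); last by ring.
    have Te : 0 <= T * e k by rewrite mulr_ge0// ltW.
    apply: ler_pM => //; [exact: mulr_ge0|exact: nm_ge0|exact: ler_wpM2r].
  exact: rest_le.
have TQ0 : 0 <= T + Q k + g by rewrite !addr_ge0.
have h2 : e k * (T + Q k + g) <= 2 * e k.+1 * (T + Q k + g).
  by rewrite ler_wpM2r// ewt_ratio2.
have h3 := ler_wpM2l P0 h2.
have kp : 0 < k.+1%:R :> R by [].
rewrite -(ler_pM2l kp).
have -> : k.+1%:R * (4 * P * h k * e k.+1 * (T + Q k + g)) =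
   4 * (P * (e k.+1 * (T + Q k + g))).
  have : k.+1%:R != 0 :> R by [].
  by move: (k.+1%:R : R) => x x0; field.
have u0 := nm_ge0 (u k.+1).
have h4 : P * nm (u k.+1) <= k.+1%:R * nm (u k.+1) / 2.
  by rewrite mulrAC ler_wpM2r//; lra.
move: h1 h3 h4.
rewrite -!(mulrA 2) (mulrCA P 2).
move: (e k * _) (e k.+1 * _) (P * nm _) (_%:R * nm _) => a b x y.
by move: (P * a) (P * b) => *; lra.
Qed.

Let u_leG k : (k0 <= k)%N -> 2 * P <= k.+1%:R ->
  nm (u k.+1) <= 4 * P * e k.+1 * G k.
Proof.
move=> kk kP; apply: le_trans (u_le kk kP) _.
rewrite [leLHS](_ : _ = 4 * P * e k.+1 * (h k * cn (tau k) + h k * (Q k + h k ^+ m.+1))); last by ring.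
rewrite ler_wpM2l//; first by rewrite !mulr_ge0// ltW.
rewrite /G [leRHS](_ : _ = h k * cn (tau k) + (Q k + h k ^+ m.+1)); last by ring.
rewrite lerD2l; apply: ler_piMl; last exact: invS_le1.
by rewrite addr_ge0// exprn_ge0.
Qed.

(** The summand [10 * P] serves [Qstep], the other one [row_step]. *)
Let Kc : R := 10 * P + P * P * (4 * P + 2).

(** The leading part of [u k.+1] is $-\frac{\delta}{k+1}$ times the [tr] component of [d k], along
    [b2]; what remains is one order smaller. With [ro = tr] the left side is
    $e_{k+1}(\tau_{k+1}-\tau_k)$, with [ro = xr] it is the increment of the [xr] component of
    [d]. *)
Let row_step (ro : 'rV[CC]_2) k : nm ro <= P -> (k0 <= k)%N -> 2 * P <= k.+1%:R ->
  cn (ap ro (u k.+1) + RtoC (dl * h k) * ap tr (d k) * ap ro b2)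
    <= Kc * h k * e k.+1 * G k.
Proof.
move=> roP kk kP.
have -> : ap ro (u k.+1) + RtoC (dl * h k) * ap tr (d k) * ap ro b2 =
   RtoC (h k) * ap ro (A' *m u k.+1 - rest k).
  have /(congr1 (fun v => RtoC (h k) * ap ro v)) := HuE kk.
  rewrite -scalemxAr [X in _ * X = _]mxE mulrA -RtoCM mulVf// RtoC1 mul1r => ->.
  rewrite !mulmxBr -!scalemxAr !mxE RtoCM.
  move: (\sum_j _) (\sum_j _) (\sum_j _) (\sum_j _) => x y z t.
  ring.
rewrite cnM cn_RtoC ger0_norm//.
rewrite [leRHS](_ : _ = h k * (Kc * e k.+1 * G k)); last by ring.
rewrite ler_wpM2l//.
apply: le_trans (nm_row_mul _ _) _.
apply: (@le_trans _ _ (P * (P * (4 * P * e k.+1 * G k) + P * (2 * e k.+1 * G k)))).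
  apply: ler_pM; rewrite ?nm_ge0//.
  apply: le_trans (nmB _ _) _; apply: lerD.
    apply: le_trans (nmM _ _) _; apply: ler_pM; rewrite ?nm_ge0//.
    exact: u_leG.
  apply: le_trans (rest_le kk) _; rewrite ler_wpM2l//.
  apply: ler_pM; rewrite ?addr_ge0 ?exprn_ge0 ?(ltW (e0 _))//.
    exact: ewt_ratio2.
  by rewrite /G addrAC lerDl mulr_ge0// cn_ge0.
rewrite [leLHS](_ : _ = P * P * (4 * P + 2) * (G k * e k.+1)); last by ring.
rewrite [leRHS](_ : _ = Kc * (G k * e k.+1)); last by ring.
rewrite ler_wpM2r//; first by rewrite mulr_ge0// ltW.
by rewrite /Kc lerDr mulr_ge0.
Qed.

(** Midway between $1/c$ and 1, which leaves room for the corrections of order $1/k$. *)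
Let th : R := (1 + c^-1) / 2.
Let ci1 : 0 < c^-1 < 1.
Proof. by have c0 : 0 < c := lt_trans ltr01 hc; rewrite invr_gt0 c0 invf_lt1. Qed.

Let th01 : 0 <= th < 1.
Proof. by have /andP[] := ci1; rewrite /th; move: c^-1 => x *; apply/andP; split; lra. Qed.

Let Kc0 : 0 <= Kc.
Proof. by rewrite /Kc addr_ge0// ?mulr_ge0// addr_ge0// mulr_ge0. Qed.

(** In [Qstep] the coefficient of [Q k] is $c^{-1}$ plus at most [h k * (c^-1 + 8 * P)]; the second
    condition keeps the sum below [th]. The first one is the hypothesis of [u_le]. *)
Let threshold : exists k1, (k0 <= k1)%N /\ forall k, (k1 <= k)%N ->
  2 * P <= k.+1%:R /\ h k * (c^-1 + 8 * P) <= (1 - c^-1) / 2.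
Proof.
have /andP[c0 c1] := ci1.
pose B := 2 * P + 2 * (c^-1 + 8 * P) / (1 - c^-1).
exists (maxn k0 (Num.truncn B)); split; first by rewrite leq_maxl.
move=> k kk; have hB : B < k.+1%:R.
  apply: lt_le_trans (truncnS_gt _) _; rewrite ler_nat ltnS.
  by apply: leq_trans kk; rewrite leq_maxr.
have q0 : 0 <= 2 * (c^-1 + 8 * P) / (1 - c^-1).
  apply: divr_ge0; last by rewrite subr_ge0 ltW.
  by apply: mulr_ge0 => //; apply: addr_ge0; [exact: ltW|exact: mulr_ge0].
split.
  by apply: ltW; apply: le_lt_trans hB; rewrite /B lerDl.
have : 2 * (c^-1 + 8 * P) / (1 - c^-1) <= k.+1%:R.
  by apply: ltW; apply: le_lt_trans hB; rewrite /B lerDr mulr_ge0.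
rewrite ler_pdivrMr ?subr_gt0// => hh; rewrite mulrC ler_pdivrMr//; move: hh.
by move: (k.+1%:R : R) (c^-1) => *; lra.
Qed.

Let Qstep k : (k0 <= k)%N -> 2 * P <= k.+1%:R ->
  h k * (c^-1 + 8 * P) <= (1 - c^-1) / 2 ->
  Q k.+1 <= th * Q k + Kc * (h k * cn (tau k) + h k ^+ m.+1).
Proof.
move=> kk kP kh.
have /andP[c0 c1] := ci1.
set T := cn (tau k); set g := h k ^+ m.+1.
have g0 : 0 <= g by rewrite exprn_ge0.
have T0 : 0 <= T by exact: cn_ge0.
have e1 := e0 k.+1.
rewrite {1}/Q ler_pdivrMr//.
have s1 : nm (s k.+1) <= c^-1 * (Q k * ((1 + h k) * e k.+1)) + nm (u k.+1) + P * (2 * e k.+1 * g).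
  rewrite (Hs kk); apply: le_trans (nmD _ _) _; apply: lerD; last first.
    apply: le_trans (Hrho kk) _; apply: ler_pM => //; first by rewrite mulr_ge0// ltW.
    by rewrite ler_wpM2r// ewt_ratio2.
  apply: le_trans (nmD _ _) _; rewrite lerD2r nmZ cn_RtoC (ger0_norm (ltW c0)) ler_wpM2l ?(ltW c0)//.
  apply: (@le_trans _ _ (Q k * e k)); first by rewrite -QE lerDr nm_ge0.
  by rewrite ler_wpM2l// ewt_ratio.
have u1 := u_le kk kP; rewrite -/T -/g in u1.
have hg : h k * g <= g by rewrite ler_piMl// invS_le1.
have p1 : 8 * P * e k.+1 * (h k * g) <= 8 * P * e k.+1 * g.
  by rewrite ler_wpM2l// !mulr_ge0// ltW.
have p2 : h k * (c^-1 + 8 * P) * (Q k * e k.+1) <= (1 - c^-1) / 2 * (Q k * e k.+1).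
  by rewrite ler_wpM2r// mulr_ge0// ltW.
have p3 : 0 <= P * P * (4 * P + 2) * (e k.+1 * (h k * T + g)) + 2 * P * (h k * T * e k.+1).
  have e1' := ltW e1; have hT0 : 0 <= h k * T by rewrite mulr_ge0.
  apply: addr_ge0; apply: mulr_ge0.
  - by apply: mulr_ge0; [exact: mulr_ge0|rewrite addr_ge0// mulr_ge0].
  - by rewrite mulr_ge0// addr_ge0.
  - by rewrite mulr_ge0.
  - by rewrite mulr_ge0.
rewrite [leRHS](_ : _ = th * Q k * e k.+1 + 10 * P * (e k.+1 * (h k * T + g)) +
  P * P * (4 * P + 2) * (e k.+1 * (h k * T + g))); last by rewrite /Kc; ring.
rewrite /th.
move: s1 u1 p1 p2 p3; move: (nm (s _)) (nm (u _)) (P * P * _ * _) => ns nu pp.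
by move: (c^-1) (Q k) (h k) (e k.+1) => *; lra.
Qed.

Let taustep k : (k0 <= k)%N -> 2 * P <= k.+1%:R ->
  cn (tau k.+1 - tau k) <= Kc * h k * G k.
Proof.
move=> kk kP; have := row_step Pt kk kP.
have -> : ap tr (u k.+1) + RtoC (dl * h k) * ap tr (d k) * ap tr b2
  = (tau k.+1 - tau k) * RtoC (e k.+1).
  have E : tau k * RtoC (e k.+1) = (1 - RtoC (dl * h k)) * ap tr (d k).
    rewrite (_ : RtoC (e k.+1) = (1 - RtoC (dl * h k)) * RtoC (e k)); last first.
      by rewrite (@ewtS _ sig k) [LHS]RtoCM RtoCB.
    by rewrite tauE; ring.
  rewrite tb2 mulr1 [RHS]mulrBl E -tauE (Hd kk) mulmxDr [X in _ = X - _]mxE.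
  by ring.
rewrite cnM cn_RtoC (ger0_norm (ltW (e0 _))) mulrAC ler_pM2r//.
Qed.

Let error_hyps : exists k1, (k0 <= k1)%N /\
 (forall k, (k1 <= k)%N -> 2 * P <= k.+1%:R) /\
 (forall k, (k1 <= k)%N -> Q k.+1 <= th * Q k + Kc * (h k * cn (tau k) + h k ^+ m.+1)) /\
 (forall k, (k1 <= k)%N ->
   cn (tau k.+1 - tau k) <= Kc * h k * (Q k + h k * cn (tau k) + h k ^+ m.+1)).
Proof.
have [k1 [kk1 H]] := threshold; exists k1; split=> //; split; [|split] => k kk.
- by have [] := H k kk.
- by have [? ?] := H k kk; apply: Qstep => //; exact: leq_trans kk1 kk.
- by have [? ?] := H k kk; apply: taustep => //; exact: leq_trans kk1 kk.
Qed.

(** As [xr] annihilates [b2], the slow term drops out and the increments of the [xr] component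
    become summable. The 12 is 6 from [ewt_gap] times 2 from [cn_bracketed_limit]. *)
Let xstep j (M : R) k1 : 0 <= M -> (k0 <= k1)%N ->
  (forall k, (k1 <= k)%N -> 2 * P <= k.+1%:R) ->
  (forall k, (k1 <= k)%N -> G k <= M * h k ^+ j.+1) ->
  exists xi, forall k, (k1 <= k)%N ->
    cn (ap xr (d k) - xi) <= 12 * Kc * M * (e k * h k ^+ j.+1).
Proof.
move=> M0 kk1 HP HG.
have [||xi Hxi] := @cn_bracketed_limit R (fun k => ap xr (d k))
   (fun k => e k * h k ^+ j.+1) (6 * (Kc * M)) k1; last first.
- exists xi => k kk; apply: le_trans (Hxi k kk) _.
  by rewrite le_eqVlt; apply/orP; left; apply/eqP; ring.
- move=> k kk; have k0k := leq_trans kk1 kk.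
  have := row_step Px k0k (HP k kk); rewrite xb2 mulr0 addr0.
  have -> : ap xr (u k.+1) = ap xr (d k.+1) - ap xr (d k).
    by rewrite (Hd k0k) mulmxDr [X in _ = X - _]mxE; ring.
  move=> H; apply: le_trans H _.
  apply: (@le_trans _ _ (Kc * M * (e k.+1 * h k ^+ j.+2))).
    rewrite [leLHS](_ : _ = Kc * (h k * e k.+1) * G k); last by ring.
    rewrite [leRHS](_ : _ = Kc * (h k * e k.+1) * (M * h k ^+ j.+1)); last by rewrite [h k ^+ j.+2]exprS; ring.
    by rewrite ler_wpM2l ?HG// !mulr_ge0// ltW.
  rewrite [leRHS](_ : _ = Kc * M * (6 * (e k * h k ^+ j.+1 - e k.+1 * h k.+1 ^+ j.+1))); last by ring.
  by rewrite ler_wpM2l ?mulr_ge0// ewt_gap.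
- move=> k kk; rewrite !mulr_ge0// ?exprn_ge0// ltW//.
Qed.

(** The first pass: bounded [tau] already gives $G_k = O(1/k)$, enough for [xstep] with [j = 0]. *)
Lemma perturbed_recurrence_cvg : exists l xi M k1, 0 <= M /\ forall k, (k1 <= k)%N ->
  [/\ cn (ap tr (d k) - l * RtoC (e k)) <= M * (e k * h k),
      cn (ap xr (d k) - xi) <= M * (e k * h k) &
      nm (u k) + nm (s k) <= M * (e k * h k)].
Proof.
have [k1 [kk1 [H1 [H2 H3]]]] := error_hyps.
have [l [M [k2 [M0 HM]]]] := error_system_cvg th01 Kc0 Q_ge0 H2 H3.
have [MT [MT0 HMT]] := error_system_bounded th01 Kc0 Q_ge0 H2 H3.
pose k3 := maxn k1 k2.
have M1 : 0 <= M + MT + 1 by rewrite !addr_ge0.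
have k31 k : (k3 <= k)%N -> (k1 <= k)%N by rewrite geq_max => /andP[].
have k32 k : (k3 <= k)%N -> (k2 <= k)%N by rewrite geq_max => /andP[].
have k03 : (k0 <= k3)%N := leq_trans kk1 (leq_maxl _ _).
have [|k kk|xi Hxi] := @xstep 0%N (M + MT + 1) k3 M1 k03.
- by move=> k /k31; exact: H1.
- have [_ hQ] := HM k (k32 k kk).
  have hT := HMT k (k31 k kk).
  rewrite /G expr1 2!mulrDl mul1r; apply: lerD; last first.
    by rewrite exprS ler_piMr// exprn_ile1// invS_le1.
  by apply: lerD => //; rewrite mulrC ler_wpM2r.
exists l, xi, (M + 12 * Kc * (M + MT + 1)), k3; split.
  by rewrite addr_ge0// mulr_ge0// mulr_ge0.
move=> k kk; have [h1 h2] := HM k (k32 k kk).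
have eh0 : 0 <= e k * h k by rewrite mulr_ge0// ltW.
have ek := e0 k.
have KM : 0 <= 12 * Kc * (M + MT + 1) by rewrite mulr_ge0// mulr_ge0.
split.
- rewrite tauE -mulrBl cnM cn_RtoC (ger0_norm (ltW ek)).
  apply: (@le_trans _ _ (M * (e k * h k))); last by rewrite ler_wpM2r// lerDl.
  by rewrite (mulrC (e k)) mulrA ler_wpM2r// ltW.
- apply: le_trans (Hxi k kk) _; rewrite expr1 ler_wpM2r// lerDr//.
- rewrite QE; apply: (@le_trans _ _ (M * (e k * h k))); last by rewrite ler_wpM2r// lerDl.
  by rewrite (mulrC (e k)) mulrA ler_wpM2r// ltW.
Qed.

(** The second pass, meant for the difference between the exact solution and a multiple of the
    approximate one, where [tau] tends to 0 and all errors sink to the order of the residuals. *)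
Lemma perturbed_recurrence_decay :
  (forall x : R, 0 < x -> exists N, forall k, (N <= k)%N -> cn (ap tr (d k)) <= x * e k) ->
  exists xi M k1, 0 <= M /\ forall k, (k1 <= k)%N ->
    cn (ap tr (d k)) <= M * (e k * h k ^+ m.+1) /\
    cn (ap xr (d k) - xi) <= M * (e k * h k ^+ m.+1).
Proof.
move=> H0.
have [k1 [kk1 [H1 [H2 H3]]]] := error_hyps.
have tau0 x : 0 < x -> exists N, forall k, (N <= k)%N -> cn (tau k) <= x.
  move=> /H0[N HN]; exists N => k kN; have := HN k kN.
  by rewrite tauE cnM cn_RtoC (ger0_norm (ltW (e0 k))) ler_pM2r.
have [M [k2 [M0 HM]]] := error_system_decay th01 Kc0 Q_ge0 H2 H3 tau0.
pose k3 := maxn k1 k2.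
have M1 : 0 <= M + M + 1 by rewrite !addr_ge0.
have k31 k : (k3 <= k)%N -> (k1 <= k)%N by rewrite geq_max => /andP[].
have k32 k : (k3 <= k)%N -> (k2 <= k)%N by rewrite geq_max => /andP[].
have k03 : (k0 <= k3)%N := leq_trans kk1 (leq_maxl _ _).
have [|k kk|xi Hxi] := @xstep m (M + M + 1) k3 M1 k03.
- by move=> k /k31; exact: H1.
- have [hT hQ] := HM k (k32 k kk).
  rewrite /G 2!mulrDl mul1r lerD2r; apply: lerD => //.
  by apply: le_trans hT; rewrite ler_piMl ?cn_ge0// invS_le1.
exists xi, (M + 12 * Kc * (M + M + 1)), k3; split.
  by rewrite addr_ge0// mulr_ge0// mulr_ge0.
move=> k kk; have [h1 h2] := HM k (k32 k kk).
have ek := e0 k.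
have eh0 : 0 <= e k * h k ^+ m.+1 by rewrite mulr_ge0 ?exprn_ge0// ltW.
have KM : 0 <= 12 * Kc * (M + M + 1) by rewrite mulr_ge0// mulr_ge0.
split.
- rewrite tauE cnM cn_RtoC (ger0_norm (ltW ek)).
  apply: (@le_trans _ _ (M * (e k * h k ^+ m.+1))); last by rewrite ler_wpM2r// lerDl.
  by rewrite (mulrC (e k)) mulrA ler_wpM2r// ltW.
- by apply: le_trans (Hxi k kk) _; rewrite ler_wpM2r// lerDr.
Qed.

End PerturbedRecurrence.

Lemma le1_cases (k : nat) : (k <= 1)%N -> k = 0%N \/ k = 1%N.
Proof. by lia. Qed.

Lemma ord2 (i : 'I_2) : i = 0 \/ i = 1.
Proof. by case: i => [[|[|]]]// ?; [left|right]; apply/val_inj. Qed.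

Lemma sum_ord2 (V : nmodType) (F : 'I_2 -> V) : \sum_j F j = F 0 + F 1.
Proof. by rewrite big_ord_recl big_ord1; congr (_ + F _); apply/val_inj. Qed.

(** Reduces a goal that differs from a known equation by a polynomial identity to a goal for
    [ring]. *)
Lemma eq_by_sub (V : zmodType) (l r x y : V) : l = r -> x - y = l - r -> x = y.
Proof. by move=> -> /eqP; rewrite subrr subr_eq0 => /eqP. Qed.

(** * Algebra of adding one term to the truncated expansion *)

Section StepIdentities.
Variable F : fieldType.
Implicit Types (a q : F) (X Y Z : 'cV[F]_2).

(** In these identities all matrix products are replaced by free vectors, so that entry by entry
    [ring] can finish. *)
Lemma Wapp_step_identity q a1 a2 X1 X2 X3 Y1 Y2 Y3 :
  (1 - q) *: X1 = - q *: X2 + X3 + a1 *: (Y1 - q *: Y2) ->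
  (1 - q) *: (X1 + a1 *: (q *: Y2 + Y3)) =
  - q *: (X2 + a2 *: (q *: Y2 + Y3)) + (X3 + a2 *: (Y1 + Y3))
    + (a1 - a2) *: (Y1 + Y3 - q *: (q *: Y2 + Y3)).
Proof.
move=> H; apply/matrixP => i j.
have := congr1 (fun M : 'cV[F]_2 => M i j) H; rewrite !mxE => /eq_by_sub; apply.
ring.
Qed.

Lemma Uapp_step_identity k dl N a1 a2 a3 q X1 X2 X3 X4 X5 Y1 Y2 Y3 Y4 Y5 Z1 Z2 Z3 d1 u1 :
  k * a2 = - (dl + (N + 1)) * (a1 - a2) ->
  k *: X5 = X1 - X2 - X3 - (- q) *: X4 -
    (a2 *: Y1 - a1 *: ((dl + N) *: d1 - Y2 - Y3 + Y4 - q *: Y5)) ->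
  k *: (X5 + a2 *: (d1 + u1)) = (X1 + a2 *: (Y2 + Z1))
   - (X2 + (a1 - a2) *: (Y3 + ((dl + (N + 1)) *: u1 + Y2 + d1 - Y4 + q *: Y5)))
   - (X3 + (a2 - a3) *: (Y1 + Z2)) - (- q) *: (X4 + a2 *: (q *: Y5 + Z3))
   - (a3 *: (Y1 + Z2) - a2 *: ((dl + (N + 1)) *: (d1 + u1) - (Y2 + Z1)
       - (Y3 + ((dl + (N + 1)) *: u1 + Y2 + d1 - Y4 + q *: Y5)) + Z2 - q *: (q *: Y5 + Z3))).
Proof.
move=> H1 H2; apply/matrixP => i j.
have := congr1 (fun M : 'cV[F]_2 => M i j) H2; rewrite !mxE => H3.
apply: (eq_by_sub H3).
transitivity (k * a2 * (d1 i j + u1 i j) - (- (dl + (N + 1)) * (a1 - a2)) * (d1 i j + u1 i j)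
 + (k * X5 i j - (X1 i j - X2 i j - X3 i j - - q * X4 i j -
   (a2 * Y1 i j - a1 * ((dl + N) * d1 i j - Y2 i j - Y3 i j + Y4 i j - q * Y5 i j))))).
  ring.
by rewrite H1; ring.
Qed.

Lemma Uapp_base_identity k dl a0 a1 a2 q X1 X2 X3 b :
  k * a1 = - (dl + 0%:R) * (a0 - a1) ->
  k *: (a1 *: b) = a1 *: X1 - (a0 - a1) *: (dl *: b) - (a1 - a2) *: X2
    - (- q) *: (a1 *: X3)
    - (a2 *: X2 - a1 *: ((dl + 0%:R) *: b - X1 - dl *: b + X2 - q *: X3)).
Proof.
by move=> H1; apply/matrixP => i j; rewrite !mxE mulrA H1; ring.
Qed.

Lemma udst_rec_identity x1 x2 y r1 r2 X1 X2 X3 X4 u1 d1 :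
  x2 = x1 + y -> r2 = r1 + 1 ->
  X1 + x1 *: u1 = X2 + r2 *: d1 - X3 + X4 ->
  X1 + x2 *: u1 = y *: u1 + (X2 + r1 *: d1) + d1 - X3 + X4.
Proof.
move=> -> -> H; apply/matrixP => i j.
have := congr1 (fun M : 'cV[F]_2 => M i j) H; rewrite !mxE => /eq_by_sub; apply.
ring.
Qed.

End StepIdentities.

(** * Vectors and matrices of size two *)

Section TwoByTwo.
Variable R : realType.
Local Notation CC := (C R).

Definition row2 (x1 x2 : CC) : 'rV[CC]_2 := \row_j if j == 0 then x1 else x2.

Lemma row2_mul x1 x2 (v : 'cV[CC]_2) : (row2 x1 x2 *m v) 0 0 = x1 * v 0 0 + x2 * v 1 0.
Proof. by rewrite !mxE sum_ord2 !mxE. Qed.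

Lemma mx2_mul (x11 x12 x21 x22 : CC) (v : 'cV[CC]_2) :
  mx2 x11 x12 x21 x22 *m v = vec2 (x11 * v 0 0 + x12 * v 1 0) (x21 * v 0 0 + x22 * v 1 0).
Proof.
apply/matrixP => i j; rewrite (ord1 j) !mxE sum_ord2 !mxE.
by case: (ord2 i) => ->.
Qed.

Lemma mx2_scalar (x11 x12 x21 x22 a : CC) :
  mx2 x11 x12 x21 x22 + a%:M = mx2 (x11 + a) x12 x21 (x22 + a).
Proof.
apply/matrixP => i j; rewrite !mxE.
by case: (ord2 i) => ->; case: (ord2 j) => -> /=; rewrite ?mulr1n ?mulr0n ?addr0.
Qed.

Lemma mx2_upper_unit (a b d : CC) : a != 0 -> d != 0 -> mx2 a b 0 d \in unitmx.
Proof.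
move=> a0 d0.
have : mx2 a b 0 d *m mx2 a^-1 (- b / (a * d)) 0 d^-1 = 1%:M.
  apply/matrixP => i j; rewrite !mxE sum_ord2 !mxE.
  case: (ord2 i) => ->; case: (ord2 j) => -> /=; rewrite ?mulr1n ?mulr0n.
  - by field; rewrite a0.
  - by field; rewrite a0 d0.
  - by ring.
  - by field; rewrite d0.
by move/mulmx1_unit => [].
Qed.

Lemma vec2E (v : 'cV[CC]_2) : v = vec2 (v 0 0) (v 1 0).
Proof. by apply/matrixP => i j; rewrite (ord1 j) !mxE; case: (ord2 i) => ->. Qed.

Lemma cV2P (v w : 'cV[CC]_2) : v 0 0 = w 0 0 -> v 1 0 = w 1 0 -> v = w.
Proof. by move=> e1 e2; rewrite (vec2E v) (vec2E w) e1 e2. Qed.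

Lemma vec2_0 (x y : CC) : vec2 x y 0 0 = x. Proof. by rewrite mxE. Qed.
Lemma vec2_1 (x y : CC) : vec2 x y 1 0 = y. Proof. by rewrite mxE. Qed.

(** The pairing is the determinant of the matrix with columns [v] and [w], hence alternating. *)
Lemma J_pair (v w : 'cV[CC]_2) :
  (v^T *m (Jmx R *m w)) 0 0 = v 0 0 * w 1 0 - v 1 0 * w 0 0.
Proof. by rewrite /Jmx mx2_mul !mxE sum_ord2 !mxE/=; ring. Qed.

End TwoByTwo.

(** * Big-O calculus relative to the scale $e_k (k+1)^{-j}$ *)

Section WeightBounds.
Variables (R : realType) (sig : nat).
Hypothesis hsig : (sig <= 1)%N.
Local Notation h k := ((k.+1%:R : R)^-1).
Local Notation e := (ewt R sig).

Definition weight_bound (f : nat -> R) (j : nat) := exists M k1, 0 <= M /\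
  forall k, (k1 <= k)%N -> f k <= M * (e k * h k ^+ j).

Lemma weight_boundD f g j : weight_bound f j -> weight_bound g j ->
  weight_bound (fun k => f k + g k) j.
Proof.
move=> [M [k1 [M0 H]]] [N [k2 [N0 K]]]; exists (M + N), (maxn k1 k2).
split; first exact: addr_ge0.
move=> k; rewrite geq_max => /andP[/H h1 /K h2].
by rewrite mulrDl lerD.
Qed.

Lemma weight_boundZ f j (a : R) : 0 <= a -> weight_bound f j ->
  weight_bound (fun k => a * f k) j.
Proof.
move=> a0 [M [k1 [M0 H]]]; exists (a * M), k1.
split; first exact: mulr_ge0.
by move=> k /H h1; rewrite -mulrA ler_wpM2l.
Qed.

Lemma weight_bound_le f g j : (forall k, f k <= g k) -> weight_bound g j -> weight_bound f j.
Proof.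
move=> fg [M [k1 [M0 H]]]; exists M, k1; split=> // k /H; exact: le_trans.
Qed.

Lemma weight_bound_weak f i j : (i <= j)%N -> weight_bound f j -> weight_bound f i.
Proof.
move=> ij [M [k1 [M0 H]]]; exists M, k1; split=> // k /H /le_trans; apply.
rewrite ler_wpM2l// ler_wpM2l ?(ltW (ewt_gt0 R hsig k))//.
by apply: ler_wiXn2l => //; exact: invS_le1.
Qed.

Lemma ewt_next k : e k.+1 <= (1 + h k) * e k.
Proof.
rewrite ewtS ler_wpM2r ?(ltW (ewt_gt0 R hsig k))//.
have := invS_gt0 R k; move: (h k) => x x0.
by case: (dl_cases R hsig) => ->; lra.
Qed.

Lemma ewt_le_lin k : e k <= k.+1%:R.
Proof.
elim: k => [|k IH]; first by rewrite /ewt big_ord0.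
apply: le_trans (ewt_next k) _.
have h0 : 0 <= 1 + h k by rewrite addr_ge0.
apply: le_trans (ler_wpM2l h0 IH) _.
by rewrite mulrDl mul1r mulVf// natr1.
Qed.

Lemma weight_bound_shift f j : weight_bound f j -> weight_bound (fun k => f k.+1) j.
Proof.
move=> [M [k1 [M0 H]]]; exists (M * 2), k1.
split; first exact: mulr_ge0.
move=> k kk; apply: le_trans (H k.+1 (leqW kk)) _.
rewrite -mulrA ler_wpM2l// mulrA; apply: ler_pM.
- exact: ltW (ewt_gt0 _ _ _).
- by rewrite exprn_ge0.
- apply: le_trans (ewt_next k) _; rewrite ler_wpM2r ?(ltW (ewt_gt0 R hsig k))//.
  by have := invS_le1 R k; move: (h k) => x; lra.
- by apply: lerXn2r; rewrite ?nnegrE//; exact: invS_le.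
Qed.

Lemma weight_bound_Ewt l : weight_bound (fun k => `|Ewt R sig l k|) l.
Proof.
have [M [k1 [M0 H]]] := Ewt_le R hsig l; exists M, k1; split=> // k /H.
by rewrite mulrA.
Qed.

Lemma weight_bound_Ewt_vec l j (f : nat -> R) (v : 'cV[C R]_2) : (j <= l)%N ->
  weight_bound (fun k => `|f k|) l -> weight_bound (fun k => nm (RtoC (f k) *: v)) j.
Proof.
move=> jl H; apply: weight_bound_weak jl _.
apply: (@weight_bound_le _ (fun k => nm v * `|f k|)); last first.
  exact: weight_boundZ (nm_ge0 _) _.
by move=> k; rewrite nmZ cn_RtoC mulrC.
Qed.

End WeightBounds.

Lemma eventually_bounded (R : realType) (f g : nat -> R) (M : R) k1 : 0 <= M ->
  (forall k, 0 <= f k) -> (forall k, 1 <= g k) ->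
  (forall k, (k1 <= k)%N -> f k <= M * g k) ->
  exists M', forall k, f k <= M' * g k.
Proof.
move=> M0 f0 g1 H; exists (M + \sum_(i < k1) f i) => k.
have S0 : 0 <= \sum_(i < k1) f i by exact: sumr_ge0.
have g0 : 0 <= g k by apply: le_trans (g1 k).
have [kk|kk] := leqP k1 k.
  by apply: le_trans (H k kk) _; rewrite ler_wpM2r// lerDl.
apply: (@le_trans _ _ (\sum_(i < k1) f i)).
  by rewrite (bigD1 (Ordinal kk))//= lerDl sumr_ge0.
by apply: le_trans (ler_peMr S0 (g1 k)) _; rewrite ler_wpM2r// lerDr.
Qed.

(** * The exact recurrence and its truncated approximate solution *)

Section Asymptotics.
Variables (R : realType) (c : R) (lam mu gam : C R) (rho sig n : nat).
Hypotheses (hc : 1 < c) (hrho : (rho <= 1)%N) (hsig : (sig <= 1)%N).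
Local Notation CC := (C R).
Local Notation h k := ((k.+1%:R : R)^-1).
Local Notation dl := (1 / 2 - sig%:R : R).
Local Notation e := (ewt R sig).
Local Notation E := (Ewt R sig).
Local Notation ap r v := ((r *m v) 0 0).
Local Notation A := (Amx lam).
Local Notation B := (Bmx c lam mu gam).
Local Notation Rm := (Rmx c lam mu gam).
Local Notation S := (Smx R).
Local Notation b1 := (b1 c lam mu gam sig).
Local Notation b2 := (b2 c lam mu gam sig).
Local Notation b12 := (b12 c lam mu gam).

(** [A'] and [B'] are $A-\alpha_0$ and $B-\beta_1$, the residues after the gauge; [B'] has
    eigenvalue 0 on $b_1$ and $\delta$ on $b_2$. *)
Definition A' : 'M[CC]_2 := A + (RtoC (rho%:R / 2))%:M.
Definition B' : 'M[CC]_2 := B + (RtoC (- sig%:R / 2 + 1 / 2))%:M.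
Definition S' : 'M[CC]_2 := (RtoC c)^-1 *: S.
Definition R' : 'M[CC]_2 := (RtoC c)^-1 *: Rm.

(* The dual basis of [(b1, b2)]. *)
Definition xr : 'rV[CC]_2 :=
  if sig == 0%N then row2 2 (- (4 * b12)) else row2 0 1.
Definition tr : 'rV[CC]_2 :=
  if sig == 0%N then row2 0 1 else row2 2 (- (4 * b12)).

Let sig_cases : sig = 0%N \/ sig = 1%N. Proof. exact: le1_cases. Qed.

Let b1E : b1 = if sig == 0%N then vec2 (1 / 2) 0 else vec2 (2 * b12) 1.
Proof.
rewrite /Defs.b1 /sigR; case: sig_cases => -> /=.
  by rewrite mulr0n subr0 RtoC0 mulr0 add0r RtoC_half.
by rewrite mulr1n subrr mul0r RtoC0 RtoC1 addr0 mulr1.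
Qed.

Let b2E : b2 = if sig == 0%N then vec2 (2 * b12) 1 else vec2 (1 / 2) 0.
Proof.
rewrite /Defs.b2 /sigR; case: sig_cases => -> /=.
  by rewrite mulr0n subr0 mul0r RtoC0 RtoC1 addr0 mulr1.
by rewrite mulr1n subrr RtoC0 mulr0 add0r RtoC_half.
Qed.

Lemma tr_b2 : ap tr b2 = 1.
Proof.
rewrite b2E /tr; case: ifP => _; rewrite row2_mul vec2_0 vec2_1; first by ring.
by field.
Qed.
Lemma xr_b2 : ap xr b2 = 0.
Proof.
rewrite b2E /xr; case: ifP => _; rewrite row2_mul vec2_0 vec2_1; by ring.
Qed.
Lemma xr_b1 : ap xr b1 = 1.
Proof.
rewrite b1E /xr; case: ifP => _; rewrite row2_mul vec2_0 vec2_1; first by field.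
by ring.
Qed.

Lemma dual_basis v : v = ap xr v *: b1 + ap tr v *: b2.
Proof.
rewrite b1E b2E /xr /tr; case: ifP => _; rewrite !row2_mul; apply: cV2P;
  rewrite !mxE/=; by field.
Qed.

(** [B'] kills [b1] and scales [b2] by $\delta$, so it has rank one, the form that the abstract
    recurrence expects. *)
Lemma B'E v : B' *m v = (RtoC dl * ap tr v) *: b2.
Proof.
rewrite /B' /Bmx mx2_scalar mx2_mul b2E /tr.
case: sig_cases => -> /=; rewrite row2_mul; apply: cV2P; rewrite !mxE/=;
  rewrite ?mulr0n ?mulr1n !(RtoC_nat, RtoC0, RtoC1, RtoCB, RtoCD, RtoCM, RtoCN, RtoCV); by field.
Qed.

Lemma b1_J_b2 : cn ((b1^T *m (Jmx R *m b2)) 0 0) = 1 / 2.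
Proof.
rewrite J_pair b1E b2E; case: ifP => _; rewrite !vec2_0 !vec2_1.
  by rewrite mul0r subr0 mulr1 -RtoC_half cn_RtoC ger0_norm.
by rewrite mulr0 mul1r sub0r cnN -RtoC_half cn_RtoC ger0_norm.
Qed.

Local Notation u_ k := (uds c lam mu gam rho sig k).1.1.
Local Notation s_ k := (uds c lam mu gam rho sig k).2.
Local Notation d_ k := (d_ c lam mu gam rho sig k).
Local Notation ut k := (udst c lam mu gam rho sig k).1.1.
Local Notation st k := (udst c lam mu gam rho sig k).2.
Local Notation dt k := (dt_ c lam mu gam rho sig k).

(** These are the diagonal entries of the triangular matrices inverted in [uds] and [udst]; all are
    negative because $r/2 < k+1$. So [invmx] is a genuine inverse there. *)
Lemma shifted_neq0 (a : R) (r k : nat) : (r <= 1)%N -> a = 0 \/ a = - (1 / 2) ->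
  a + (r%:R / 2 - k.+1%:R) != 0.
Proof.
move=> r1 ha; have r0 : r%:R <= 1 :> R by rewrite -[leRHS]/(1%:R) ler_nat.
have k0 : 0 <= k%:R :> R by [].
rewrite lt_eqF// -(natr1 k); move: (k%:R : R) (r%:R : R) k0 r0 => x y *.
by case: ha => ->; lra.
Qed.

Let mhalf : - (1 / 2) = RtoC (- (1 / 2)) :> CC.
Proof. by rewrite RtoCN RtoC_half. Qed.

Lemma dS k : d_ k.+1 = d_ k + u_ k.+1.
Proof. by rewrite /Defs.d_ /=; case: (uds _ _ _ _ _ _ k) => [[u d] s]. Qed.

Lemma sS k : s_ k.+1 = (RtoC c)^-1 *: s_ k + u_ k.+1.
Proof. by rewrite /=; case: (uds _ _ _ _ _ _ k) => [[u d] s]. Qed.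

Lemma uds_rec k : (A + (RtoC (rho%:R / 2 - k.+1%:R))%:M) *m u_ k.+1 =
  B' *m d_ k + (RtoC c)^-1 *: (S *m u_ k) + (RtoC c)^-1 *: (Rm *m s_ k).
Proof.
have un : A + (RtoC (rho%:R / 2 - k.+1%:R))%:M \in unitmx.
  rewrite /Amx mx2_scalar mhalf -RtoCD add0r; apply: mx2_upper_unit.
    by rewrite RtoC_eq0 shifted_neq0//; right.
  by rewrite RtoC_eq0 -(add0r (_ / _ - _)) shifted_neq0//; left.
rewrite /Defs.d_ /=; case: (uds _ _ _ _ _ _ k) => [[u d] s] /=.
by rewrite mulKVmx.
Qed.

Lemma uS k : RtoC k.+1%:R *: u_ k.+1 = A' *m u_ k.+1 -
   (RtoC dl * ap tr (d_ k)) *: b2 - S' *m u_ k - R' *m s_ k.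
Proof.
have := uds_rec k; rewrite B'E /S' /R' -!scalemxAl /A' !mulmxDl !mul_scalar_mx.
rewrite RtoCB scalerBl.
move: (A *m _) (RtoC (_ / _) *: _) (RtoC _%:R *: _) (_ *: b2) (_ *: (S *m _)) (_ *: (Rm *m _)).
move=> x1 x2 x3 x4 x5 x6 H; apply/matrixP => i j.
by have := congr1 (fun M : 'cV[CC]_2 => M i j) H; rewrite !mxE => /esym/eq_by_sub; apply; ring.
Qed.

Lemma udst_rec k : (B + (RtoC (sig%:R / 2 - k.+1%:R))%:M) *m ut k.+1 =
  (A + (RtoC (rho%:R / 2 + 1))%:M) *m dt k - (RtoC c)^-1 *: (S *m ut k)
    + (RtoC (1 - c))^-1 *: (Rm *m st k).
Proof.
have un : B + (RtoC (sig%:R / 2 - k.+1%:R))%:M \in unitmx.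
  rewrite /Bmx mx2_scalar mhalf -RtoCD add0r; apply: mx2_upper_unit.
    by rewrite RtoC_eq0 shifted_neq0//; right.
  by rewrite RtoC_eq0 -(add0r (_ / _ - _)) shifted_neq0//; left.
rewrite /Defs.dt_ /=; case: (udst _ _ _ _ _ _ k) => [[u d] s] /=.
by rewrite mulKVmx.
Qed.

Lemma dtS k : dt k.+1 = dt k + ut k.+1.
Proof. by rewrite /Defs.dt_ /=; case: (udst _ _ _ _ _ _ k) => [[u d] s]. Qed.

Lemma stS k : st k.+1 = (RtoC (1 - c))^-1 *: st k + ut k.+1.
Proof. by rewrite /=; case: (udst _ _ _ _ _ _ k) => [[u d] s]. Qed.

Local Notation q := ((RtoC (1 - c))^-1).
(* Termwise coefficients of the local solution at [z = 1] with exponent [beta2], expanded at [z = 0] and truncated after [N + 1] terms. *)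
Definition Dapp N k : 'cV[CC]_2 := \sum_(l < N.+1) RtoC (E l k) *: dt l.
Definition Uapp N k : 'cV[CC]_2 := \sum_(l < N.+1) RtoC (E l.+1 k) *: dt l.
(** The index [k.+1] is a division by $z$. Formally the local solution has $U = (1-z)^\delta\sum_l
    \tilde d_l(1-z)^l$ and $U/(1-z/c) = (1-q)\,z^{-1}(1-z)^\delta\sum_l\tilde s_l(1-z)^l$, because
    $1-q(1-z) = (c-z)/(c-1)$. *)
Definition Wapp N k : 'cV[CC]_2 := (1 - q) *: \sum_(l < N.+1) RtoC (E l.+1 k.+1) *: st l.

Lemma DappS N k : Dapp N k.+1 = Dapp N k + Uapp N k.+1.
Proof.
rewrite /Dapp /Uapp -big_split; apply: eq_bigr => l _ /=.
by rewrite -scalerDl -RtoCD Ewt_diff// addrC subrK.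
Qed.

Let c0 : RtoC c != 0. Proof. by rewrite RtoC_eq0 gt_eqF// (lt_trans ltr01). Qed.
Let cm1 : RtoC (1 - c) != 0. Proof. by rewrite RtoC_eq0 lt_eqF// subr_lt0. Qed.

Let cq : (RtoC c)^-1 * (1 - q) = - q.
Proof. by move: cm1; rewrite RtoCB RtoC1 => c1; field; rewrite c0 c1. Qed.

Definition rhoapp N k : 'cV[CC]_2 := RtoC (E N.+2 k.+2) *: (dt N - q *: st N).

Lemma WappS N k :
  Wapp N k.+1 = RtoC c^-1 *: Wapp N k + Uapp N k.+1 + rhoapp N k.
Proof.
rewrite RtoCV /Wapp /Uapp /rhoapp scalerA cq; elim: N => [|N IH].
  rewrite !big_ord1 /= /Defs.dt_ /= (Ewt_diff R hsig 1 k.+1).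
  rewrite RtoCB; apply/matrixP => i j; rewrite !mxE; ring.
rewrite !(big_ord_recr N.+1)/=.
rewrite (Ewt_diff R hsig N.+2 k.+1) RtoCB.
rewrite stS dtS; exact: Wapp_step_identity.
Qed.

(** The residual of the truncation. Only the top index [N] occurs because the lower terms telescope,
    and the weights $E_{N+1}$, $E_{N+2}$ supply the order $e_k k^{-N-1}$. *)
Definition rapp N k : 'cV[CC]_2 := RtoC (E N.+2 k.+1) *: (S' *m dt N) -
  RtoC (E N.+1 k.+1) *: ((RtoC dl + N%:R) *: dt N - A' *m dt N - B' *m dt N
     + S' *m ut N - q *: (Rm *m st N)).

(** Induction on [N]: the recurrence defining [ut N.+1] is exactly what turns the residual of one
    truncation into that of the next. *)
Lemma UappS N k : RtoC k.+1%:R *: Uapp N k.+1 = A' *m Uapp N k.+1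
   - B' *m Dapp N k - S' *m Uapp N k - R' *m Wapp N k - rapp N k.
Proof.
have R'W v : R' *m ((1 - q) *: v) = (- q) *: (Rm *m v).
  by rewrite /R' -scalemxAl -scalemxAr scalerA cq.
have mul l : RtoC k.+1%:R * RtoC (E l.+1 k.+1) =
   - (RtoC dl + l%:R) * (RtoC (E l k.+1) - RtoC (E l.+1 k.+1)).
  by rewrite -RtoCM Ewt_mul// RtoCM RtoCN RtoCD RtoC_nat [in LHS]RtoCB.
have diff l : RtoC (E l k) = RtoC (E l k.+1) - RtoC (E l.+1 k.+1).
  by rewrite -RtoCB Ewt_diff// opprB addrC subrK.
rewrite /Wapp R'W /Uapp /Dapp /rapp; elim: N => [|N IH].
  rewrite !big_ord1 /= /Defs.dt_ /= -!scalemxAr B'E tr_b2 mulr1 !diff.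
  exact: Uapp_base_identity.
rewrite !(big_ord_recr N.+1)/= !mulmxDr -!scalemxAr !diff.
(* The matrix inverted in [udst] is [B'] minus the scalar $\delta+N+1$, so its recurrence can be
   solved for the product with [B']. *)
have rec : B' *m ut N.+1 = (RtoC dl + N.+1%:R) *: ut N.+1 + A' *m dt N + dt N - S' *m ut N + q *: (Rm *m st N).
  have := udst_rec N.
  rewrite /B' /A' /S' !mulmxDl !mul_scalar_mx -!scalemxAl.
  apply: udst_rec_identity; last by rewrite RtoCD.
  by rewrite -RtoC_nat -!RtoCD; congr RtoC; lra.
rewrite dtS stS !mulmxDr rec -!scalemxAr.
have H1 := mul N.+1; rewrite -(natr1 N) in H1 *.
exact: Uapp_step_identity.
Qed.

End Asymptotics.

Lemma row_mul_subZ (F : fieldType) (r : 'rV[F]_2) (v w : 'cV[F]_2) a :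
  (r *m (v - a *: w)) 0 0 = (r *m v) 0 0 - a * (r *m w) 0 0.
Proof. by rewrite !mxE !sum_ord2 !mxE; ring. Qed.

(** * The alternating pairing given by [Jmx] *)

Section SymplecticPairing.
Variable R : realType.
Implicit Types (v w b d p : 'cV[C R]_2).
Local Notation "[ v , w ]J" := ((v^T *m (Jmx R *m w)) 0 0) (at level 0).

Lemma J_pair_split v p b : [v, p]J = [v, b]J + [v, p - b]J.
Proof.
rewrite !J_pair !mxE; move: (v 0 0) (v 1 0) (b 0 0) (b 1 0) (p 0 0) (p 1 0) => *.
by ring.
Qed.

Lemma J_pair_comb d b p (xi l a : C R) :
  [d - xi *: b - l *: (a *: p), p]J = [d, p]J - xi * [b, p]J.
Proof.
rewrite !J_pair !mxE; move: (d 0 0) (d 1 0) (b 0 0) (b 1 0) (p 0 0) (p 1 0) => *.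
by ring.
Qed.

Lemma pair_scale v w (a : C R) : (v^T *m (a *: w)) 0 0 = a * (v^T *m w) 0 0.
Proof. by rewrite -scalemxAr mxE. Qed.
End SymplecticPairing.

Section LinearCombination.
Variable F : fieldType.
Implicit Types (A S T : 'M[F]_2) (u d s U D W r b : 'cV[F]_2).

Lemma combine_s l (ci : F) s' s u' W' W U' r :
  s' = ci *: s + u' -> W' = ci *: W + U' + r ->
  s' - l *: W' = ci *: (s - l *: W) + (u' - l *: U') + - l *: r.
Proof.
by move=> -> ->; apply/matrixP => i j; rewrite !mxE; ring.
Qed.

Lemma combine_u l (kk dl : F) A S T (tr : 'rV[F]_2) b u' u d s U' U D W r :
  kk *: u' = A *m u' - (dl * (tr *m d) 0 0) *: b - S *m u - T *m s ->
  kk *: U' = A *m U' - (dl * (tr *m D) 0 0) *: b - S *m U - T *m W - r ->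
  kk *: (u' - l *: U') = A *m (u' - l *: U') - (dl * (tr *m (d - l *: D)) 0 0) *: b
    - S *m (u - l *: U) - T *m (s - l *: W) - - l *: r.
Proof.
move=> H1 H2; rewrite row_mul_subZ !mulmxBr -!scalemxAr scalerBr H1.
rewrite (_ : kk *: (l *: U') = l *: (kk *: U')); last by rewrite !scalerA mulrC.
rewrite H2.
move: (A *m u') (A *m U') (S *m u) (S *m U) (T *m s) (T *m W) => x1 x2 x3 x4 x5 x6.
move: ((tr *m d) 0 0) ((tr *m D) 0 0) => y1 y2.
by apply/matrixP => i j; rewrite !mxE; ring.
Qed.
End LinearCombination.

(** * Asymptotics of [d_] and of [Theta_] *)

Section ThetaAsymptotics.
Variables (R : realType) (c : R) (lam mu gam : C R) (rho sig n : nat).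
Hypotheses (hc : 1 < c) (hrho : (rho <= 1)%N) (hsig : (sig <= 1)%N).
Local Notation CC := (C R).
Local Notation h k := ((k.+1%:R : R)^-1).
Local Notation dl := (1 / 2 - sig%:R : R).
Local Notation e := (ewt R sig).
Local Notation E := (Ewt R sig).
Local Notation ap r v := ((r *m v) 0 0).
Local Notation b1 := (b1 c lam mu gam sig).
Local Notation b2 := (b2 c lam mu gam sig).
Local Notation A' := (A' lam rho).
Local Notation S' := (S' c).
Local Notation R' := (R' c lam mu gam).
Local Notation xr := (xr c lam mu gam sig).
Local Notation tr := (tr c lam mu gam sig).
Local Notation u_ k := (uds c lam mu gam rho sig k).1.1.
Local Notation s_ k := (uds c lam mu gam rho sig k).2.
Local Notation d_ k := (d_ c lam mu gam rho sig k).
Local Notation dt k := (dt_ c lam mu gam rho sig k).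
Local Notation Dapp := (Dapp c lam mu gam rho sig).
Local Notation Uapp := (Uapp c lam mu gam rho sig).
Local Notation Wapp := (Wapp c lam mu gam rho sig).
Local Notation rapp := (rapp c lam mu gam rho sig).
Local Notation rhoapp := (rhoapp c lam mu gam rho sig).

Lemma rapp_bound : weight_bound sig (fun k => nm (rapp n k)) n.+1.
Proof.
apply: (@weight_bound_le _ _ _ (fun k => _ + _)); first by move=> k; exact: nmB.
apply: weight_boundD.
  apply: (@weight_bound_Ewt_vec _ _ hsig n.+2) => //.
  exact: (weight_bound_shift hsig (weight_bound_Ewt R hsig n.+2)).
apply: (@weight_bound_Ewt_vec _ _ hsig n.+1) => //.
exact: (weight_bound_shift hsig (weight_bound_Ewt R hsig n.+1)).
Qed.

Lemma rhoapp_bound : weight_bound sig (fun k => nm (rhoapp n k)) n.+1.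
Proof.
apply: (@weight_bound_Ewt_vec _ _ hsig n.+2) => //.
have H := weight_bound_shift hsig (weight_bound_Ewt R hsig n.+2).
exact: (weight_bound_shift hsig H).
Qed.

Lemma Dapp_leading : weight_bound sig (fun k => nm (Dapp n k - RtoC (e k) *: b2)) 1.
Proof.
elim: n => [|N IH].
  exists 0, 0%N; split=> // k _; rewrite /Dapp big_ord1 /Ewt /eprod big_geq// mulr1.
  by rewrite subrr -(scale0r 0) nmZ cn0 !mul0r.
apply: (@weight_bound_le _ _ _ (fun k => nm (Dapp N k - RtoC (e k) *: b2)
   + nm (RtoC (E N.+1 k) *: dt N.+1))).
  move=> k; rewrite /Dapp big_ord_recr/= addrAC; exact: nmD.
apply: weight_boundD => //.
by apply: (@weight_bound_Ewt_vec _ _ hsig N.+1) => //; exact: weight_bound_Ewt.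
Qed.

Lemma DappE k : Dapp n k = RtoC (e k) *: p_ c lam mu gam rho sig n k.
Proof.
rewrite /Dapp /p_ -(big_mkord xpredT (fun l => RtoC (E l k) *: dt l)) big_nat_recl//.
rewrite {1}/Ewt {1}/eprod big_geq// mulr1 scalerDr; congr (_ + _).
rewrite big_add1 /= scaler_sumr; apply: eq_bigr => l _.
by rewrite scalerA -RtoCM.
Qed.

Let nm0 m1 m2 : nm (0 : 'M[CC]_(m1, m2)) = 0.
Proof. by rewrite -(scale0r 0) nmZ cn0 mul0r. Qed.

(** The residuals vanish here; the outcome fixes the multiple [l] of the approximate solution that
    is subtracted in [d_asymptotics]. *)
Lemma exact_recurrence_cvg : exists l xi M k1, 0 <= M /\ forall k, (k1 <= k)%N ->
  [/\ cn (ap tr (d_ k) - l * RtoC (e k)) <= M * (e k * h k),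
      cn (ap xr (d_ k) - xi) <= M * (e k * h k) &
      nm (u_ k) + nm (s_ k) <= M * (e k * h k)].
Proof.
apply: (@perturbed_recurrence_cvg R sig c hsig hc A' S' R' tr xr b2
   (tr_b2 c lam mu gam hsig) (xr_b2 c lam mu gam hsig)
   (fun k => u_ k) (fun k => d_ k) (fun k => s_ k) (fun=> 0) (fun=> 0) 0 0 0) => //.
- by move=> k _; exact: dS.
- by move=> k _; rewrite addr0 RtoCV sS.
- by move=> k _; rewrite subr0 uS.
- by move=> k _; rewrite nm0 mul0r.
- by move=> k _; rewrite nm0 mul0r.
Qed.

(** A crude bound, sufficient for the three generating functions to converge on $|z|<1$. *)
Lemma coefficients_growth : exists M, forall k,
  nm (u_ k) + nm (s_ k) + nm (d_ k) <= M * k.+1%:R.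
Proof.
have [l [xi [M [k1 [M0 H]]]]] := exact_recurrence_cvg.
pose M1 := M + (cn xi + M) * nm b1 + (cn l + M) * nm b2.
apply: (@eventually_bounded _ _ _ M1 k1).
- by rewrite /M1 !(addr_ge0, mulr_ge0, nm_ge0, cn_ge0).
- by move=> k; rewrite !(addr_ge0, nm_ge0).
- by move=> k; rewrite ler1n.
move=> k kk; have [h1 h2 h3] := H k kk.
have e0 := ewt_gt0 R hsig k; have e1 := ewt_le_lin R hsig k.
have k0 : 1 <= k.+1%:R :> R by rewrite ler1n.
have eh : e k * h k <= k.+1%:R.
  by apply: le_trans e1; rewrite ler_piMr ?(ltW e0)// invS_le1.
have Meh : M * (e k * h k) <= M * k.+1%:R by rewrite ler_wpM2l.
have hx : cn (ap xr (d_ k)) <= (cn xi + M) * k.+1%:R.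
  have := cnD xi (ap xr (d_ k) - xi); rewrite (addrC xi) subrK => /le_trans; apply.
  rewrite mulrDl; apply: lerD; last exact: le_trans h2 Meh.
  by rewrite ler_peMr// cn_ge0.
have ht : cn (ap tr (d_ k)) <= (cn l + M) * k.+1%:R.
  have := cnD (l * RtoC (e k)) (ap tr (d_ k) - l * RtoC (e k)).
  rewrite (addrC (l * _)) subrK => /le_trans; apply.
  rewrite mulrDl; apply: lerD; last exact: le_trans h1 Meh.
  by rewrite cnM cn_RtoC (ger0_norm (ltW e0)) ler_wpM2l ?cn_ge0.
rewrite /M1 2!mulrDl -[leRHS]addrA; apply: lerD; first exact: le_trans h3 Meh.
rewrite (dual_basis c lam mu gam hsig (d_ k)); apply: le_trans (nmD _ _) _; rewrite !nmZ.
by apply: lerD; rewrite mulrAC ler_wpM2r// nm_ge0.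
Qed.

Lemma d_asymptotics : exists l xi,
  weight_bound sig (fun k => nm (d_ k - xi *: b1 - l *: Dapp n k)) n.+1.
Proof.
have [l [xi0 [M [k1 [M0 H]]]]] := exact_recurrence_cvg.
have [Mr [kr [Mr0 Hr]]] := rapp_bound.
have [Mo [ko [Mo0 Ho]]] := rhoapp_bound.
have [Md [kd [Md0 Hd]]] := Dapp_leading.
pose k0 := maxn kr ko.
pose K := cn l * (Mr + Mo).
have K0 : 0 <= K by rewrite mulr_ge0 ?cn_ge0// addr_ge0.
have ehn0 k : 0 <= e k * h k ^+ n.+1 by rewrite mulr_ge0 ?exprn_ge0// ltW// ewt_gt0.
have [||||||xi [M' [k2 [M'0 H']]]] := @perturbed_recurrence_decay R sig c hsig hc A' S' R' tr xr b2
   (tr_b2 c lam mu gam hsig) (xr_b2 c lam mu gam hsig) (fun k => u_ k - l *: Uapp n k) (fun k => d_ k - l *: Dapp n k)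
   (fun k => s_ k - l *: Wapp n k) (fun k => (- l) *: rapp n k)
   (fun k => (- l) *: rhoapp n k) K n k0 K0.
- move=> k _; cbv beta; rewrite dS (DappS c lam mu gam rho hsig) scalerDr opprD addrACA//.
- move=> k _; apply: combine_s (WappS _ _ _ _ _ _ _ _) => //.
  by rewrite RtoCV; exact: sS.
- move=> k _; apply: combine_u; first exact: uS.
  by rewrite -B'E//; exact: UappS.
- move=> k; rewrite geq_max => /andP[kkr kko]; rewrite nmZ cnN /K -mulrA.
  rewrite ler_wpM2l ?cn_ge0//; apply: le_trans (Hr k kkr) _.
  by rewrite ler_wpM2r// lerDl.
- move=> k; rewrite geq_max => /andP[kkr kko]; rewrite nmZ cnN /K -mulrA.
  rewrite ler_wpM2l ?cn_ge0//; apply: le_trans (Ho k kko) _.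
  by rewrite ler_wpM2r// lerDr.
(* The relative amplitude of the difference tends to 0: both the [tr] component of [d_ k] and that
   of [l] times [Dapp n k] equal $l e_k$ up to $O(e_k/k)$. *)
- move=> x x0.
  pose K2 := M + cn l * (nm tr * Md).
  exists (maxn (maxn k1 kd) (Num.truncn (K2 / x))) => k.
  rewrite !geq_max => /andP[/andP[kk1 kkd] kx].
  have e0 := ewt_gt0 R hsig k.
  have hK : h k * K2 <= x.
    have : K2 / x < k.+1%:R by apply: lt_le_trans (truncnS_gt _) _; rewrite ler_nat ltnS.
    rewrite ltr_pdivrMr// => /ltW hh; rewrite mulrC ler_pdivrMr//.
    by rewrite (mulrC x).
  have [h1 _ _] := H k kk1; have h2 := Hd k kkd; rewrite expr1 in h2.
  have -> : ap tr (d_ k - l *: Dapp n k) = (ap tr (d_ k) - l * RtoC (e k))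
      - l * ap tr (Dapp n k - RtoC (e k) *: b2).
    by rewrite !row_mul_subZ tr_b2//; ring.
  apply: (@le_trans _ _ (e k * (h k * K2))); last by rewrite mulrC ler_wpM2r// ltW.
  rewrite /K2 !mulrDr; apply: le_trans (cnB _ _) _; apply: lerD.
    by apply: le_trans h1 _; rewrite (mulrC M) mulrA.
  rewrite cnM [leRHS](_ : _ = cn l * (nm tr * (Md * (e k * h k)))); last first.
    by move: (nm tr) (cn l) (h k) (e k) => *; ring.
  rewrite ler_wpM2l ?cn_ge0//; apply: le_trans (nm_row_mul _ _) _.
  by rewrite ler_wpM2l ?nm_ge0.
exists l, xi, (M' * (nm b1 + nm b2)), k2; split.
  by rewrite mulr_ge0// addr_ge0 ?nm_ge0.
move=> k kk; have [h1 h2] := H' k kk.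
have -> : d_ k - xi *: b1 - l *: Dapp n k =
  (ap xr (d_ k - l *: Dapp n k) - xi) *: b1 + ap tr (d_ k - l *: Dapp n k) *: b2.
  rewrite addrAC; move: (d_ k - l *: _) => v.
  by rewrite {1}(dual_basis c lam mu gam hsig v) scalerBl addrAC.
apply: le_trans (nmD _ _) _; rewrite !nmZ (mulrC M') -mulrA mulrDl.
by apply: lerD; rewrite mulrC ler_wpM2l ?nm_ge0.
Qed.

(** [xr] removes the leading part $e_k b_2$ of [Dapp]. Since $e_k/k$ tends to 0, the [xr] component
    converges to [xi] even when [d_] does not, and this is the input of the Abel summation. *)
Lemma xr_d_asymptotics l xi :
  weight_bound sig (fun k => nm (d_ k - xi *: b1 - l *: Dapp n k)) n.+1 ->
  weight_bound sig (fun k => cn (ap xr (d_ k) - xi)) 1.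
Proof.
move=> H.
apply: (@weight_bound_le _ _ _ (fun k => nm xr * nm (d_ k - xi *: b1 - l *: Dapp n k)
  + (nm xr * cn l) * nm (Dapp n k - RtoC (e k) *: b2))).
  move=> k.
  have -> : ap xr (d_ k) - xi = ap xr (d_ k - xi *: b1 - l *: Dapp n k)
      + l * ap xr (Dapp n k - RtoC (e k) *: b2).
    rewrite !row_mul_subZ xr_b1// xr_b2//.
    by move: (ap xr (d_ k)) (ap xr (Dapp n k)) (RtoC (e k)) => *; ring.
  apply: le_trans (cnD _ _) _; rewrite cnM -mulrA mulrCA.
  apply: lerD; first exact: nm_row_mul.
  by rewrite ler_wpM2l ?cn_ge0// nm_row_mul.
apply: weight_boundD.
  apply: weight_boundZ; first exact: nm_ge0.
  exact: (weight_bound_weak hsig _ H).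
apply: weight_boundZ; last exact: Dapp_leading.
by rewrite mulr_ge0 ?nm_ge0 ?cn_ge0.
Qed.

Lemma Theta_asymptotics l xi :
  weight_bound sig (fun k => nm (d_ k - xi *: b1 - l *: Dapp n k)) n.+1 ->
  exists M k1, forall k, (k1 <= k)%N -> den_ c lam mu gam rho sig n k != 0 /\
    cn (Theta_ c lam mu gam rho sig n k - xi) <= M * (e k * h k ^+ n.+1).
Proof.
move=> [M [k1 [M0 H]]].
have [Md [kd [Md0 Hd]]] := Dapp_leading.
(* The 4 inverts the lower bound 1/4 for the denominator: its limit has modulus 1/2, and past the
   threshold the deviation is at most 1/4. *)
exists (4 * (M * (nm (Jmx R) * (nm b2 + Md)))), (maxn (maxn k1 kd) (Num.truncn (4 * (nm b1^T * (nm (Jmx R) * Md))))).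
move=> k; rewrite !geq_max => /andP[/andP[kk1 kkd] kx].
have e0 := ewt_gt0 R hsig k; have h1 := H k kk1; have h2 := Hd k kkd.
have h0 := invS_gt0 R k.
set p := p_ c lam mu gam rho sig n k.
have hp : nm (p - b2) <= Md * h k.
  move: h2; rewrite DappE -/p -scalerBr nmZ cn_RtoC (ger0_norm (ltW e0)) expr1.
  by rewrite mulrCA ler_pM2l.
have denE : den_ c lam mu gam rho sig n k = (b1^T *m (Jmx R *m p)) 0 0.
  by rewrite /den_ -mulmxA.
have den_split : (b1^T *m (Jmx R *m p)) 0 0 = (b1^T *m (Jmx R *m b2)) 0 0
   + (b1^T *m (Jmx R *m (p - b2))) 0 0.
  exact: J_pair_split.
have small : cn ((b1^T *m (Jmx R *m (p - b2))) 0 0) <= 1 / 4.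
  apply: le_trans (nm_row_mul _ _) _.
  apply: (@le_trans _ _ (nm b1^T * (nm (Jmx R) * (Md * h k)))).
    rewrite ler_wpM2l ?nm_ge0//; apply: le_trans (nmM _ _) _.
    by rewrite ler_wpM2l ?nm_ge0.
  have : 4 * (nm b1^T * (nm (Jmx R) * Md)) < k.+1%:R.
    by apply: lt_le_trans (truncnS_gt _) _; rewrite ler_nat ltnS.
  rewrite !mulrA ler_pdivrMr//; move: (nm b1^T) (nm (Jmx R)) (k.+1%:R : R) => *; lra.
have big : 1 / 4 <= cn (den_ c lam mu gam rho sig n k).
  have B := b1_J_b2 c lam mu gam hsig.
  have : cn ((b1^T *m (Jmx R *m b2)) 0 0) <= cn (den_ c lam mu gam rho sig n k)
     + cn ((b1^T *m (Jmx R *m (p - b2))) 0 0).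
    rewrite denE den_split; move: (_ 0 0) (_ 0 0) => x y.
    by apply: le_trans (cnB _ _); rewrite addrK.
  rewrite B; move: (cn (den_ _ _ _ _ _ _ _ _)) small.
  by move: (cn ((b1^T *m (Jmx R *m (p - b2))) 0 0)) => x y *; lra.
have den0 : den_ c lam mu gam rho sig n k != 0.
  by rewrite -cn_eq0 gt_eqF//; apply: lt_le_trans big; lra.
split=> //.
have -> : Theta_ c lam mu gam rho sig n k - xi = (den_ c lam mu gam rho sig n k)^-1 *
  ((d_ k - xi *: b1 - l *: Dapp n k)^T *m (Jmx R *m p)) 0 0.
  rewrite DappE -/p J_pair_comb -denE /Theta_ /vartheta_ pair_scale -/p.
  by rewrite mulrBr mulrCA mulVf// mulr1.
rewrite cnM cnV -mulrA; apply: ler_pM; rewrite ?invr_ge0 ?cn_ge0//.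
  rewrite -(invrK 4) lef_pV2 ?posrE; first by move: big; rewrite mul1r.
    by apply: lt_le_trans big; lra.
  by rewrite invr_gt0.
apply: le_trans (nm_row_mul _ _) _.
have nmT m1 m2 (X : 'M[CC]_(m1, m2)) : nm X^T = nm X.
  by rewrite /nm exchange_big; apply: eq_bigr => i _; apply: eq_bigr => j _; rewrite mxE.
rewrite nmT [leRHS](_ : _ = (M * (e k * h k ^+ n.+1)) * (nm (Jmx R) * (nm b2 + Md))); last first.
  by move: (nm b2) (nm (Jmx R)) (e k * _) => *; ring.
apply: ler_pM; rewrite ?nm_ge0//.
apply: le_trans (nmM _ _) _; rewrite ler_wpM2l ?nm_ge0//.
rewrite -(subrK b2 p) addrC; apply: le_trans (nmD _ _) _; rewrite lerD2l.
by apply: le_trans hp _; rewrite ler_piMr// invS_le1.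
Qed.

End ThetaAsymptotics.

(** * Derivatives of complex functions of a real variable *)

Section RealPartsOfLimits.
Variable R : realType.
Local Notation CC := (C R).

Lemma cvg_Re (T : Type) (F : set_system T) (FF : Filter F) (f : T -> CC) (l : CC) :
  f @ F --> l -> (fun x => complex.Re (f x)) @ F --> complex.Re l.
Proof.
move=> /cvgrPdist_lt H; apply/cvgrPdist_lt => e e0.
have e0' : 0 < RtoC e by rewrite /RtoC ltcR.
have := H _ e0'; apply: filterS => x; rewrite cnE /RtoC ltcR; apply: le_lt_trans.
by rewrite -raddfB; exact: cn_Re.
Qed.

Lemma cvg_Im (T : Type) (F : set_system T) (FF : Filter F) (f : T -> CC) (l : CC) :
  f @ F --> l -> (fun x => complex.Im (f x)) @ F --> complex.Im l.
Proof.
move=> /cvgrPdist_lt H; apply/cvgrPdist_lt => e e0.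
have e0' : 0 < RtoC e by rewrite /RtoC ltcR.
have := H _ e0'; apply: filterS => x; rewrite cnE /RtoC ltcR; apply: le_lt_trans.
by rewrite -raddfB; exact: cn_Im.
Qed.

Lemma ReD (y z : CC) : complex.Re (y + z) = complex.Re y + complex.Re z.
Proof. exact: raddfD. Qed.
Lemma ImD (y z : CC) : complex.Im (y + z) = complex.Im y + complex.Im z.
Proof. exact: raddfD. Qed.
Lemma Re_RtoC_mul (a : R) (z : CC) : complex.Re (RtoC a * z) = a * complex.Re z.
Proof. by case: z => x y; rewrite /RtoC /=; ring. Qed.
Lemma Im_RtoC_mul (a : R) (z : CC) : complex.Im (RtoC a * z) = a * complex.Im z.
Proof. by case: z => x y; rewrite /RtoC /=; ring. Qed.

(** Real and imaginary parts are differentiated separately, so that real calculus applies to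
    each. *)
Definition is_derivC (f : R -> CC) (x : R) (l : CC) :=
  is_derive x (1 : R) (fun t => complex.Re (f t)) (complex.Re l) /\
  is_derive x (1 : R) (fun t => complex.Im (f t)) (complex.Im l).

Lemma is_derive_quotient (g : R -> R) (x l : R) :
  (fun h : R => (g (x + h) - g x) / h) @ (0 : R)^' --> l -> is_derive x (1 : R) g l.
Proof.
move=> H.
have H' : (fun h : R => h^-1 *: (g (h *: (1 : R) + x) - g x)) @ (0 : R)^' --> l.
  rewrite (_ : (fun h : R => _) = (fun h : R => (g (x + h) - g x) / h))//.
  by apply/funext => h; rewrite /GRing.scale /= mulr1 (addrC h) mulrC.
apply: DeriveDef; first exact: cvgP H'.
exact: cvg_lim H'.
Qed.

Lemma has_derivC_is_derivC f x l : has_derivC f x l -> is_derivC f x l.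
Proof.
move=> H; split; apply: is_derive_quotient.
  rewrite (_ : (fun h : R => _) = (fun h => complex.Re ((f (x + h) - f x) / RtoC h))).
    exact: cvg_Re.
  apply/funext => h.
  by rewrite [in RHS]mulrC -RtoCV Re_RtoC_mul raddfB mulrC.
rewrite (_ : (fun h : R => _) = (fun h => complex.Im ((f (x + h) - f x) / RtoC h))).
    exact: cvg_Im.
  apply/funext => h.
by rewrite [in RHS]mulrC -RtoCV Im_RtoC_mul raddfB mulrC.
Qed.

Lemma is_derivCB f g x l m : is_derivC f x l -> is_derivC g x m ->
  is_derivC (fun t => f t - g t) x (l - m).
Proof.
move=> [f1 f2] [g1 g2]; split.
  rewrite raddfB (_ : (fun t => _) = (fun t => complex.Re (f t)) - (fun t => complex.Re (g t))).
    exact: is_deriveB.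
  by apply/funext => t; rewrite raddfB.
rewrite raddfB (_ : (fun t => _) = (fun t => complex.Im (f t)) - (fun t => complex.Im (g t))).
  exact: is_deriveB.
by apply/funext => t; rewrite raddfB.
Qed.

Lemma is_derivCZ (g : R -> R) f x m l : is_derive x (1 : R) g m -> is_derivC f x l ->
  is_derivC (fun t => RtoC (g t) * f t) x (RtoC (g x) * l + RtoC m * f x).
Proof.
move=> Hg [f1 f2]; split.
  rewrite (_ : (fun t => _) = g * (fun t => complex.Re (f t))).
    rewrite ReD !Re_RtoC_mul (mulrC m); exact: is_deriveM.
  by apply/funext => t; rewrite Re_RtoC_mul.
rewrite (_ : (fun t => _) = g * (fun t => complex.Im (f t))).
  rewrite ImD !Im_RtoC_mul (mulrC m); exact: is_deriveM.
by apply/funext => t; rewrite Im_RtoC_mul.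
Qed.

End RealPartsOfLimits.

(** * Complex power series at real points *)

Section PowerSeries.
Variable R : realType.
Local Notation CC := (C R).
Implicit Types (a b : nat -> CC) (x r : R) (l m : CC).

Definition is_ps a x l :=
  pseries (fun k => complex.Re (a k)) x @ \oo --> complex.Re l /\
  pseries (fun k => complex.Im (a k)) x @ \oo --> complex.Im l.

(** Abel's criterion: bounded $a_k r^k$ gives absolute convergence for $|x|<r$. *)
Definition tame a r := exists M, forall k, cn (a k) * r ^+ k <= M.

Lemma is_ps_unique a x l m : is_ps a x l -> is_ps a x m -> l = m.
Proof.
move=> [l1 l2] [m1 m2]; apply/eqP; rewrite eq_complex.
by apply/andP; split; apply/eqP; [exact: cvg_unique l1 m1|exact: cvg_unique l2 m2].
Qed.

Lemma is_psD a b x l m : is_ps a x l -> is_ps b x m -> is_ps (fun k => a k + b k) x (l + m).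
Proof.
have E (f g : nat -> R) : pseries (fun k => f k + g k) x = pseries f x + pseries g x.
  apply/funext => n; rewrite /pseries /series /= fctE -big_split/=.
  by apply: eq_bigr => i _; rewrite mulrDl.
move=> [l1 l2] [m1 m2]; split; rewrite ?ReD ?ImD.
  under [X in pseries X]funext do rewrite ?ReD ?ImD.
  by rewrite E; exact: cvgD.
under [X in pseries X]funext do rewrite ?ReD ?ImD.
by rewrite E; exact: cvgD.
Qed.

Lemma is_psZ a x l (w : CC) : is_ps a x l -> is_ps (fun k => w * a k) x (w * l).
Proof.
have E (f g : nat -> R) s t : pseries (fun k => s * f k + t * g k) x =
  (fun n => s * pseries f x n + t * pseries g x n).
  apply/funext => n; rewrite /pseries /series /= !mulr_sumr -big_split/=.
  by apply: eq_bigr => i _; rewrite mulrDl !mulrA.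
have rw z : complex.Re (w * z) = complex.Re w * complex.Re z + - complex.Im w * complex.Im z.
  by case: (w) => ? ?; case: z => ? ? /=; ring.
have iw z : complex.Im (w * z) = complex.Re w * complex.Im z + complex.Im w * complex.Re z.
  by case: (w) => ? ?; case: z => ? ? /=; ring.
move=> [l1 l2]; split.
  under [X in pseries X]funext do rewrite rw.
  by rewrite rw E; apply: cvgD; apply: cvgMr.
under [X in pseries X]funext do rewrite iw.
by rewrite iw E; apply: cvgD; apply: cvgMr.
Qed.

Lemma pseries_shift_cvg (f : nat -> R) x (s : R) :
  pseries (fun k => f k.+1) x @ \oo --> s -> pseries f x @ \oo --> f 0%N + x * s.
Proof.
move=> H; have E : (fun n => f 0%N + x * pseries (fun k => f k.+1) x n) @ \oo
    --> f 0%N + x * s.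
  by apply: cvgD; [exact: cvg_cst|exact: cvgMr].
suff e : [sequence pseries f x n.+1]_n = (fun n => f 0%N + x * pseries (fun k => f k.+1) x n).
  by move: E; rewrite -e cvg_shiftS.
apply/funext => n; rewrite /pseries /series /= big_nat_recl// expr0 mulr1 mulr_sumr.
by congr (_ + _); apply: eq_bigr => i _; rewrite exprS mulrCA.
Qed.

Lemma is_ps_shift a x l : is_ps (fun k => a k.+1) x l -> is_ps a x (a 0%N + RtoC x * l).
Proof.
move=> [l1 l2]; split; rewrite ?ReD ?ImD ?Re_RtoC_mul ?Im_RtoC_mul.
  exact: (@pseries_shift_cvg (fun k => complex.Re (a k))).
exact: (@pseries_shift_cvg (fun k => complex.Im (a k))).
Qed.

Lemma is_ps_bound a x l B : is_ps a x l ->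
  (forall n, \sum_(0 <= k < n) cn (a k) * `|x| ^+ k <= B) -> cn l <= 2 * B.
Proof.
have E (f : nat -> R) (s : R) : pseries f x @ \oo --> s -> (forall k, `|f k| <= cn (a k)) ->
   (forall n, \sum_(0 <= k < n) cn (a k) * `|x| ^+ k <= B) -> `|s| <= B.
  move=> fs fa H; rewrite -(cvg_lim (@Rhausdorff R) (cvg_norm fs)).
  apply: limr_le; first by apply/cvg_ex; exists `|s|; exact: cvg_norm.
  apply: nearW => n /=; apply: le_trans (H n); apply: le_trans (ler_norm_sum _ _ _) _.
  by apply: ler_sum => k _; rewrite normrM normrX ler_wpM2r ?exprn_ge0.
move=> [l1 l2] H; apply: le_trans (cn_le _) _.
have h1 := E _ _ l1 (fun k => cn_Re (a k)) H.
have h2 := E _ _ l2 (fun k => cn_Im (a k)) H.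
by rewrite mulr_natl mulr2n lerD.
Qed.

End PowerSeries.

Section TamePowerSeries.
Variable R : realType.
Local Notation CC := (C R).
Implicit Types (a b : nat -> CC) (x r : R) (l m : CC).

Lemma geometric_partial_le (t : R) n : 0 <= t < 1 -> \sum_(0 <= k < n) t ^+ k <= (1 - t)^-1.
Proof.
move=> /andP[t0 t1]; have s0 : 0 < 1 - t by lra.
rewrite -[leRHS]mul1r ler_pdivlMr//.
suff -> : (\sum_(0 <= k < n) t ^+ k) * (1 - t) = 1 - t ^+ n.
  by rewrite lerBlDr lerDl exprn_ge0.
elim: n => [|n IH]; first by rewrite big_nil mul0r expr0 subrr.
by rewrite big_nat_recr//= mulrDl IH exprS; ring.
Qed.

(** $t^k$ is the least of the $k+1$ terms $1,\dots,t^k$, whose sum is at most $1/(1-t)$. *)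
Lemma linear_geometric_le (t : R) k : 0 <= t < 1 -> k.+1%:R * t ^+ k <= (1 - t)^-1.
Proof.
move=> ht; have /andP[t0 t1] := ht; apply: le_trans (geometric_partial_le k.+1 ht).
rewrite mulr_natl -[X in _ *+ X](card_ord k.+1) -sumr_const big_mkord.
apply: ler_sum => i _; apply: ler_wiXn2l => //; first exact: ltW.
by rewrite -ltnS.
Qed.

Lemma tame_abs_sum a r x : 0 < r -> tame a r -> `|x| < r ->
  exists B, forall n, \sum_(0 <= k < n) cn (a k) * `|x| ^+ k <= B.
Proof.
move=> r0 [M HM] xr; exists (M * (1 - `|x| / r)^-1) => n.
have ht : 0 <= `|x| / r < 1.
  by apply/andP; split; [exact: divr_ge0 (ltW r0)|rewrite ltr_pdivrMr// mul1r].
have M0 : 0 <= M by apply: le_trans (HM 0%N); rewrite mulr_ge0 ?cn_ge0.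
apply: le_trans (ler_wpM2l M0 (geometric_partial_le n ht)).
rewrite mulr_sumr; apply: ler_sum => k _.
have -> : cn (a k) * `|x| ^+ k = cn (a k) * r ^+ k * (`|x| / r) ^+ k.
  rewrite -mulrA -exprMn mulrCA divff ?mulr1//; exact: lt0r_neq0.
by rewrite ler_wpM2r// exprn_ge0//; case/andP: ht.
Qed.

Lemma pseries_is_cvg (f : nat -> R) x B :
  (forall n, \sum_(0 <= k < n) `|f k| * `|x| ^+ k <= B) -> cvgn (pseries f x).
Proof.
move=> H; apply: normed_cvg; apply: nondecreasing_is_cvgn.
  by apply: nondecreasing_series => n _ _; exact: normr_ge0.
exists B => _ [n _ <-]; apply: le_trans (H n); apply: ler_sum => k _.
by rewrite /= normrM normrX.
Qed.

Definition psum a x : CC := Complex (limn (pseries (fun k => complex.Re (a k)) x))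
  (limn (pseries (fun k => complex.Im (a k)) x)).

Lemma tame_cvg a r x : 0 < r -> tame a r -> `|x| < r ->
  cvgn (pseries (fun k => complex.Re (a k)) x) /\ cvgn (pseries (fun k => complex.Im (a k)) x).
Proof.
move=> r0 ta xr; have [B HB] := tame_abs_sum r0 ta xr.
split; apply: (@pseries_is_cvg _ _ B) => n; apply: le_trans (HB n);
  apply: ler_sum => k _; rewrite ler_wpM2r ?exprn_ge0//; [exact: cn_Re|exact: cn_Im].
Qed.

Lemma is_ps_psum a r x : 0 < r -> tame a r -> `|x| < r -> is_ps a x (psum a x).
Proof. by move=> r0 ta xr; have [h1 h2] := tame_cvg r0 ta xr; split. Qed.

Definition diffs a k : CC := RtoC k.+1%:R * a k.+1.

Lemma tame_diffs a r s : 0 < s < r -> tame a r -> tame (diffs a) s.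
Proof.
move=> /andP[s0 sr] [M HM].
have r0 : 0 < r by apply: lt_trans sr.
have ht : 0 <= s / r < 1.
  apply/andP; split; first exact: divr_ge0 (ltW s0) (ltW r0).
  by rewrite ltr_pdivrMr// mul1r.
have M0 : 0 <= M by apply: le_trans (HM 0%N); rewrite mulr_ge0 ?cn_ge0 ?exprn_ge0 ?ltW.
exists (M / r * (1 - s / r)^-1) => k.
rewrite /diffs cnM cn_RtoC ger0_norm//.
have -> : k.+1%:R * cn (a k.+1) * s ^+ k = (cn (a k.+1) * r ^+ k.+1 / r) * (k.+1%:R * (s / r) ^+ k).
  have rk : r ^+ k != 0 by rewrite expf_neq0// lt0r_neq0.
  rewrite exprS expr_div_n; field; rewrite rk; exact: lt0r_neq0.
have ri : 0 <= r^-1 by rewrite invr_ge0 ltW.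
apply: ler_pM.
- by apply: mulr_ge0 => //; rewrite mulr_ge0 ?cn_ge0// exprn_ge0// ltW.
- by apply: mulr_ge0 => //; rewrite exprn_ge0//; case/andP: ht.
- by apply: ler_wpM2r.
- exact: linear_geometric_le.
Qed.

Lemma psum_derive a r x : tame a r -> `|x| < r ->
  is_derivC (psum a) x (psum (diffs a) x).
Proof.
move=> ta xr.
have r0 : 0 < r by apply: le_lt_trans xr.
have x0 : 0 <= `|x| by [].
(* Differentiating the series at [x] uses convergence of it and of its first two formal derivatives
   at some point beyond $|x|$. Each formal derivative costs a little radius, hence $|x| < K < r_2 <
   r_1 < r$. *)
pose r1 := `|x| + (r - `|x|) * (3 / 4).
pose r2 := `|x| + (r - `|x|) / 2.
pose K := `|x| + (r - `|x|) / 4.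
have K0 : 0 < K by rewrite /K; lra.
have nK : `|K| = K by rewrite ger0_norm// ltW.
have t1 : tame (diffs a) r1 by apply: tame_diffs ta; apply/andP; split; rewrite /r1; lra.
have t2 : tame (diffs (diffs a)) r2.
  by apply: tame_diffs t1; apply/andP; split; rewrite /r1 /r2; lra.
have c0 := tame_cvg r0 ta (_ : `|K| < r).
have c1 := tame_cvg (_ : 0 < r1) t1 (_ : `|K| < r1).
have c2 := tame_cvg (_ : 0 < r2) t2 (_ : `|K| < r2).
have [c0r c0i] : cvgn (pseries (fun k => complex.Re (a k)) K) /\
   cvgn (pseries (fun k => complex.Im (a k)) K) by apply: c0; rewrite nK /K; lra.
have [c1r c1i] : cvgn (pseries (fun k => complex.Re (diffs a k)) K) /\
   cvgn (pseries (fun k => complex.Im (diffs a k)) K).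
  by apply: c1; rewrite ?nK /K /r1; lra.
have [c2r c2i] : cvgn (pseries (fun k => complex.Re (diffs (diffs a) k)) K) /\
   cvgn (pseries (fun k => complex.Im (diffs (diffs a) k)) K).
  by apply: c2; rewrite ?nK /K /r2; lra.
have dr b : (fun k => complex.Re (diffs b k)) = pseries_diffs (fun k => complex.Re (b k)).
  by apply/funext => k; rewrite /diffs Re_RtoC_mul.
have di b : (fun k => complex.Im (diffs b k)) = pseries_diffs (fun k => complex.Im (b k)).
  by apply/funext => k; rewrite /diffs Im_RtoC_mul.
rewrite !dr in c1r c2r; rewrite !di in c1i c2i.
split; rewrite /psum /=.
  by rewrite dr; apply: (@pseries_snd_diffs _ _ K) => //; rewrite nK /K; lra.
by rewrite di; apply: (@pseries_snd_diffs _ _ K) => //; rewrite nK /K; lra.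
Qed.

Lemma linear_growth_tame a (M : R) r : 0 <= r < 1 -> (forall k, cn (a k) <= M * k.+1%:R) ->
  tame a r.
Proof.
move=> hr H; have /andP[r0 r1] := hr.
have M0 : 0 <= M by have := H 0%N; rewrite mulr1; apply: le_trans; exact: cn_ge0.
exists (M * (1 - r)^-1) => k.
apply: le_trans (ler_wpM2r _ (H k)) _; first exact: exprn_ge0.
by rewrite -mulrA ler_wpM2l// linear_geometric_le.
Qed.

Lemma series_to_is_ps a x l : series_to a x l -> is_ps a x l.
Proof.
move=> H; split.
  rewrite (_ : pseries _ _ = (fun N => complex.Re (\sum_(k < N) a k * RtoC x ^+ k))).
    exact: cvg_Re.
  apply/funext => N; rewrite /pseries /series /= (big_morph _ (@ReD R) (erefl _)) big_mkord; apply: eq_bigr => k _.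
  by rewrite -RtoCX [in RHS]mulrC Re_RtoC_mul mulrC.
rewrite (_ : pseries _ _ = (fun N => complex.Im (\sum_(k < N) a k * RtoC x ^+ k))).
  exact: cvg_Im.
apply/funext => N; rewrite /pseries /series /= (big_morph _ (@ImD R) (erefl _)) big_mkord; apply: eq_bigr => k _.
by rewrite -RtoCX [in RHS]mulrC Im_RtoC_mul mulrC.
Qed.

Lemma is_ps_tame a r l : 0 < r -> is_ps a r l -> tame a r.
Proof.
have E (f : nat -> R) (s : R) : 0 < r -> pseries f r @ \oo --> s ->
    exists M, forall k, `|f k| * r ^+ k <= M.
  move=> r0 H; have : cvgn (fun k => f k * r ^+ k).
    apply/cvg_ex; exists 0; apply: cvg_series_cvg_0; apply/cvg_ex; exists s; exact: H.
  move=> /cvg_seq_bounded [M [_ HM]]; exists (M + 1) => k.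
  have := HM (M + 1) _ k I; rewrite /= normrM normrX (gtr0_norm r0); apply.
  by rewrite ltrDl.
move=> r0 [h1 h2]; have [M1 H1] := E _ _ r0 h1; have [M2 H2] := E _ _ r0 h2.
exists (M1 + M2) => k; apply: le_trans (ler_wpM2r _ (cn_le _)) _.
  by rewrite exprn_ge0 ?ltW.
by rewrite mulrDl lerD.
Qed.

(** The difference is $x$ times the shifted series, which is bounded by its absolute sum at
    $r/2$. *)
Lemma is_ps_lipschitz a r : 0 < r -> tame a r -> exists L, 0 <= L /\
  forall x l, `|x| <= r / 2 -> is_ps a x l -> cn (l - a 0%N) <= L * `|x|.
Proof.
move=> r0 ta; have [M HM] := ta.
have ts : tame (fun k => a k.+1) r.
  exists (M / r) => k; rewrite ler_pdivlMr// -mulrA -exprSr; exact: HM.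
have r20 : 0 <= r / 2 by rewrite divr_ge0 ?ltW.
have [|B HB] := tame_abs_sum r0 ts (_ : `|r / 2| < r).
  by rewrite ger0_norm//; lra.
rewrite (ger0_norm r20) in HB.
exists (2 * B); split; first by rewrite mulr_ge0//; have := HB 0%N; rewrite big_nil.
move=> x l xr al.
have xr' : `|x| < r by lra.
have ps := is_ps_psum r0 ts xr'.
rewrite (is_ps_unique al (is_ps_shift ps)) addrC addKr cnM cn_RtoC mulrC ler_wpM2r//.
apply: is_ps_bound ps _ => n; apply: le_trans (HB n); apply: ler_sum => k _.
by rewrite ler_wpM2l ?cn_ge0// lerXn2r.
Qed.

(** A quantitative Abel theorem: subtracting [l0] times the geometric series gives
    $(1-x)f(x)-l_0=(1-x)\sum_k(a_k-l_0)x^k$. The terms before [N] contribute to [K], the tail at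
    most $e$; the factor 2 adds real and imaginary parts. *)
Lemma abel_mean a l0 (f : R -> CC) :
  (forall e : R, 0 < e -> exists N, forall k, (N <= k)%N -> cn (a k - l0) <= e) ->
  (forall x, 0 < x < 1 -> is_ps a x (f x)) ->
  forall e : R, 0 < e -> exists K, forall x, 0 < x < 1 ->
    cn (RtoC (1 - x) * f x - l0) <= 2 * e + K * (1 - x).
Proof.
move=> Ha Hf e e0; have [N HN] := Ha e e0.
pose K := \sum_(0 <= k < N) cn (a k - l0).
exists (2 * K) => x /andP[x0 x1]; have ax := Hf x.
have x1' : `|x| < 1 by rewrite gtr0_norm.
have onep : is_ps (fun=> - l0) x (- l0 * RtoC (1 - x)^-1).
  rewrite (_ : (fun _ : nat => - l0) = (fun k => - l0 * (fun=> 1 : CC) k)); last first.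
    by apply/funext => k; rewrite mulr1.
  apply: is_psZ; have t1 : tame (fun _ : nat => 1 : CC) 1.
    by exists 1 => k; rewrite expr1n mulr1 cn1.
  have := is_ps_psum (ltr01 : 0 < 1 :> R) t1 x1'; set s := psum _ _ => sp.
  have := is_ps_unique sp (is_ps_shift sp) => hs.
  suff -> : RtoC (1 - x)^-1 = s by [].
  have n0 : RtoC (1 - x) != 0 by rewrite RtoC_eq0; lra.
  rewrite RtoCV; apply: (mulfI n0); rewrite divff// RtoCB mulrBl [1 * s]mul1r {1}hs.
  by rewrite addrK.
have {}ax : is_ps (fun k => a k - l0) x (f x - l0 * RtoC (1 - x)^-1).
  by rewrite -mulNr; apply: is_psD onep; apply: ax; rewrite x0.
have n0 : 1 - x != 0 by lra.
have -> : RtoC (1 - x) * f x - l0 = RtoC (1 - x) * (f x - l0 * RtoC (1 - x)^-1).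
  by rewrite mulrBr mulrCA -RtoCM divff// RtoC1 mulr1.
rewrite cnM cn_RtoC gtr0_norm; last by lra.
have B : cn (f x - l0 * RtoC (1 - x)^-1) <= 2 * (K + e * (1 - x)^-1).
  apply: is_ps_bound ax _ => n.
  rewrite gtr0_norm//.
  apply: (@le_trans _ _ (\sum_(0 <= k < n) ((if (k < N)%N then cn (a k - l0) else 0) + e * x ^+ k))).
    apply: ler_sum => k _; case: ltnP => kN.
      rewrite -[leLHS]addr0; apply: lerD; last by rewrite mulr_ge0 ?exprn_ge0 ?ltW.
      by rewrite ler_piMr ?cn_ge0// exprn_ile1// ltW.
    by rewrite add0r; apply: ler_wpM2r; [exact: exprn_ge0 (ltW x0)|exact: HN].
  rewrite big_split/=; apply: lerD; last first.
    rewrite -mulr_sumr; apply: ler_wpM2l; first exact: ltW.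
    by apply: geometric_partial_le; rewrite (ltW x0).
  rewrite -big_mkcond/= /K.
  have [nN|/ltnW Nn] := leqP n N.
    rewrite (@big_cat_nat _ _ _ n 0 N)//=.
    rewrite -[leLHS]addr0; apply: lerD; last by apply: sumr_ge0 => k _; exact: cn_ge0.
    by rewrite big_mkcond/=; apply: ler_sum => k _; case: ifP => // _; exact: cn_ge0.
  rewrite (big_nat_widen 0 N n xpredT _ Nn) le_eqVlt; apply/orP; left; apply/eqP.
  by apply: eq_bigl => k.
apply: le_trans (ler_wpM2l _ B) _; first by lra.
rewrite (_ : (1 - x) * _ = 2 * K * (1 - x) + 2 * e); last by field.
by rewrite addrC.
Qed.

End TamePowerSeries.

(** * Uniqueness at the singular point 0 by an energy estimate *)

Section SingularGronwall.
Variable R : realType.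
Implicit Types (E : R -> R) (x z b : R).

(* [E^2 exp(-2 K z) / z] is nonincreasing and tends to 0 at 0. *)
Lemma singular_gronwall E E' (K M e0 b : R) : 0 <= K -> 0 < e0 -> 0 < b ->
  (forall z, 0 < z <= b -> is_derive z (1 : R) E (E' z)) ->
  (forall z, 0 < z <= b -> 0 <= E z) ->
  (forall z, 0 < z <= b -> E' z <= (1 / (2 * z) + K) * E z) ->
  (forall z, 0 < z < e0 -> E z <= M * z) -> E b = 0.
Proof.
move=> K0 e00 b0 dE E0 E'le EM.
pose phi z : R := - (2 * K) * z - ln z.
pose G z : R := E z ^+ 2 * expR (phi z).
have dphi z : 0 < z -> is_derive z (1 : R) phi (- (2 * K) - z^-1).
  move=> z0; rewrite /phi.
  have h1 : is_derive z (1 : R) (fun t : R => - (2 * K) *: t) (- (2 * K) *: 1).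
    exact: is_deriveZ.
  have h2 := is_derive1_ln z0.
  have := is_deriveB h1 h2; rewrite /GRing.scale /= mulr1; exact.
have dG z : 0 < z <= b -> is_derive z (1 : R) G
    (expR (phi z) * E z * (2 * E' z - (2 * K + z^-1) * E z)).
  move=> zb; have /andP[z0 _] := zb.
  have h1 := dE z zb.
  have h2 : is_derive z (1 : R) (expR \o phi) (expR (phi z) * (- (2 * K) - z^-1)).
    exact: (@is_derive1_comp _ expR phi z _ _ (is_derive_expR (phi z)) (dphi z z0)).
  have h3 := is_deriveM (is_deriveX 2 h1) h2.
  rewrite (_ : G = E ^+ 2 * (expR \o phi)); last by [].
  apply: (is_derive_eq h3); rewrite /GRing.scale /= !fctE /=.
  by rewrite expr1; ring.
have Gnincr s : 0 < s < b -> G b <= G s.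
  move=> /andP[s0 sb].
  have dG' z : s <= z <= b -> is_derive z (1 : R) G
     (expR (phi z) * E z * (2 * E' z - (2 * K + z^-1) * E z)).
    by move=> /andP[sz zb]; apply: dG; rewrite zb (lt_le_trans s0 sz).
  have := @ler0_derive1_le_cc R G s b; apply.
  - by move=> z; rewrite in_itv/= => /andP[sz zb]; have [] := dG' z _; rewrite ?ltW.
  - move=> z; rewrite in_itv/= => /andP[sz zb].
    have zz : 0 < z <= b by rewrite (ltW zb) (lt_trans s0 sz).
    have /andP[z0 _] := zz.
    rewrite derive1E (@derive_val _ _ _ _ _ _ _ (dG z zz)).
    apply: mulr_ge0_le0; first by rewrite mulr_ge0 ?expR_ge0 ?E0.
    have := E'le z zz; have -> : 1 / (2 * z) = z^-1 / 2 by field; exact: lt0r_neq0.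
    move: (z^-1) (E z) (E' z) => i F F' h; lra.
  - apply: derivable_within_continuous => z; rewrite in_itv/= => sz.
    by have [] := dG' z sz.
  - by rewrite in_itv/= lexx ltW.
  - by rewrite in_itv/= lexx ltW.
  - exact: ltW.
have Gb0 : G b <= 0.
  apply/ler_addgt0Pr => e e_gt0; rewrite add0r.
  pose s := Num.min (b / 2) (Num.min (e0 / 2) (e / (M ^+ 2 + 1))).
  have M10 : 0 < M ^+ 2 + 1 by have := sqr_ge0 M; lra.
  have s0 : 0 < s by rewrite !lt_min !divr_gt0.
  have sb : s < b by rewrite gt_min; apply/orP; left; lra.
  have se0 : s < e0 by rewrite !gt_min; apply/orP; right; apply/orP; left; lra.
  have se : s <= e / (M ^+ 2 + 1) by rewrite !ge_min lexx !orbT.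
  apply: le_trans (Gnincr s _) _; first by rewrite s0.
  rewrite ler_pdivlMr// in se; apply: le_trans se.
  rewrite /G /phi expRD expRN lnK ?posrE//.
  have Es0 : 0 <= E s by apply: E0; rewrite s0 ltW.
  have EMs : E s <= M * s by apply: EM; rewrite s0.
  have x1 : expR (- (2 * K) * s) <= 1.
    rewrite -expR0 ler_expR mulNr oppr_le0; apply: mulr_ge0; last exact: ltW.
    exact: mulr_ge0.
  have E2 : E s ^+ 2 <= (M * s) ^+ 2 by rewrite lerXn2r ?nnegrE// (le_trans Es0).
  apply: (@le_trans _ _ ((M * s) ^+ 2 * (1 * s^-1))).
    have si0 : 0 < s^-1 by rewrite invr_gt0.
    apply: ler_pM => //; first exact: sqr_ge0.
      by apply: mulr_ge0; [exact: expR_ge0|exact: ltW].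
    by rewrite ler_pM2r.
  rewrite (_ : (M * s) ^+ 2 * (1 * s^-1) = s * M ^+ 2); last by field; exact: lt0r_neq0.
  by rewrite ler_pM2l// lerDl.
have : E b ^+ 2 <= 0 by move: Gb0; rewrite /G pmulr_lle0 ?expR_gt0.
by move=> h; apply/eqP; rewrite -sqrf_eq0 eq_le h sqr_ge0.
Qed.

End SingularGronwall.

Section EnergyEstimate.
Variable R : realType.
Local Notation CC := (C R).

Definition dot (y z : CC) : R := complex.Re y * complex.Re z + complex.Im y * complex.Im z.

Lemma dotD x y z : dot x (y + z) = dot x y + dot x z.
Proof. by rewrite /dot ReD ImD; ring. Qed.
Lemma dotZ (a : R) x y : dot x (RtoC a * y) = a * dot x y.
Proof. by rewrite /dot Re_RtoC_mul Im_RtoC_mul; ring. Qed.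
Lemma dot_sqr z : dot z z = cn z ^+ 2.
Proof.
rewrite /cn normc_def /= sqr_sqrtr; last by rewrite addr_ge0 ?sqr_ge0.
by rewrite /dot !expr2.
Qed.

Lemma dot_le y z : dot y z <= cn y * cn z.
Proof.
apply: le_trans (ler_norm _) _.
rewrite -ler_sqr ?nnegrE ?mulr_ge0 ?cn_ge0// real_normK ?num_real// exprMn -!dot_sqr.
rewrite /dot; move: (complex.Re y) (complex.Im y) (complex.Re z) (complex.Im z) => a b d e.
by rewrite -subr_ge0 (_ : _ - _ = (a * e - b * d) ^+ 2) ?sqr_ge0//; ring.
Qed.

Lemma cn_sqr_derive (f : R -> CC) x l : is_derivC f x l ->
  is_derive x (1 : R) (fun t => cn (f t) ^+ 2) (2 * dot (f x) l).
Proof.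
move=> [h1 h2].
have h3 := is_deriveD (is_deriveX 2 h1) (is_deriveX 2 h2).
rewrite (_ : (fun t => cn (f t) ^+ 2) = (fun t => complex.Re (f t)) ^+ 2 + (fun t => complex.Im (f t)) ^+ 2); last first.
  by apply/funext => t; rewrite -dot_sqr /dot -!expr2.
apply: (is_derive_eq h3); rewrite /GRing.scale /= /dot !expr1.
by ring.
Qed.

End EnergyEstimate.

(** Here [i] stands for $1/z$. The weight $2a^2+1$ on $Y^2$ makes the singular cross term $2aiXY$
    part of a completed square, so the singular growth rate stays at $i/2$, as [singular_gronwall]
    requires. *)
Lemma energy_inequality (R : realType) (i p q a X Y : R) :
  0 <= i -> 0 <= p -> 0 <= q -> 0 <= a ->
  2 * ((- (i / 2) + p) * X ^+ 2) + 2 * ((a * i + q) * (X * Y))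
    + 2 * ((2 * a ^+ 2 + 1) * (X * Y)) <=
  (i / 2 + (2 * p + q + (2 * a ^+ 2 + 1))) * (X ^+ 2 + (2 * a ^+ 2 + 1) * Y ^+ 2).
Proof.
move=> i0 p0 q0 a0; rewrite -subr_ge0.
have -> : (i / 2 + (2 * p + q + (2 * a ^+ 2 + 1))) * (X ^+ 2 + (2 * a ^+ 2 + 1) * Y ^+ 2) -
  (2 * ((- (i / 2) + p) * X ^+ 2) + 2 * ((a * i + q) * (X * Y))
    + 2 * ((2 * a ^+ 2 + 1) * (X * Y))) =
  i * ((X - a * Y) ^+ 2 + X ^+ 2 / 2 + Y ^+ 2 / 2)
  + 2 * p * (2 * a ^+ 2 + 1) * Y ^+ 2 +
  (q + (2 * a ^+ 2 + 1)) * ((X - Y) ^+ 2 + 2 * a ^+ 2 * Y ^+ 2) by field.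
by repeat (first [done | exact: sqr_ge0 | apply: addr_ge0 | apply: mulr_ge0]).
Qed.

Section Uniqueness.
Variables (R : realType) (c : R) (lam mu gam : C R).
Hypothesis hc : 1 < c.
Local Notation CC := (C R).
Local Notation M z := (coefM c lam mu gam z).
Local Notation b12 := (b12 c lam mu gam).
Local Notation r12 := (r12 c lam mu gam).

Definition m11 (z : R) : R := - (1 / 2) * (z^-1 + (z - 1)^-1 + (z - c)^-1).
Definition m12 (z : R) : CC := RtoC z^-1 * lam + RtoC (z - 1)^-1 * b12 + RtoC (z - c)^-1 * r12.

Lemma coefM_mul0 z (v : 'cV[CC]_2) : (M z *m v) 0 0 = RtoC (m11 z) * v 0 0 + m12 z * v 1 0.
Proof.
rewrite /coefM /Amx /Bmx /Rmx /Smx mxE sum_ord2 !mxE /=.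
rewrite /m11 /m12 RtoCM RtoCN RtoC_half !RtoCD !RtoCV !RtoCD /a12.
by ring.
Qed.

Lemma coefM_mul1 z (v : 'cV[CC]_2) : (M z *m v) 1 0 = RtoC (- c^-1) * v 0 0.
Proof.
rewrite /coefM /Amx /Bmx /Rmx /Smx mxE sum_ord2 !mxE /=.
by rewrite RtoCN RtoCV; ring.
Qed.

(** The energy grows at rate at most $1/(2z)+K$, which allows only $z^{1/2}$ near 0, whereas the
    hypothesis makes it $O(z)$; so it vanishes. *)
Lemma floquet_unique (w : R -> 'cV[CC]_2) (B e0 : R) : 0 < e0 ->
  (forall z, 0 < z < 1 -> forall i, is_derivC (fun t => w t i 0) z ((M z *m w z) i 0)) ->
  (forall z, 0 < z < e0 -> forall i, cn (w z i 0) ^+ 2 <= B * z) ->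
  forall z, 0 < z < 1 -> w z = 0.
Proof.
move=> e00 dw wB b /andP[b0 b1].
(* [K] is the weight of the second component in the energy; [p] bounds $|z-1|^{-1}$ and $|z-c|^{-1}$
   on $(0,b]$, so the argument is run up to each [b] below 1 separately. *)
pose a := cn lam; pose K := 2 * a ^+ 2 + 1; pose p := (1 - b)^-1.
pose q := p * cn b12 + p * cn r12.
have a0 : 0 <= a by exact: cn_ge0.
have K1 : 1 <= K by rewrite /K; have := sqr_ge0 a; lra.
have K0 : 0 <= K by exact: le_trans K1.
have p0 : 0 <= p by rewrite invr_ge0; lra.
have q0 : 0 <= q by rewrite addr_ge0 ?mulr_ge0 ?cn_ge0.
pose E z := cn (w z 0 0) ^+ 2 + K * cn (w z 1 0) ^+ 2.
pose E' z := 2 * dot (w z 0 0) ((M z *m w z) 0 0) + K * (2 * dot (w z 1 0) ((M z *m w z) 1 0)).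
have E0 z : 0 <= E z by apply: addr_ge0; [exact: sqr_ge0|apply: mulr_ge0; [exact: K0|exact: sqr_ge0]].
suff Eb : E b = 0.
  have h1 := sqr_ge0 (cn (w b 0 0)); have h2 := sqr_ge0 (cn (w b 1 0)).
  have e1 : cn (w b 0 0) ^+ 2 = 0 by move: Eb; rewrite /E; nra.
  have e2 : cn (w b 1 0) ^+ 2 = 0 by move: Eb; rewrite /E; nra.
  apply: cV2P; rewrite mxE; apply/eqP; rewrite -cn_eq0 -sqrf_eq0; exact/eqP.
apply: (@singular_gronwall R E E' (2 * p + q + K) (B + K * B) e0 b) => //.
- by apply: addr_ge0 => //; apply: addr_ge0 => //; exact: mulr_ge0.
- move=> z /andP[z0 zb]; have z01 : 0 < z < 1 by rewrite z0 (le_lt_trans zb).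
  have h0 := cn_sqr_derive (dw z z01 0); have h1 := cn_sqr_derive (dw z z01 1).
  have h2 : is_derive z (1 : R) (fun t => K *: cn (w t 1 0) ^+ 2) _ := is_deriveZ K h1.
  exact: (is_deriveD h0 h2).
- move=> z /andP[z0 zb].
  have i0 : 0 <= z^-1 by rewrite invr_ge0 ltW.
  have pinv x : 1 - b <= x -> x^-1 <= p.
    by move=> bx; rewrite /p lef_pV2// posrE; lra.
  have p1 : - (z - 1)^-1 <= p.
    by rewrite -invrN opprB; apply: pinv; exact: lerB.
  have p2 : - (z - c)^-1 <= p.
    by rewrite -invrN opprB; apply: pinv; exact: lerB (ltW hc) zb.
  have n1 : (z - 1)^-1 <= 0 by rewrite invr_le0 subr_le0 ltW// (le_lt_trans zb).
  have n2 : (z - c)^-1 <= 0 by rewrite invr_le0 subr_le0 ltW// (le_lt_trans zb)// (lt_trans b1).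
  have M11 : m11 z <= - (z^-1 / 2) + p.
    by rewrite /m11; move: (z^-1) ((z - 1)^-1) ((z - c)^-1) p1 p2 => x y t; lra.
  have M12 : cn (m12 z) <= a * z^-1 + q.
    rewrite /m12 /q -addrA; apply: le_trans (cnD _ _) _; apply: lerD.
      by rewrite cnM cn_RtoC (ger0_norm i0) mulrC.
    apply: le_trans (cnD _ _) _; apply: lerD; rewrite cnM cn_RtoC ler0_norm//;
      apply: ler_wpM2r => //; exact: cn_ge0.
  have c_gt0 : 0 < c by exact: lt_trans hc.
  have ci : c^-1 <= 1 by rewrite invf_le1// ltW.
  have ci0 : 0 <= c^-1 by rewrite invr_ge0 ltW.
  have -> : 1 / (2 * z) = z^-1 / 2 by field; exact: lt0r_neq0.
  apply: le_trans (energy_inequality _ _ i0 p0 q0 a0).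
  rewrite /E' coefM_mul0 coefM_mul1 dotD !dotZ dot_sqr.
  set X := cn (w z 0 0); set Y := cn (w z 1 0).
  have X0 : 0 <= X by exact: cn_ge0.
  have Y0 : 0 <= Y by exact: cn_ge0.
  have t1 : m11 z * X ^+ 2 <= (- (z^-1 / 2) + p) * X ^+ 2 by rewrite ler_wpM2r ?sqr_ge0.
  have t2 : dot (w z 0 0) (m12 z * w z 1 0) <= (a * z^-1 + q) * (X * Y).
    apply: le_trans (dot_le _ _) _; rewrite cnM mulrCA ler_wpM2r//.
    exact: mulr_ge0.
  have t3 : - c^-1 * dot (w z 1 0) (w z 0 0) <= X * Y.
    rewrite mulNr -mulrN.
    have -> : - dot (w z 1 0) (w z 0 0) = dot (w z 1 0) (RtoC (-1) * w z 0 0).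
      by rewrite dotZ mulN1r.
    apply: le_trans (ler_wpM2l ci0 (dot_le _ _)) _.
    rewrite cnM cn_RtoC normrN1 mul1r mulrC (mulrC Y) ler_piMr//.
    exact: mulr_ge0.
  have t4 : K * (- c^-1 * dot (w z 1 0) (w z 0 0)) <= K * (X * Y).
    by apply: ler_wpM2l t3; lra.
  move: t1 t2 t4; rewrite -/K; move: (m11 z * _) (dot _ _) (K * (X * Y)) => t1 t2 t3'.
  move: ((- (z^-1 / 2) + p) * _) ((a * z^-1 + q) * _) (- c^-1 * _) => t4 t5 t6; lra.
- move=> z ze; have h0 := wB z ze 0; have h1 := wB z ze 1.
  rewrite (_ : (B + K * B) * z = B * z + K * (B * z)); last by ring.
  by apply: lerD => //; apply: ler_wpM2l.
Qed.

End Uniqueness.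

(** * Vector-valued power series *)

Section VectorSeries.
Variable R : realType.
Local Notation CC := (C R).
Implicit Types (a b : nat -> 'cV[CC]_2) (v w : 'cV[CC]_2) (z : R).

Definition is_vps a z v := forall i, is_ps (fun k => a k i 0) z (v i 0).

Definition vpsum a z : 'cV[CC]_2 := \col_i psum (fun k => a k i 0) z.

Lemma is_vps_unique a z v w : is_vps a z v -> is_vps a z w -> v = w.
Proof. by move=> h1 h2; apply: cV2P; exact: is_ps_unique (h1 _) (h2 _). Qed.

Lemma is_vpsD a b z v w : is_vps a z v -> is_vps b z w ->
  is_vps (fun k => a k + b k) z (v + w).
Proof.
move=> h1 h2 i; have := is_psD (h1 i) (h2 i).
by rewrite mxE; under [X in _ -> is_ps X _ _]funext do rewrite mxE.
Qed.

Lemma is_ps_row (r : 'rV[CC]_2) a z v : is_vps a z v ->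
  is_ps (fun k => (r *m a k) 0 0) z ((r *m v) 0 0).
Proof.
move=> h; have := is_psD (is_psZ (r 0 0) (h 0)) (is_psZ (r 0 1) (h 1)).
by rewrite mxE sum_ord2; under [X in _ -> is_ps X _ _]funext do rewrite mxE sum_ord2.
Qed.

Lemma is_vpsM (A : 'M[CC]_2) a z v : is_vps a z v -> is_vps (fun k => A *m a k) z (A *m v).
Proof.
move=> h i; have := is_ps_row (row i A) h.
rewrite -row_mul mxE; under [X in is_ps X _ _ -> _]funext do rewrite -row_mul mxE.
by [].
Qed.

Lemma is_vpsZ (x : CC) a z v : is_vps a z v -> is_vps (fun k => x *: a k) z (x *: v).
Proof.
move=> h i; have := is_psZ x (h i).
by rewrite mxE; under [X in _ -> is_ps X _ _]funext do rewrite mxE.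
Qed.

Lemma is_vpsB a b z v w : is_vps a z v -> is_vps b z w ->
  is_vps (fun k => a k - b k) z (v - w).
Proof.
move=> h1 h2; have := is_vpsD h1 (is_vpsZ (-1) h2); rewrite scaleN1r.
by under [X in is_vps X _ _]funext do rewrite scaleN1r.
Qed.

Lemma is_vps_shift a z v : is_vps (fun k => a k.+1) z v -> is_vps a z (a 0%N + RtoC z *: v).
Proof. by move=> h i; rewrite !mxE; exact: (@is_ps_shift _ (fun k => a k i 0)). Qed.

Lemma linear_growth_vps a (M : R) z : (forall k, nm (a k) <= M * k.+1%:R) -> `|z| < 1 ->
  is_vps a z (vpsum a z).
Proof.
move=> H z1 i; rewrite mxE.
have z0 : 0 <= `|z| by [].
have r0 : 0 < (1 + `|z|) / 2 by lra.
apply: (is_ps_psum r0); last by lra.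
apply: (@linear_growth_tame _ _ M); first by lra.
by move=> k; apply: le_trans (H k); exact: nm_entry.
Qed.

Lemma linear_growth_vps_derive a (M : R) z i : (forall k, nm (a k) <= M * k.+1%:R) -> `|z| < 1 ->
  is_derivC (fun t => vpsum a t i 0) z (vpsum (fun k => RtoC k.+1%:R *: a k.+1) z i 0) /\
  is_vps (fun k => RtoC k.+1%:R *: a k.+1) z (vpsum (fun k => RtoC k.+1%:R *: a k.+1) z).
Proof.
move=> H z1.
have z0 : 0 <= `|z| by [].
pose r := (1 + `|z|) / 2.
have ta j : tame (fun k => a k j 0) r.
  apply: (@linear_growth_tame _ _ M); first by rewrite /r; lra.
  by move=> k; apply: le_trans (H k); exact: nm_entry.
have dE j : (fun k => (RtoC k.+1%:R *: a k.+1) j 0) = diffs (fun k => a k j 0).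
  by apply/funext => k; rewrite mxE.
split.
  rewrite mxE dE (_ : (fun t => _) = psum (fun k => a k i 0)).
    by apply: (@psum_derive _ _ r) => //; rewrite /r; lra.
  by apply/funext => t; rewrite mxE.
move=> j; rewrite mxE dE; pose s := (1 + 3 * `|z|) / 4.
apply: (@is_ps_psum _ _ s); rewrite /s; [lra| |lra].
by apply: tame_diffs (ta j); rewrite /r; lra.
Qed.
End VectorSeries.

(** * Generating functions of the recurrence *)

Section SeriesSolution.
Variables (R : realType) (c : R) (lam mu gam : C R) (rho sig : nat).
Hypotheses (hc : 1 < c) (hrho : (rho <= 1)%N) (hsig : (sig <= 1)%N).
Local Notation CC := (C R).
Local Notation A' := (A' lam rho).
Local Notation B' := (B' c lam mu gam sig).
Local Notation S' := (S' c).
Local Notation R' := (R' c lam mu gam).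
Local Notation u_ k := (uds c lam mu gam rho sig k).1.1.
Local Notation s_ k := (uds c lam mu gam rho sig k).2.
Local Notation d_ k := (d_ c lam mu gam rho sig k).

Definition Useries (z : R) : 'cV[CC]_2 := vpsum (fun k => u_ k) z.
Definition Dseries (z : R) : 'cV[CC]_2 := vpsum (fun k => d_ k) z.
Definition Sseries (z : R) : 'cV[CC]_2 := vpsum (fun k => s_ k) z.

Lemma series_growth : exists M : R, forall k,
  [/\ nm (u_ k) <= M * k.+1%:R, nm (d_ k) <= M * k.+1%:R & nm (s_ k) <= M * k.+1%:R].
Proof.
have [M H] := coefficients_growth lam mu gam hc hrho hsig.
exists M => k; have := H k; have := nm_ge0 (u_ k); have := nm_ge0 (d_ k); have := nm_ge0 (s_ k).
by move: (nm _) (nm _) (nm _) (M * _) => x y t m *; split; lra.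
Qed.

(** [a0] is an eigenvector of $A$ for $\alpha_0$; hence $A'U(z)/z$ has no pole at 0. *)
Lemma A'_a0 : A' *m a0 lam rho = 0.
Proof.
rewrite /A' /Amx mx2_scalar mx2_mul /a0 /rhoR.
case: (le1_cases hrho) => ->; apply: cV2P; rewrite !mxE/=;
  rewrite ?mulr0n ?mulr1n ?mul0r ?subr0 ?subrr ?RtoC0 ?RtoC1 ?RtoC_half /a12 ?RtoCM ?RtoC1 ?RtoCV ?RtoC_nat; by field.
Qed.

(** The recurrences for [d_], [s_] and [u_] read as identities between series, each obtained by
    shifting the index and using uniqueness of the sum. *)
Lemma series_relations z : 0 < z < 1 ->
  [/\ is_vps (fun k => u_ k) z (Useries z), is_vps (fun k => d_ k) z (Dseries z),
   RtoC (1 - z) *: Dseries z = Useries z, RtoC (1 - z / c) *: Sseries z = Useries z &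
   forall i, is_derivC (fun t => Useries t i 0) z
     ((RtoC z^-1 *: (A' *m Useries z) - B' *m Dseries z - S' *m Useries z
       - R' *m Sseries z) i 0)].
Proof.
move=> /andP[z0 z1]; have z1' : `|z| < 1 by rewrite gtr0_norm.
have [M HM] := series_growth.
have Mu k : nm (u_ k) <= M * k.+1%:R by case: (HM k).
have Md k : nm (d_ k) <= M * k.+1%:R by case: (HM k).
have Ms k : nm (s_ k) <= M * k.+1%:R by case: (HM k).
have hu := linear_growth_vps Mu z1'.
have hd := linear_growth_vps Md z1'.
have hs := linear_growth_vps Ms z1'.
have Mu1 k : nm (u_ k.+1) <= 2 * M * k.+1%:R.
  apply: le_trans (Mu k.+1) _.
  have M0 : 0 <= M by have := Mu 0%N; rewrite mulr1; apply: le_trans; exact: nm_ge0.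
  have k2 : k.+2%:R <= 2 * k.+1%:R :> R by rewrite -natrM ler_nat; lia.
  by apply: le_trans (ler_wpM2l M0 k2) _; rewrite mulrCA mulrA.
have hu1 := linear_growth_vps Mu1 z1'.
rewrite -!/(Useries z) -/(Dseries z) -/(Sseries z) in hu hd hs.
move: hu1; set U1 := vpsum _ _ => hu1.
have eU : Useries z = a0 lam rho + RtoC z *: U1.
  exact: is_vps_unique hu (is_vps_shift hu1).
have d1 : is_vps (fun k => d_ k.+1) z (Dseries z + U1).
  by under [X in is_vps X _ _]funext do rewrite dS; exact: is_vpsD.
have s1 : is_vps (fun k => s_ k.+1) z ((RtoC c)^-1 *: Sseries z + U1).
  by under [X in is_vps X _ _]funext do rewrite sS; apply: is_vpsD => //; exact: is_vpsZ.
have eD : Dseries z = a0 lam rho + RtoC z *: (Dseries z + U1).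
  exact: is_vps_unique hd (is_vps_shift d1).
have eS : Sseries z = a0 lam rho + RtoC z *: ((RtoC c)^-1 *: Sseries z + U1).
  exact: is_vps_unique hs (is_vps_shift s1).
split=> //.
- rewrite RtoCB RtoC1 scalerBl scale1r {1}eD eU scalerDr.
  by rewrite (addrC (RtoC z *: Dseries z)) addrA addrK.
- rewrite RtoCB RtoC1 RtoCM RtoCV scalerBl scale1r {1}eS eU scalerDr scalerA.
  by rewrite (addrC (_ *: Sseries z)) addrA addrK.
move=> i; have [h1 h2] := linear_growth_vps_derive i Mu z1'.
suff <- : vpsum (fun k => RtoC k.+1%:R *: u_ k.+1) z =
   RtoC z^-1 *: (A' *m Useries z) - B' *m Dseries z - S' *m Useries z - R' *m Sseries z.
  exact: h1.
apply: is_vps_unique h2 _.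
have -> : RtoC z^-1 *: (A' *m Useries z) = A' *m U1.
  rewrite eU mulmxDr A'_a0 add0r -scalemxAr scalerA -RtoCM mulVf ?scale1r//.
  exact: lt0r_neq0.
under [X in is_vps X _ _]funext do rewrite uS -?B'E//.
by repeat (apply: is_vpsB); apply: is_vpsM.
Qed.

End SeriesSolution.

(** * The gauged series solves the system *)

Section FloquetSolution.
Variables (R : realType) (c : R) (lam mu gam : C R) (rho sig : nat).
Hypotheses (hc : 1 < c) (hrho : (rho <= 1)%N) (hsig : (sig <= 1)%N).
Local Notation CC := (C R).
Local Notation al0 := (alpha0 R rho).
Local Notation be1 := (beta1 R sig).
Local Notation U := (Useries c lam mu gam rho sig).
Local Notation Ds := (Dseries c lam mu gam rho sig).
Local Notation Ss := (Sseries c lam mu gam rho sig).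
Local Notation A' := (A' lam rho).
Local Notation B' := (B' c lam mu gam sig).
Local Notation S' := (S' c).
Local Notation R' := (R' c lam mu gam).

Definition gauge (z : R) : R := z `^ al0 * (1 - z) `^ be1.

Lemma powR_derive (a x : R) : 0 < x -> is_derive x (1 : R) (fun t : R => t `^ a) (a / x * x `^ a).
Proof.
move=> x0; apply: (is_derive_eq (is_derive1_powR a x0)).
rewrite powRD; last by rewrite (gt_eqF x0) implybT.
by rewrite powR_inv1 ?ltW// -!mulrA; congr (_ * _); rewrite mulrC.
Qed.

Lemma gauge_derive (z : R) : 0 < z < 1 ->
  is_derive z (1 : R) gauge ((al0 / z - be1 / (1 - z)) * gauge z).
Proof.
move=> /andP[z0 z1]; have z1' : 0 < 1 - z by rewrite subr_gt0.
have h1 := powR_derive al0 z0.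
have h3 : is_derive z (1 : R) (fun t : R => 1 - t) (0 - 1).
  exact: (is_deriveB (is_derive_cst (1 : R) z 1) (is_derive_id z (1 : R))).
have h2 := @is_derive1_comp _ (fun t : R => t `^ be1) (fun t : R => 1 - t) z _ _ (powR_derive be1 z1') h3.
have h := is_deriveM h1 h2.
rewrite (_ : gauge = (fun t : R => t `^ al0) * ((fun t : R => t `^ be1) \o (fun t : R => 1 - t))); last by [].
apply: (is_derive_eq h); rewrite /GRing.scale /= /gauge.
rewrite -[((_ * (_ \o _)) z)]/(z `^ al0 * (1 - z) `^ be1).
by move: (z `^ _) ((1 - z) `^ _) (z^-1) ((1 - z)^-1) => *; ring.
Qed.

Lemma gauge_ode_identity (F : fieldType) (z c' al be : F) (U1 AU BU SU RU : F) :
  z != 0 -> 1 - z != 0 -> c' != 0 -> c' - z != 0 ->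
  z^-1 * (AU + - al * U1) - (1 - z)^-1 * (BU + - be * U1) - c'^-1 * SU
    - (1 - z / c')^-1 * (c'^-1 * RU) + (al / z - be / (1 - z)) * U1
  = z^-1 * AU + (z - 1)^-1 * BU + (z - c')^-1 * RU - c'^-1 * SU.
Proof.
move=> h1 h2 h3 h4.
have h5 : z - 1 != 0 by rewrite -oppr_eq0 opprB.
have h6 : z - c' != 0 by rewrite -oppr_eq0 opprB.
have h7 : 1 - z / c' != 0.
  by rewrite (_ : 1 - z / c' = (c' - z) / c') ?mulf_neq0 ?invr_eq0//; field.
by field; rewrite h1 h2 h3 h5 h6 /= h4.
Qed.

Lemma gauge_ode_matrix (F : fieldType) (z c' al be : F) (A B S T : 'M[F]_2) (V : 'cV[F]_2) i :
  z != 0 -> 1 - z != 0 -> c' != 0 -> c' - z != 0 ->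
  (z^-1 *: ((A + (- al)%:M) *m V) - (B + (- be)%:M) *m ((1 - z)^-1 *: V)
    - (c'^-1 *: S) *m V - (c'^-1 *: T) *m ((1 - z / c')^-1 *: V)) i 0
    + (al / z - be / (1 - z)) * V i 0
  = ((z^-1 *: A + (z - 1)^-1 *: B + (z - c')^-1 *: T - c'^-1 *: S) *m V) i 0.
Proof.
move=> h1 h2 h3 h4; rewrite -!scalemxAr !mulmxBl !mulmxDl !mul_scalar_mx -!scalemxAl.
move: (A *m V) (B *m V) (S *m V) (T *m V) => AV BV SV TV; rewrite !mxE.
move: (V i 0) (AV i 0) (BV i 0) (SV i 0) (TV i 0) => V1 A1 B1 S1 T1.
exact: gauge_ode_identity.
Qed.

Lemma gauged_series_solves (z : R) i : 0 < z < 1 ->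
  is_derivC (fun t => (RtoC (gauge t) *: U t) i 0) z
    ((coefM c lam mu gam z *m (RtoC (gauge z) *: U z)) i 0).
Proof.
move=> zz; have /andP[z0 z1] := zz.
have [_ _ eD eS dU] := series_relations lam mu gam hc hrho hsig zz.
have h := is_derivCZ (gauge_derive zz) (dU i).
rewrite (_ : (fun t => _) = (fun t => RtoC (gauge t) * U t i 0)); last first.
  by apply/funext => t; rewrite mxE.
suff <- : RtoC (gauge z) * (RtoC z^-1 *: (A' *m U z) - B' *m Ds z - S' *m U z - R' *m Ss z) i 0
  + RtoC ((al0 / z - be1 / (1 - z)) * gauge z) * U z i 0 =
  (coefM c lam mu gam z *m (RtoC (gauge z) *: U z)) i 0 by [].
rewrite -scalemxAr [in RHS]mxE RtoCM (mulrC _ (RtoC (gauge z))) -mulrA -mulrDr; congr (_ * _).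
have nz : 1 - z != 0 by rewrite subr_eq0 gt_eqF.
have c0 : 0 < c by exact: lt_trans hc.
have nc : 1 - z / c != 0.
  by rewrite subr_eq0 eq_sym lt_eqF// ltr_pdivrMr// mul1r (lt_trans z1).
have -> : Ds z = RtoC (1 - z)^-1 *: U z.
  by rewrite -eD scalerA -RtoCM mulVf// scale1r.
have -> : Ss z = RtoC (1 - z / c)^-1 *: U z.
  by rewrite -eS scalerA -RtoCM mulVf// scale1r.
have eA : A' = Amx lam + (- RtoC al0)%:M.
  by rewrite /A' -RtoCN /alpha0 /rhoR mulNr opprK.
have eB : B' = Bmx c lam mu gam + (- RtoC be1)%:M.
  by rewrite /B' -RtoCN /beta1 /sigR; congr (_ + (RtoC _)%:M); lra.
rewrite eA eB /S' /R' /coefM !RtoCV !(RtoCB (al0 / z)) !RtoCM !RtoCV !RtoCB !RtoCM !RtoCV RtoC1.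
apply: gauge_ode_matrix; rewrite ?RtoC_eq0 ?(lt0r_neq0 z0) ?(lt0r_neq0 c0)//.
- by rewrite -RtoC1 -RtoCB RtoC_eq0.
- by rewrite -RtoCB RtoC_eq0 subr_eq0 gt_eqF// (lt_trans z1).
Qed.

End FloquetSolution.

(** The form in which analyticity of [h0] at 0 and of [H] at 1 enters the estimates. *)
Lemma analytic_lipschitz (R : realType) m n (f : R -> 'M[C R]_(m, n)) (z0 : R) :
  analytic_at f z0 -> exists r L : R, [/\ 0 < r, 0 <= L &
    forall x, `|x - z0| <= r -> forall i j, cn (f x i j - f z0 i j) <= L * `|x - z0|].
Proof.
move=> [r [r0 [a H]]].
have ps x i j : `|x - z0| < r -> is_ps (fun k => a k i j) (x - z0) (f x i j).
  by move=> xr; apply: series_to_is_ps; exact: H.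
have r20 : 0 < r / 2 by rewrite divr_gt0.
have ta i j : tame (fun k => a k i j) (r / 2).
  have := ps (z0 + r / 2) i j; rewrite (addrC z0) addrK => h; apply: is_ps_tame (h _) => //.
  by rewrite gtr0_norm//; lra.
have /choice[L HL] : forall ij : 'I_m * 'I_n, exists L, 0 <= L /\
   forall x l, `|x| <= r / 2 / 2 -> is_ps (fun k => a k ij.1 ij.2) x l ->
   cn (l - a 0%N ij.1 ij.2) <= L * `|x|.
  by move=> [i j]; exact: is_ps_lipschitz (ta i j).
exists (r / 2 / 2), (\sum_ij L ij); split; first by rewrite divr_gt0.
  by apply: sumr_ge0 => ij _; case: (HL ij).
move=> x xr i j; have [L0 HLij] := HL (i, j).
have e0 : f z0 i j = a 0%N i j.
  have := ps z0 i j; rewrite subrr normr0 => /(_ r0) h.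
  have := HLij 0 _ _ h; rewrite normr0 mulr0 => h'.
  apply/eqP; rewrite -subr_eq0 -cn_eq0 eq_le cn_ge0 andbT; apply: h'.
  by rewrite ltW// divr_gt0.
rewrite e0; apply: le_trans (HLij _ _ xr (ps x i j _)) _; first by move: xr r0; lra.
rewrite ler_wpM2r// (bigD1 (i, j))//= lerDl; apply: sumr_ge0 => ij _.
by case: (HL ij).
Qed.

(** * Identification of [y0] with the gauged series *)

Section Connection.
Variables (R : realType) (c : R) (lam mu gam : C R) (rho sig : nat).
Hypotheses (hc : 1 < c) (hrho : (rho <= 1)%N) (hsig : (sig <= 1)%N).
Local Notation CC := (C R).
Local Notation al0 := (alpha0 R rho).
Local Notation be1 := (beta1 R sig).
Local Notation be2 := (beta2 R sig).
Local Notation U := (Useries c lam mu gam rho sig).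
Local Notation Ds := (Dseries c lam mu gam rho sig).
Local Notation gauge := (gauge rho sig).

Lemma Useries_lipschitz : exists L, 0 <= L /\ forall z, 0 < z <= 1 / 4 -> forall i,
  cn (U z i 0 - a0 lam rho i 0) <= L * z.
Proof.
have [M HM] := series_growth lam mu gam hc hrho hsig.
have ta i : tame (fun k => (uds c lam mu gam rho sig k).1.1 i 0) (1 / 2).
  apply: (@linear_growth_tame _ _ M); first by lra.
  by move=> k; have [h _ _] := HM k; apply: le_trans h; exact: nm_entry.
have h2 : 0 < 1 / 2 :> R by lra.
have [L0 [L00 H0]] := is_ps_lipschitz h2 (ta 0).
have [L1 [L10 H1]] := is_ps_lipschitz h2 (ta 1).
exists (L0 + L1); split; first exact: addr_ge0.
move=> z /andP[z0 z4] i.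
have zz : 0 < z < 1 by lra.
have [hu _ _ _ _] := series_relations lam mu gam hc hrho hsig zz.
have zn : `|z| <= 1 / 2 / 2 by rewrite gtr0_norm//; lra.
have h0 := H0 _ _ zn (hu 0); have h1 := H1 _ _ zn (hu 1); rewrite gtr0_norm// in h0 h1.
have p0 : 0 <= L0 * z by rewrite mulr_ge0// ltW.
have p1 : 0 <= L1 * z by rewrite mulr_ge0// ltW.
rewrite mulrDl; case: (ord2 i) => ->; [apply: le_trans h0 _ | apply: le_trans h1 _].
  by rewrite lerDl.
by rewrite lerDr.
Qed.

Lemma be1_range : -1 <= be1 <= 0.
Proof. by rewrite /beta1 /sigR; case: (le1_cases hsig) => ->; rewrite ?mulr0n ?mulr1n; lra. Qed.

Lemma powR_near1 (b z : R) : -1 <= b <= 0 -> 0 < z <= 1 / 2 -> `|(1 - z) `^ b - 1| <= 2 * z.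
Proof.
move=> /andP[b1 b0] /andP[z0 z2].
have hz : 0 < 1 - z <= 1 by lra.
have h1 := ger_powR hz b0; have h2 := ger_powR hz b1.
rewrite powRr0 in h1; rewrite powR_inv1 in h2; last by lra.
have h3 : (1 - z)^-1 <= 1 + 2 * z.
  rewrite -[leLHS]mul1r ler_pdivrMr; last by lra.
  have hzz : 0 <= z * (1 - 2 * z) by apply: mulr_ge0; lra.
  rewrite (_ : (1 + 2 * z) * (1 - z) = 1 + z * (1 - 2 * z)); first by lra.
  by ring.
by rewrite ger0_norm; lra.
Qed.

Lemma powR_al0_sqr z : 0 < z < 1 -> (z `^ al0) ^+ 2 <= z^-1.
Proof.
move=> /andP[z0 z1]; have hz : 0 < z <= 1 by rewrite z0 ltW.
have ha : -1 <= al0 * 2%:R.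
  by rewrite /alpha0 /rhoR; case: (le1_cases hrho) => ->; rewrite ?mulr0n ?mulr1n; lra.
by have := ger_powR hz ha; rewrite powRrM powR_mulrn ?powR_ge0// powR_inv1// ltW.
Qed.

(** Both candidates start with $z^{\alpha_0}a_0$, so they differ by $z^{\alpha_0}O(z)$. As
    $2\alpha_0\ge -1$, the squared difference is $O(z)$, which is what [floquet_unique] takes. *)
Lemma floquet_series (y0 h0 : R -> 'cV[CC]_2) (r0 : R) :
  solves_on01 c lam mu gam y0 -> analytic_at h0 0 -> h0 0 = a0 lam rho -> 0 < r0 ->
  (forall z, 0 < z < r0 -> y0 z = RtoC (z `^ al0) *: h0 z) ->
  forall z, 0 < z < 1 -> y0 z = RtoC (gauge z) *: U z.
Proof.
move=> sy ah h00 r00 Hy z zz; apply/eqP; rewrite -subr_eq0; apply/eqP.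
have [r [L [rr0 L0 HL]]] := analytic_lipschitz ah.
have [LU [LU0 HU]] := Useries_lipschitz.
pose B := L + 2 * (nm (a0 lam rho) + LU) + LU.
pose e0 := Num.min r0 (Num.min r (1 / 4)).
have B0 : 0 <= B by rewrite /B !addr_ge0 ?mulr_ge0 ?addr_ge0 ?nm_ge0.
apply: (@floquet_unique R c lam mu gam hc (fun t => y0 t - RtoC (gauge t) *: U t) (B ^+ 2) e0) zz.
- by rewrite !lt_min r00 rr0 /=; lra.
- move=> t tt i.
  have h1 := has_derivC_is_derivC (sy t tt i).
  have h2 := gauged_series_solves lam mu gam hc hrho hsig i tt.
  have subE (v w : 'cV[CC]_2) : (v - w) i 0 = v i 0 - w i 0 by rewrite mxE [X in _ + X]mxE.
  rewrite mulmxBr subE; have := is_derivCB h1 h2.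
  by rewrite (_ : (fun t => y0 t i 0 - _) =
    (fun t => (y0 t - RtoC (gauge t) *: U t) i 0)) //; apply/funext => s; rewrite subE.
move=> t /andP[t0]; rewrite !lt_min => /and3P[tr0 tr t4] i.
have t01 : 0 < t < 1 by lra.
rewrite Hy ?t0//.
have e : (RtoC (t `^ al0) *: h0 t - RtoC (gauge t) *: U t) i 0 =
  RtoC (t `^ al0) * ((h0 t i 0 - a0 lam rho i 0) - RtoC ((1 - t) `^ be1 - 1) * U t i 0
    - (U t i 0 - a0 lam rho i 0)).
  by rewrite !mxE /gauge RtoCM RtoCB RtoC1; ring.
rewrite e cnM exprMn cn_RtoC (ger0_norm (powR_ge0 _ _)).
set w := _ - _ - _.
have wB : cn w <= B * t.
  have h1 : cn (h0 t i 0 - a0 lam rho i 0) <= L * t.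
    by have := HL t _ i 0; rewrite subr0 h00 gtr0_norm//; apply; exact: ltW.
  have h2 : cn (U t i 0 - a0 lam rho i 0) <= LU * t by apply: HU; rewrite t0 ltW.
  have h3 : cn (U t i 0) <= nm (a0 lam rho) + LU.
    rewrite -(subrK (a0 lam rho i 0) (U t i 0)) addrC; apply: le_trans (cnD _ _) _.
    apply: lerD; first exact: nm_entry.
    by apply: le_trans h2 _; rewrite ler_piMr//; lra.
  have h4 : cn (RtoC ((1 - t) `^ be1 - 1) * U t i 0) <= 2 * t * (nm (a0 lam rho) + LU).
    rewrite cnM cn_RtoC; apply: ler_pM; rewrite ?cn_ge0//.
    by apply: powR_near1; [exact: be1_range|lra].
  apply: le_trans (cnB _ _) _; rewrite /B mulrDl; apply: lerD => //.
  apply: le_trans (cnB _ _) _; rewrite mulrDl; apply: lerD => //.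
  by rewrite mulrAC.
apply: (@le_trans _ _ (t^-1 * (B * t) ^+ 2)); last first.
  by rewrite (_ : t^-1 * _ = B ^+ 2 * t)//; field; exact: lt0r_neq0.
apply: ler_pM; rewrite ?sqr_ge0//; first exact: powR_al0_sqr.
by rewrite lerXn2r ?nnegrE ?cn_ge0// mulr_ge0// ltW.
Qed.

End Connection.

Lemma delta_not_int (R : realType) (sig : nat) : ~ exists m : int, delta R sig = m%:~R.
Proof.
move=> [m]; rewrite /delta /beta2 /beta1 /sigR => e.
have : (1 - 2 * sig%:Z)%:~R = (2 * m)%:~R :> R.
  by rewrite rmorphB !rmorphM /= -e; lra.
by move=> /intr_inj; lia.
Qed.

Lemma fundamental_entries (R : realType) (Hz : 'M[C R]_2) (x1 x2 : C R) i :
  (Hz *m mx2 x1 0 0 x2 *m mx2 1 0 0 1) i 0 = Hz i 0 * x1 /\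
  (Hz *m mx2 x1 0 0 x2 *m mx2 1 0 0 1) i 1 = Hz i 1 * x2.
Proof. by split; rewrite !mxE !sum_ord2 !mxE !sum_ord2 !mxE /=; ring. Qed.

(** * Comparison with the fundamental matrix at 1 *)

Section ConnectionCoefficient.
Variables (R : realType) (c : R) (lam mu gam : C R) (rho sig : nat).
Hypotheses (hc : 1 < c) (hrho : (rho <= 1)%N) (hsig : (sig <= 1)%N).
Local Notation CC := (C R).
Local Notation al0 := (alpha0 R rho).
Local Notation be1 := (beta1 R sig).
Local Notation be2 := (beta2 R sig).
Local Notation U := (Useries c lam mu gam rho sig).
Local Notation Ds := (Dseries c lam mu gam rho sig).
Local Notation ap r v := ((r *m v) 0 0).
Local Notation xr := (xr c lam mu gam sig).
Local Notation d_ k := (d_ c lam mu gam rho sig k).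

Section NearOne.
Variables (H : R -> 'M[CC]_2) (r1 : R) (Th Om : CC).
Hypotheses (aH : analytic_at H 1) (H10 : col 0 (H 1) = b1 c lam mu gam sig)
  (H11 : col 1 (H 1) = b2 c lam mu gam sig) (r10 : 0 < r1).
Hypothesis HU : forall z, 0 < z < 1 -> 1 - r1 < z ->
  RtoC (gauge rho sig z) *: U z = (Th * RtoC ((1 - z) `^ be1)) *: col 0 (H z)
     + (Om * RtoC ((1 - z) `^ be2)) *: col 1 (H z).

Lemma ungauged z : 0 < z < 1 -> 1 - r1 < z ->
  ap xr (U z) = RtoC (z `^ (- al0)) *
    (Th * ap xr (col 0 (H z)) + Om * (RtoC ((1 - z) `^ (be2 - be1)) * ap xr (col 1 (H z)))).
Proof.
move=> zz zr; have /andP[z0 z1] := zz.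
have p1 : z `^ al0 != 0 by rewrite powR_eq0 gt_eqF.
have p2 : (1 - z) `^ be1 != 0 by rewrite powR_eq0 gt_eqF// subr_gt0.
have z1n : 1 - z != 0 by rewrite gt_eqF// subr_gt0.
have g0 : RtoC (gauge rho sig z) != 0 by rewrite RtoC_eq0 mulf_neq0.
have := congr1 (fun v => ap xr v) (HU zz zr).
rewrite mulmxDr -!scalemxAr !mxE => h; apply: (mulfI g0); rewrite h.
rewrite powRN powRB; last by rewrite z1n implybT.
rewrite /gauge !RtoCM !RtoCV.
have q1 : RtoC (z `^ al0) != 0 by rewrite RtoC_eq0.
have q2 : RtoC ((1 - z) `^ be1) != 0 by rewrite RtoC_eq0.
move: (RtoC (z `^ al0)) (RtoC (_ `^ be1)) (RtoC (_ `^ be2)) q1 q2 => x1 x2 x3 q1 q2.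
by field; rewrite q1 q2.
Qed.

Lemma xr_H_near1 : exists L r : R, [/\ 0 <= L, 0 < r & forall z, 1 - r <= z <= 1 ->
  cn (ap xr (col 0 (H z)) - 1) <= L * (1 - z) /\ cn (ap xr (col 1 (H z))) <= L * (1 - z)].
Proof.
have [r [L [r0 L0 HL]]] := analytic_lipschitz aH.
exists (nm xr * (2 * L)), r; split=> //.
  by rewrite mulr_ge0 ?nm_ge0// mulr_ge0.
move=> z /andP[zr z1].
have nz : `|z - 1| = 1 - z by rewrite ler0_norm ?opprB// subr_le0.
have hz : `|z - 1| <= r by rewrite nz; lra.
have E j : nm (col j (H z) - col j (H 1)) <= 2 * L * (1 - z).
  rewrite /nm sum_ord2 !big_ord1 -mulrA mulr_natl mulr2n -nz.
  by apply: lerD; rewrite !mxE; exact: HL.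
have E' j : cn (ap xr (col j (H z) - col j (H 1))) <= nm xr * (2 * L) * (1 - z).
  by apply: le_trans (nm_row_mul _ _) _; rewrite -mulrA ler_wpM2l ?nm_ge0.
split.
  by have := E' 0; rewrite H10 mulmxBr [X in cn X]mxE [X in cn (_ + X)]mxE xr_b1.
by have := E' 1; rewrite H11 mulmxBr [X in cn X]mxE [X in cn (_ + X)]mxE xr_b2// subr0.
Qed.

(** [xr] vanishes on the second column of [H] at 1, hence is $O(1-z)$ there. This outweighs
    $(1-z)^\delta$ with $\delta\ge -1/2$, so the second solution contributes $O(\sqrt{1-z})$ even
    when it is singular. *)
Lemma xr_U_limit : exists K r : R, [/\ 0 <= K, 0 < r & forall z, 0 < z < 1 -> 1 - r <= z ->
  cn (ap xr (U z) - Th) <= K * Num.sqrt (1 - z)].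
Proof.
have [L [r [L0 r0 HL]]] := xr_H_near1.
exists (cn Th * L + cn Th + cn Om * L), (Num.min r (r1 / 2)); split.
- by rewrite !addr_ge0 ?mulr_ge0 ?cn_ge0.
- by rewrite lt_min r0 divr_gt0.
move=> z zz; rewrite lerBlDr -lerBlDl le_min => /andP[zr zr1]; have /andP[z0 z1] := zz.
have zr1' : 1 - r1 < z by lra.
have zr' : 1 - r <= z <= 1 by lra.
rewrite (ungauged zz zr1'); have [h0 h1] := HL z zr'.
set t := 1 - z in h0 h1 *.
have t0 : 0 < t by rewrite subr_gt0.
have ht : 0 < t <= 1 by rewrite /t; lra.
set s := Num.sqrt t.
have sE : s = t `^ (2^-1) by rewrite powR12_sqrt// ltW.
have ts : t <= s.
  have h2 : (2^-1 : R) <= 1 by lra.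
  by have := ger_powR ht h2; rewrite -sE (powRr1 (ltW t0)).
have ds : t `^ (be2 - be1) * t <= s.
  rewrite -{2}(powRr1 (ltW t0)) -powRD; last by rewrite (gt_eqF t0) implybT.
  have h2 : (2^-1 : R) <= be2 - be1 + 1.
    by rewrite /beta2 /beta1 /sigR; case: (le1_cases hsig) => ->; rewrite ?mulr0n ?mulr1n; lra.
  by have := ger_powR ht h2; rewrite sE.
have hz : 0 < z <= 1 by lra.
have P1 : z `^ (- al0) <= 1.
  have h2 : 0 <= - al0.
    by rewrite /alpha0 /rhoR; case: (le1_cases hrho) => ->; rewrite ?mulr0n ?mulr1n; lra.
  by have := ger_powR hz h2; rewrite powRr0.
have Pz : z <= z `^ (- al0).
  have h2 : - al0 <= 1.
    by rewrite /alpha0 /rhoR; case: (le1_cases hrho) => ->; rewrite ?mulr0n ?mulr1n; lra.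
  by have := ger_powR hz h2; rewrite powRr1// ltW.
set P := z `^ (- al0) in P1 Pz *.
have P0 : 0 <= P by exact: powR_ge0.
set X0 := ap xr _ in h0 *; set X1 := ap xr _ in h1 *.
set D := t `^ _ in ds *.
have D0 : 0 <= D by exact: powR_ge0.
have -> : RtoC P * (Th * X0 + Om * (RtoC D * X1)) - Th =
  RtoC P * (Th * (X0 - 1)) + RtoC (P - 1) * Th + RtoC P * (Om * (RtoC D * X1)).
  by rewrite RtoCB RtoC1; ring.
apply: le_trans (cnD _ _) _; rewrite mulrDl; apply: lerD; last first.
  rewrite !cnM !cn_RtoC (ger0_norm P0) (ger0_norm D0).
  apply: (@le_trans _ _ (1 * (cn Om * (L * s)))); last by rewrite mul1r mulrA.
  apply: ler_pM => //; first by rewrite !mulr_ge0 ?cn_ge0.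
  apply: ler_wpM2l; first exact: cn_ge0.
  apply: le_trans (ler_wpM2l D0 h1) _; rewrite mulrCA.
  exact: ler_wpM2l.
apply: le_trans (cnD _ _) _; rewrite mulrDl; apply: lerD; last first.
  rewrite cnM cn_RtoC mulrC ler_wpM2l ?cn_ge0//; apply: le_trans ts.
  by rewrite ler0_norm /t; lra.
rewrite !cnM !cn_RtoC (ger0_norm P0).
apply: (@le_trans _ _ (1 * (cn Th * (L * s)))); last by rewrite mul1r mulrA.
apply: ler_pM => //; first by rewrite !mulr_ge0 ?cn_ge0.
apply: ler_wpM2l; first exact: cn_ge0.
by apply: le_trans h0 _; apply: ler_wpM2l.
Qed.

Lemma connection_coefficient xi :
  (forall e : R, 0 < e -> exists N, forall k, (N <= k)%N -> cn (ap xr (d_ k) - xi) <= e) ->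
  xi = Th.
Proof.
move=> Hxi; apply/eqP; rewrite -subr_eq0 -cn_eq0 eq_le cn_ge0 andbT.
apply/ler_addgt0Pr => e4 e40; rewrite add0r.
pose e := e4 / 4; have e0 : 0 < e by rewrite divr_gt0.
have Hps z : 0 < z < 1 -> is_ps (fun k => ap xr (d_ k)) z (ap xr (Ds z)).
  move=> zz; have [_ hd _ _ _] := series_relations lam mu gam hc hrho hsig zz.
  exact: is_ps_row.
have [K HK] := abel_mean Hxi Hps e0.
have [K2 [r [K20 r0 HK2]]] := xr_U_limit.
pose Kt := `|K| + K2 + 1.
have Kt0 : 0 < Kt by rewrite ltr_wpDl// addr_ge0.
(* The test point $z=1-s^2$ turns $\sqrt{1-z}$ into $s$; with $s \le e/Kt$ the terms in [K] and [K2]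
   together cost at most $e$, for a total of $3e$. *)
pose s := Num.min (1 / 2) (Num.min r (e / Kt)).
have half0 : 0 < 1 / 2 :> R by lra.
have s0 : 0 < s by rewrite !lt_min half0 r0 divr_gt0.
have sh : s <= 1 / 2 by rewrite ge_min lexx.
have sr : s <= r by rewrite !ge_min lexx orbT.
have se : s <= e / Kt by rewrite !ge_min lexx !orbT.
pose z := 1 - s ^+ 2.
have s2 : s ^+ 2 <= s by rewrite expr2 ler_piMr; lra.
have s20 : 0 < s ^+ 2 by rewrite exprn_gt0.
have zz : 0 < z < 1 by rewrite /z; lra.
have z1 : 1 - z = s ^+ 2 by rewrite /z opprB addrCA subrr addr0.
have h1 := HK z zz.
have h2 := HK2 z zz (_ : 1 - r <= z).
have {}h2 : cn (ap xr (U z) - Th) <= K2 * s.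
  by rewrite -[s](gtr0_norm s0) -sqrtr_sqr -z1; apply: h2; rewrite /z; lra.
have [_ _ eD _ _] := series_relations lam mu gam hc hrho hsig zz.
have eU : RtoC (1 - z) * ap xr (Ds z) = ap xr (U z) by rewrite -eD -scalemxAr [RHS]mxE.
rewrite eU z1 in h1.
have h3 : cn (ap xr (U z) - xi) <= 2 * e + `|K| * s.
  apply: le_trans h1 _; rewrite lerD2l; apply: le_trans (ler_norm _) _.
  by rewrite normrM (gtr0_norm s20) ler_wpM2l.
have -> : xi - Th = - (ap xr (U z) - xi) + (ap xr (U z) - Th) by ring.
apply: le_trans (cnD _ _) _; rewrite cnN.
rewrite ler_pdivlMr// in se.
have h4 : (`|K| + K2) * s <= e.
  by apply: le_trans se; rewrite mulrC ler_pM2l// /Kt lerDl.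
have h5 : e4 = 4 * e by rewrite /e mulrCA divff ?mulr1.
by move: h2 h3 h4; rewrite mulrDl h5; lra.
Qed.
End NearOne.

End ConnectionCoefficient.

Theorem theorem5 (R : realType) (c : R) (lam mu gam : C R) (rho sig n : nat)
  (hc : 1 < c) (hrho : (rho <= 1)%N) (hsig : (sig <= 1)%N)
  (* Floquet solution y0(z) = z^alpha0 h0(z) near 0, continued along (0,1) *)
  (y0 : R -> 'V2[R]) (h0 : R -> 'V2[R]) (r0 : R)
  (* fundamental matrix near 1, continued along (0,1) *)
  (Y : R -> 'M2[R]) (H : R -> 'M2[R]) (r1 : R) (q : C R)
  (* connection coefficients *)
  (Th Om : C R) :
  solves_on01 c lam mu gam y0 ->
  analytic_at h0 0 -> h0 0 = a0 lam rho ->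
  0 < r0 -> (forall z : R, 0 < z < r0 -> y0 z = RtoC (z `^ alpha0 R rho) *: h0 z) ->
  (forall j : 'I_2, solves_on01 c lam mu gam (fun z => col j (Y z))) ->
  analytic_at H 1 ->
  col 0 (H 1) = b1 c lam mu gam sig -> col 1 (H 1) = b2 c lam mu gam sig ->
  (~ (exists m : int, delta R sig = m%:~R) -> q = 0) ->
  0 < r1 ->
  (forall z : R, 1 - r1 < z < 1 ->
     Y z = H z *m mx2 (RtoC ((1 - z) `^ beta1 R sig)) 0 0 (RtoC ((1 - z) `^ beta2 R sig))
               *m mx2 1 0 (q * RtoC (ln (1 - z))) 1) ->
  (forall z : R, 0 < z < 1 -> y0 z = Th *: col 0 (Y z) + Om *: col 1 (Y z)) ->
  (exists k1 : nat, forall k : nat, (k1 <= k)%N -> den_ c lam mu gam rho sig n k != 0)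
  /\ (Theta_ c lam mu gam rho sig n @ \oo --> Th)
  /\ (exists (K : nat) (M : R), forall k : nat, (K <= k)%N ->
        `|Theta_ c lam mu gam rho sig n k - Th|
          <= RtoC (M * (k%:R `^ (sig%:R - n%:R - 3 / 2)))).
Proof.
move=> sy ah h00 r00 Hy _ aH H10 H11 Hq r10 HY Hconn.
have {Hq}q0 : q = 0 := Hq (@delta_not_int R sig).
have yU := floquet_series hc hrho hsig sy ah h00 r00 Hy.
have HU z : 0 < z < 1 -> 1 - r1 < z ->
  RtoC (gauge rho sig z) *: Useries c lam mu gam rho sig z =
    (Th * RtoC ((1 - z) `^ beta1 R sig)) *: col 0 (H z)
     + (Om * RtoC ((1 - z) `^ beta2 R sig)) *: col 1 (H z).
  move=> zz zr; have /andP[_ z1] := zz.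
  rewrite -yU// Hconn// HY ?zr// q0 mul0r.
  apply/matrixP => i j; rewrite (ord1 j).
  have [e0 e1] := fundamental_entries (H z) (RtoC ((1 - z) `^ beta1 R sig))
     (RtoC ((1 - z) `^ beta2 R sig)) i.
  have colE k (x1 x2 : C R) (M1 M2 : 'M[C R]_2) :
      (x1 *: col 0 M1 + x2 *: col 1 M2) k 0 = x1 * M1 k 0 + x2 * M2 k 1 by rewrite !mxE.
  by rewrite !colE -!mulrA !(mulrC (RtoC _)) e0 e1.
have [l [xi Hd]] := d_asymptotics lam mu gam n hc hrho hsig.
have [Mx [kx [Mx0 Hx]]] := xr_d_asymptotics hsig Hd.
have xiTh : xi = Th.
  apply: (connection_coefficient hc hrho hsig aH H10 H11 r10 HU) => e e0.
  have e1 : 0 < e / (Mx + 1) by rewrite divr_gt0// ltr_wpDl.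
  have [N HN] := ewt_inv_vanish hsig e1.
  exists (maxn kx N) => k; rewrite geq_max => /andP[kk kN].
  apply: le_trans (Hx k kk) _; rewrite expr1.
  apply: le_trans (ler_wpM2l Mx0 (HN k kN)) _.
  by rewrite mulrCA ler_piMr ?(ltW e0)// ler_pdivrMr ?ltr_wpDl// mul1r lerDl.
rewrite {}xiTh in Hd.
have [M [k1 HM]] := Theta_asymptotics hsig Hd.
split; first by exists k1 => k /HM[].
have bound k : (k1 <= k)%N -> cn (Theta_ c lam mu gam rho sig n k - Th) <=
    `|M| * (ewt R sig k * (k.+1%:R)^-1 ^+ n.+1).
  move=> /HM[_ /le_trans]; apply; apply: ler_wpM2r; last exact: ler_norm.
  by rewrite mulr_ge0 ?(ltW (ewt_gt0 R hsig k))// exprn_ge0.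
split.
  apply/cvgrPdist_le => e e0.
  (* The tolerance ranges over the complex field, where being positive forces it to be real. *)
  have eR : e = RtoC (cn e) by rewrite -cnE gtr0_norm.
  have e0' : 0 < cn e by move: e0; rewrite {1}eR /RtoC ltcR.
  have e1 : 0 < cn e / (`|M| + 1) by rewrite divr_gt0// ltr_wpDl.
  have [N HN] := ewt_inv_vanish hsig e1.
  exists (maxn k1 N) => // k /=; rewrite geq_max => /andP[kk kN].
  rewrite cnE eR ler_RtoC cnC; apply: le_trans (bound k kk) _.
  apply: (@le_trans _ _ (`|M| * (cn e / (`|M| + 1)))); last first.
    by rewrite mulrCA ler_piMr ?(ltW e0')// ler_pdivrMr ?ltr_wpDl// mul1r lerDl.
  apply: ler_wpM2l => //; apply: le_trans (HN k kN).
  apply: ler_wpM2l; first exact: ltW (ewt_gt0 R hsig k).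
  by rewrite exprS ler_piMr// exprn_ile1// invS_le1.
(* The index 0 is excluded because [powR] gives 0 at base 0 and nonzero exponent, which would make
   the bound vanish. *)
exists (maxn k1 1), (`|M| * 3) => k; rewrite geq_max => /andP[kk k0].
rewrite cnE ler_RtoC; apply: le_trans (bound k kk) _.
by rewrite -mulrA; apply: ler_wpM2l => //; exact: ewt_pow_rate.
Qed.
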